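(* Let $\mathcal{S}\in\mathcal{A}$ be a critical point of $E$, with Gaussian curvature $K$. Then $\mathcal{S}$ satisfies the second-variation stability condition if and only if $$\int_{\mathcal{Y}}(\mathbf{t}\cdot\mathbf{z})^2c^2\,\mathrm{dl}\le\int_{\mathcal{S}}\big(|\nabla_{\mathcal{S}}c|^2+2Kc^2\big)\,\mathrm{da}\qquad\text{for all }c\in V_N,$$ where $V_N=\{c\in C^2(\mathcal{S},\mathbb{R}): c=0\text{ on }\mathcal{W}\}$.
   Context: Fix $\rho>0$ and $\theta_0\in[0,\pi)$. Let $\mathcal{C}=\{(x,y,z)\in\mathbb{R}^3: x^2+y^2=1,\ 0\le z\le\rho\}$, let $\mathbf{z}=(0,0,1)$, and let $\mathbf{r}(x,y,z)=(x,y,0)$ be the unit normal on $\mathcal{C}$ pointing away from its axis. Let $\mathcal{W}_1=\{(0,s,0):|s|\le1\}$, $\mathcal{W}_2=\{(-s\sin\theta_0,s\cos\theta_0,\rho):|s|\le 1\}$ and $\mathcal{W}=\mathcal{W}_1\cup\mathcal{W}_2$. Let $\mathcal{S}_0=\{(0,y,z):-1\le y\le 1,\ 0\le z\le\rho\}$. $\mathcal{A}$ is the collection of all surfaces $\mathcal{S}$ such that (1) there is an injective $f\in C^2(\mathcal{S}_0,\mathbb{R}^3)$ with $f(\mathcal{S}_0)=\mathcal{S}$; (2) $\partial\mathcal{S}$ consists of $\mathcal{W}$ and two curves lying on $\mathcal{C}$, i.e. $\mathcal{W}\subset\partial\mathcal{S}$ and $\mathcal{Y}:=\partial\mathcal{S}\setminus\mathcal{W}\subset\mathcal{C}$.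 Surfaces are understood to be regular, so that $\mathcal{S}\in\mathcal{A}$ is oriented by a unit normal field $\mathbf{n}$ of class $C^1$. Along $\partial\mathcal{S}$, $\mathbf{t}$ is the unit tangent and $\boldsymbol{\nu}$ is the outward unit conormal, with $\mathbf{t}=\mathbf{n}\times\boldsymbol{\nu}$. $\nabla_{\mathcal{S}}$ denotes the surface gradient (gradient of the extension that is constant in the normal direction) and $\mathrm{div}_{\mathcal{S}}=\mathrm{tr}\,\nabla_{\mathcal{S}}$. The curvature tensor is $\mathbf{L}=-\nabla_{\mathcal{S}}\mathbf{n}$, $H=\tfrac12\mathrm{tr}\,\mathbf{L}$, $K=\tfrac12[(\mathrm{tr}\,\mathbf{L})^2-\mathrm{tr}(\mathbf{L}^2)]$. The functional is $E(\mathcal{S})=\int_{\mathcal{S}}\sigma\,\mathrm{da}$ with $\sigma>0$ constant. Put $$V=\{\mathbf{v}\in C^2(\mathcal{S},\mathbb{R}^3): \mathbf{v}=(\mathbf{v}\cdot\mathbf{t})\mathbf{t}\text{ on }\mathcal{W},\ \mathbf{v}\cdot\mathbf{r}=0\text{ on }\mathcal{Y}\}.$$ Critical point: $\int_{\mathcal{S}}\sigma\,\mathrm{div}_{\mathcal{S}}\mathbf{v}\,\mathrm{da}=0$ for all $\mathbf{v}\in V$ (vanishing first variation). Second-variation stability condition: consider one-parameter families $f(t,\cdot)$ of injective $C^2$ maps $\mathcal{S}_0\to\mathbb{R}^3$, $C^2$ in $t$ near $0$, with $f(0,\mathcal{S}_0)=\mathcal{S}$ and $f(t,\mathcal{S}_0)\in\mathcal{A}$,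 points on the wires remaining on the wires and points of $\mathcal{Y}$ remaining on $\mathcal{C}$. With initial velocity $\mathbf{v}$ and initial acceleration $\mathbf{a}$ (viewed as fields on $\mathcal{S}$), one has $\mathbf{v}\in V$, $\mathbf{a}=(\mathbf{a}\cdot\mathbf{t})\mathbf{t}$ on $\mathcal{W}$, $\mathbf{a}\cdot\mathbf{r}=|\mathbf{v}\cdot\mathbf{z}|^2-|\mathbf{v}|^2$ on $\mathcal{Y}$, and the second variation of $E$ is $$\frac{d^2}{dt^2}E(f(t,\mathcal{S}_0))\Big|_{t=0}=\int_{\mathcal{S}}\sigma\big[|(\nabla_{\mathcal{S}}\mathbf{v})^{\top}\mathbf{n}|^2+(\mathrm{div}_{\mathcal{S}}\mathbf{v})^2-\mathrm{tr}((\nabla_{\mathcal{S}}\mathbf{v})^2)+\mathrm{div}_{\mathcal{S}}\mathbf{a}\big]\,\mathrm{da}.$$ $\mathcal{S}$ satisfies the second-variation stability condition if this quantity is $\ge0$ for all $\mathbf{v}\in V$ (with $\mathbf{a}$ subject to the stated constraints). *)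

(* Defs.v *)
From Stdlib Require Import Reals Lra ClassicalEpsilon.
From Coquelicot Require Import Coquelicot.
Open Scope R_scope.

Inductive axis := ax_x | ax_y | ax_z.

Definition vec := axis -> R.
Definition mat := axis -> axis -> R.

Definition mkvec (x y z : R) : vec :=
  fun i => match i with ax_x => x | ax_y => y | ax_z => z end.

Definition sum3 (F : axis -> R) : R := F ax_x + F ax_y + F ax_z.

Definition vscal (a : R) (u : vec) : vec := fun i => a * u i.
Definition vadd (u w : vec) : vec := fun i => u i + w i.
Definition vzero : vec := fun _ => 0.
Definition dot (u w : vec) : R := sum3 (fun i => u i * w i).
Definition vnorm (u : vec) : R := sqrt (dot u u).
Definition cross (u w : vec) : vec :=
  mkvec (u ax_y * w ax_z - u ax_z * w ax_y)
        (u ax_z * w ax_x - u ax_x * w ax_z)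
        (u ax_x * w ax_y - u ax_y * w ax_x).
Definition unit_vec (u : vec) : vec := vscal (/ vnorm u) u.

Definition mtrace (A : mat) : R := sum3 (fun i => A i i).
Definition mmul (A B : mat) : mat := fun i k => sum3 (fun j => A i j * B j k).
Definition mtr (A : mat) : mat := fun i j => A j i.
Definition mopp (A : mat) : mat := fun i j => - A i j.
Definition mapply (A : mat) (u : vec) : vec := fun i => sum3 (fun j => A i j * u j).

(** The point (0,y,z) of S_0 is written (y,z).  A function of class C^2 on the
    closed rectangle S_0 is represented by a C^2 function on the whole plane
    extending it: every function of class C^2 up to the boundary has such an
    extension, and on S_0, the closure of its interior, the derivatives up to
    order 2 do not depend on it.  Everything below looks at values and
    derivatives at points of S_0 only.  (The normal field of a regular surface
    is C^1 near S_0.) *)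

Definition dy (g : R -> R -> R) (y z : R) : R := Derive (fun s => g s z) y.
Definition dz (g : R -> R -> R) (y z : R) : R := Derive (fun s => g y s) z.

Definition C1 (g : R -> R -> R) : Prop :=
  forall y z,
    ex_derive (fun s => g s z) y /\ ex_derive (fun s => g y s) z /\
    continuity_2d_pt (dy g) y z /\ continuity_2d_pt (dz g) y z.

Definition C2 (g : R -> R -> R) : Prop := C1 g /\ C1 (dy g) /\ C1 (dz g).

Definition C2v (v : R -> R -> vec) : Prop := forall i, C2 (fun y z => v y z i).

Definition dyv (v : R -> R -> vec) (y z : R) : vec :=
  fun i => dy (fun y' z' => v y' z' i) y z.
Definition dzv (v : R -> R -> vec) (y z : R) : vec :=
  fun i => dz (fun y' z' => v y' z' i) y z.

Definition inS0 (rho y z : R) : Prop := -1 <= y <= 1 /\ 0 <= z <= rho.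

Definition in_bdS0 (rho y z : R) : Prop :=
  inS0 rho y z /\ (y = -1 \/ y = 1 \/ z = 0 \/ z = rho).

Definition ezed : vec := mkvec 0 0 1.

Definition cyl (rho : R) (p : vec) : Prop :=
  (p ax_x) ^ 2 + (p ax_y) ^ 2 = 1 /\ 0 <= p ax_z <= rho.

Definition cyl_normal (p : vec) : vec := mkvec (p ax_x) (p ax_y) 0.

Definition wire1 (p : vec) : Prop :=
  exists s, Rabs s <= 1 /\ p = mkvec 0 s 0.
Definition wire2 (rho theta0 : R) (p : vec) : Prop :=
  exists s, Rabs s <= 1 /\ p = mkvec (- s * sin theta0) (s * cos theta0) rho.
Definition wires (rho theta0 : R) (p : vec) : Prop :=
  wire1 p \/ wire2 rho theta0 p.

Definition area_vec (f : R -> R -> vec) (y z : R) : vec :=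
  cross (dyv f y z) (dzv f y z).

(** [f] parametrizes a surface S = f(S_0) of the class A.  The boundary of S is
    the image of the boundary of the rectangle. *)
Definition admissible (rho theta0 : R) (f : R -> R -> vec) : Prop :=
  C2v f /\
  (forall y z y' z', inS0 rho y z -> inS0 rho y' z' ->
     f y z = f y' z' -> y = y' /\ z = z') /\
  (forall y z, inS0 rho y z -> area_vec f y z <> vzero) /\
  (forall p, wires rho theta0 p -> exists y z, in_bdS0 rho y z /\ f y z = p) /\
  (forall y z, in_bdS0 rho y z -> ~ wires rho theta0 (f y z) -> cyl rho (f y z)).

Definition onY (rho theta0 : R) (f : R -> R -> vec) (y z : R) : Prop :=
  in_bdS0 rho y z /\ ~ wires rho theta0 (f y z).

(** Functions and vector fields on S are given by their composition with the
    injective immersion [f]; they are of class C^2 on S when this composition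
    is of class C^2 on S_0. *)

Definition normal (f : R -> R -> vec) (y z : R) : vec := unit_vec (area_vec f y z).

(** The reciprocal (dual) basis of the tangent basis (f_y, f_z). *)
Definition dual_y (f : R -> R -> vec) (y z : R) : vec :=
  let N := area_vec f y z in vscal (/ dot N N) (cross (dzv f y z) N).
Definition dual_z (f : R -> R -> vec) (y z : R) : vec :=
  let N := area_vec f y z in vscal (/ dot N N) (cross N (dyv f y z)).

(** The gradient of the extension of [c] that is constant in the normal
    direction: it is determined by [sgrad_dy], [sgrad_dz] and [sgrad_normal]. *)
Definition sgrad (f : R -> R -> vec) (c : R -> R -> R) (y z : R) : vec :=
  vadd (vscal (dy c y z) (dual_y f y z)) (vscal (dz c y z) (dual_z f y z)).

Lemma dot_self_neq0 (u : vec) : u <> vzero -> dot u u <> 0.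
Proof.
intros Hu H; apply Hu; apply FunctionalExtensionality.functional_extensionality.
unfold dot, sum3 in H; intros []; unfold vzero; nra.
Qed.

Lemma sgrad_dy f c y z :
  area_vec f y z <> vzero -> dot (sgrad f c y z) (dyv f y z) = dy c y z.
Proof.
intros H; apply dot_self_neq0 in H; revert H.
unfold sgrad, dual_y, dual_z, area_vec, dot, vadd, vscal, cross, sum3, mkvec.
intros H; field; exact H.
Qed.

Lemma sgrad_dz f c y z :
  area_vec f y z <> vzero -> dot (sgrad f c y z) (dzv f y z) = dz c y z.
Proof.
intros H; apply dot_self_neq0 in H; revert H.
unfold sgrad, dual_y, dual_z, area_vec, dot, vadd, vscal, cross, sum3, mkvec.
intros H; field; exact H.
Qed.

Lemma sgrad_normal f c y z : dot (sgrad f c y z) (normal f y z) = 0.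
Proof.
unfold normal, unit_vec, sgrad, dual_y, dual_z, area_vec.
set (k := / vnorm _); set (m := / dot _ _).
unfold dot, vadd, vscal, cross, sum3, mkvec; ring.
Qed.

(** Rows are the gradients of the components, so that [mapply (vgrad f v y z) w]
    is the derivative of [v] in the tangential direction [w]. *)
Definition vgrad (f : R -> R -> vec) (v : R -> R -> vec) (y z : R) : mat :=
  fun i => sgrad f (fun y' z' => v y' z' i) y z.

Definition sdiv (f : R -> R -> vec) (v : R -> R -> vec) (y z : R) : R :=
  mtrace (vgrad f v y z).

Definition curv_tensor (f : R -> R -> vec) (y z : R) : mat :=
  mopp (vgrad f (normal f) y z).

Definition gauss_curv (f : R -> R -> vec) (y z : R) : R :=
  let L := curv_tensor f y z in / 2 * ((mtrace L) ^ 2 - mtrace (mmul L L)).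

Definition surf_int (rho : R) (f : R -> R -> vec) (g : R -> R -> R) : R :=
  RInt (fun z => RInt (fun y => g y z * vnorm (area_vec f y z)) (-1) 1) 0 rho.

(** The edges of the rectangle are traversed counterclockwise; this is the
    orientation for which the unit tangent t, the normal n above and the outward
    unit conormal nu satisfy t = n x nu.  On every edge the parameter [s] is the
    coordinate that varies. *)

Inductive edge := e_bottom | e_right | e_top | e_left.

Definition edge_lo (e : edge) : R :=
  match e with e_bottom | e_top => -1 | e_right | e_left => 0 end.
Definition edge_hi (rho : R) (e : edge) : R :=
  match e with e_bottom | e_top => 1 | e_right | e_left => rho end.
Definition edge_y (e : edge) (s : R) : R :=
  match e with e_bottom | e_top => s | e_right => 1 | e_left => -1 end.
Definition edge_z (rho : R) (e : edge) (s : R) : R :=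
  match e with e_bottom => 0 | e_top => rho | e_right | e_left => s end.

Definition edge_vel (rho : R) (f : R -> R -> vec) (e : edge) (s : R) : vec :=
  let y := edge_y e s in let z := edge_z rho e s in
  match e with
  | e_bottom => dyv f y z
  | e_right => dzv f y z
  | e_top => vscal (-1) (dyv f y z)
  | e_left => vscal (-1) (dzv f y z)
  end.

Definition tangent (rho : R) (f : R -> R -> vec) (e : edge) (s : R) : vec :=
  unit_vec (edge_vel rho f e s).

(** The integral over Y of the function equal to [g e s] at the point of
    parameter [s] of the edge [e]. *)
Definition Y_int (rho theta0 : R) (f : R -> R -> vec) (g : edge -> R -> R) : R :=
  let I e :=
    RInt (fun s =>
      if excluded_middle_informative
           (onY rho theta0 f (edge_y e s) (edge_z rho e s))
      then g e s * vnorm (edge_vel rho f e s) else 0)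
      (edge_lo e) (edge_hi rho e) in
  I e_bottom + I e_right + I e_top + I e_left.

(** v = (v.t) t on W.  The unit tangent of the boundary is not defined at the
    corners of S; there the condition, for the tangent of the wire, follows by
    continuity. *)
Definition tangent_on_wires (rho theta0 : R) (f v : R -> R -> vec) : Prop :=
  forall e s, edge_lo e < s < edge_hi rho e ->
    wires rho theta0 (f (edge_y e s) (edge_z rho e s)) ->
    v (edge_y e s) (edge_z rho e s)
    = vscal (dot (v (edge_y e s) (edge_z rho e s)) (tangent rho f e s))
            (tangent rho f e s).

Definition inV (rho theta0 : R) (f v : R -> R -> vec) : Prop :=
  C2v v /\ tangent_on_wires rho theta0 f v /\
  (forall y z, onY rho theta0 f y z -> dot (v y z) (cyl_normal (f y z)) = 0).

Definition inVN (rho theta0 : R) (f : R -> R -> vec) (c : R -> R -> R) : Prop :=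
  C2 c /\ (forall y z, inS0 rho y z -> wires rho theta0 (f y z) -> c y z = 0).

Definition critical (rho theta0 sigma : R) (f : R -> R -> vec) : Prop :=
  forall v, inV rho theta0 f v ->
    surf_int rho f (fun y z => sigma * sdiv f v y z) = 0.

Definition acceleration (rho theta0 : R) (f v a : R -> R -> vec) : Prop :=
  C2v a /\ tangent_on_wires rho theta0 f a /\
  (forall y z, onY rho theta0 f y z ->
     dot (a y z) (cyl_normal (f y z))
     = (dot (v y z) ezed) ^ 2 - (vnorm (v y z)) ^ 2).

Definition second_variation (rho sigma : R) (f v a : R -> R -> vec) : R :=
  surf_int rho f (fun y z =>
    sigma * ((vnorm (mapply (mtr (vgrad f v y z)) (normal f y z))) ^ 2
             + (sdiv f v y z) ^ 2
             - mtrace (mmul (vgrad f v y z) (vgrad f v y z))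
             + sdiv f a y z)).

Definition second_variation_stable (rho theta0 sigma : R) (f : R -> R -> vec) : Prop :=
  forall v a, inV rho theta0 f v -> acceleration rho theta0 f v a ->
    0 <= second_variation rho sigma f v a.

(* Main.v *)
From Stdlib Require Import Reals Lra Lia FunctionalExtensionality ClassicalEpsilon.
From Coquelicot Require Import Coquelicot.
Require Import Defs.
Open Scope R_scope.

(** For a critical point and any [v] in V with any admissible acceleration, the
    second variation equals [sigma] times the quadratic form
      [Q c = int_S (|grad c|^2 + 2 K c^2) - int_Y (t . z)^2 c^2],
    evaluated at the normal component [c = v . n] ([second_variation_form]).
    Stability is thus nonnegativity of Q on the normal components of V, and it
    remains to compare these with the C^2 functions that vanish on the wires.

    Position of the wires.  A wire cannot end inside an edge of the rectangle:
    there the tangent of the edge would be both radial, being the tangent of the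
    wire, and orthogonal to the radius, because the boundary does not leave the
    cylinder ([wire_end_not_open]).  Hence the wires are two complete opposite
    edges, and Y is the other two ([admissible_wire_edges]).

    Criticality.  Write [[u,w] = u_y x w_z - u_z x w_y]; then
    [(div v) |f_y x f_z| = n . [v,f]], and Green's formula turns the integral of
    [n . [v,f]] into that of [v . [n,f]] plus a boundary term.  Fields vanishing on
    the boundary give [[n,f] = 0], that is H = 0 ([mean_curvature_zero]); fields
    tangent to the cylinder give that the conormal is radial
    ([conormal_projection]).  It points outwards because next to the wires the
    surface lies inside the cylinder ([kappa_gt0]).

    Second variation.  With [v = w + c n] the interior density is, up to exact
    forms, that of Q ([second_variation_density]).  The terms in [w] cancel
    because for H = 0 the derivative of [n] anticommutes with the rotation by a
    right angle of the tangent plane.  On Y the exact forms and the acceleration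
    term add up to [- (t . z)^2 c^2] ([boundary_density]); on the straight wires
    they vanish.

    Regularity.  As [f] is only C^2, the normal is only C^1.  Green's formula is
    therefore needed for two C^1 functions ([green]).  It follows from the case
    where one of them is C^2, by approximation with Steklov means.  The same
    approximation compares the two classes of functions [c], since Q is continuous
    in the C^1 norm: [v . n] is C^1 and is approached by C^2 functions vanishing on
    the wires ([form_nonneg_C1]); conversely [c n] is approached by fields of V
    ([form_nonneg_of_stable]). *)

(** * Functions of class C^1 and C^2 of two variables *)

Definition C0 (g : R -> R -> R) : Prop := forall y z, continuity_2d_pt g y z.

(** Same content as [C1], with the partial derivatives named instead of being
    computed by [Derive]: closure properties then also give the derivatives. *)
Definition has_C1 (g gy gz : R -> R -> R) : Prop :=
  C0 gy /\ C0 gz /\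
  forall y z, is_derive (fun s => g s z) y (gy y z) /\
              is_derive (fun s => g y s) z (gz y z).

Lemma funext2 (g h : R -> R -> R) : (forall y z, g y z = h y z) -> g = h.
Proof.
intros H; apply functional_extensionality; intros y.
apply functional_extensionality; intros z; apply H.
Qed.

Lemma has_C1_intro g : C1 g -> has_C1 g (dy g) (dz g).
Proof.
intros H; split; [|split].
- intros y z; apply (H y z).
- intros y z; apply (H y z).
- intros y z; destruct (H y z) as (H1 & H2 & _).
  split; apply Derive_correct; assumption.
Qed.

Lemma has_C1_dy g gy gz : has_C1 g gy gz -> dy g = gy.
Proof.
intros (_ & _ & H); apply funext2; intros y z.
apply is_derive_unique, (H y z).
Qed.

Lemma has_C1_dz g gy gz : has_C1 g gy gz -> dz g = gz.
Proof.
intros (_ & _ & H); apply funext2; intros y z.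
apply is_derive_unique, (H y z).
Qed.

Lemma has_C1_C1 g gy gz : has_C1 g gy gz -> C1 g.
Proof.
intros H y z; rewrite (has_C1_dy _ _ _ H), (has_C1_dz _ _ _ H).
destruct H as (H1 & H2 & H3); destruct (H3 y z) as (H4 & H5).
repeat split; try apply H1; try apply H2; eexists; eassumption.
Qed.

Lemma C1_C0 g : C1 g -> C0 g.
Proof.
intros H y z; apply differentiable_continuity_pt.
exists (dy g y z), (dz g y z).
apply filterdiff_differentiable_pt_lim.
apply is_derive_filterdiff.
- apply filter_forall; intros [u v]; simpl.
  apply Derive_correct, (H u v).
- apply Derive_correct, (H y z).
- apply continuity_2d_pt_filterlim; apply (H y z).
Qed.

Lemma C0_const k : C0 (fun _ _ => k).
Proof. intros y z; apply continuity_2d_pt_const. Qed.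

Lemma C0_plus g h : C0 g -> C0 h -> C0 (fun y z => g y z + h y z).
Proof. intros H K y z; apply continuity_2d_pt_plus; auto. Qed.

Lemma C0_minus g h : C0 g -> C0 h -> C0 (fun y z => g y z - h y z).
Proof. intros H K y z; apply continuity_2d_pt_minus; auto. Qed.

Lemma C0_opp g : C0 g -> C0 (fun y z => - g y z).
Proof. intros H y z; apply continuity_2d_pt_opp; auto. Qed.

Lemma C0_mult g h : C0 g -> C0 h -> C0 (fun y z => g y z * h y z).
Proof. intros H K y z; apply continuity_2d_pt_mult; auto. Qed.

Lemma C0_comp (phi : R -> R) g :
  (forall y z, continuity_pt phi (g y z)) -> C0 g -> C0 (fun y z => phi (g y z)).
Proof. intros H K y z; apply continuity_1d_2d_pt_comp; auto. Qed.

Lemma C0_y : C0 (fun y _ => y).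
Proof. intros y z; apply continuity_2d_pt_id1. Qed.

Lemma C0_z : C0 (fun _ z => z).
Proof. intros y z; apply continuity_2d_pt_id2. Qed.

Lemma C0_swap g : C0 g -> C0 (fun y z => g z y).
Proof.
intros H y z eps; destruct (H z y eps) as [d Hd]; exists d; intros u v Hu Hv.
apply Hd; assumption.
Qed.

Lemma C0_shift g a b : C0 g -> C0 (fun y z => g (y + a) (z + b)).
Proof.
intros H y z eps; destruct (H (y + a) (z + b) eps) as [d Hd]; exists d.
intros u v Hu Hv; apply Hd.
- replace (u + a - (y + a)) with (u - y) by ring; assumption.
- replace (v + b - (z + b)) with (v - z) by ring; assumption.
Qed.

Lemma C0_slice_y g z : C0 g -> forall y, continuous (fun s => g s z) y.
Proof.
intros H y; apply continuity_pt_filterlim; intros eps Heps.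
destruct (H y z (mkposreal eps Heps)) as [d Hd].
exists d; split; [apply d|]; intros x (_ & Hx); apply Hd.
- apply Hx.
- unfold Rminus; rewrite Rplus_opp_r, Rabs_R0; apply d.
Qed.

Lemma C0_slice_z g y : C0 g -> forall z, continuous (fun s => g y s) z.
Proof. intros H; apply (C0_slice_y (fun a b => g b a)); apply C0_swap, H. Qed.

Lemma has_C1_const k : has_C1 (fun _ _ => k) (fun _ _ => 0) (fun _ _ => 0).
Proof.
split; [apply C0_const|split; [apply C0_const|]].
intros y z; split; apply @is_derive_const.
Qed.

Lemma has_C1_y : has_C1 (fun y _ => y) (fun _ _ => 1) (fun _ _ => 0).
Proof.
split; [apply C0_const|split; [apply C0_const|]].
intros y z; split; [apply @is_derive_id|apply @is_derive_const].
Qed.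

Lemma has_C1_z : has_C1 (fun _ z => z) (fun _ _ => 0) (fun _ _ => 1).
Proof.
split; [apply C0_const|split; [apply C0_const|]].
intros y z; split; [apply @is_derive_const|apply @is_derive_id].
Qed.

Lemma has_C1_plus g gy gz h hy hz : has_C1 g gy gz -> has_C1 h hy hz ->
  has_C1 (fun y z => g y z + h y z) (fun y z => gy y z + hy y z)
         (fun y z => gz y z + hz y z).
Proof.
intros (G1 & G2 & G3) (H1 & H2 & H3).
split; [apply C0_plus; assumption|split; [apply C0_plus; assumption|]].
intros y z; split; apply @is_derive_plus; try apply G3; apply H3.
Qed.

Lemma has_C1_opp g gy gz : has_C1 g gy gz ->
  has_C1 (fun y z => - g y z) (fun y z => - gy y z) (fun y z => - gz y z).
Proof.
intros (G1 & G2 & G3).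
split; [apply C0_opp; assumption|split; [apply C0_opp; assumption|]].
intros y z; split; apply @is_derive_opp; apply G3.
Qed.

Lemma has_C1_minus g gy gz h hy hz : has_C1 g gy gz -> has_C1 h hy hz ->
  has_C1 (fun y z => g y z - h y z) (fun y z => gy y z - hy y z)
         (fun y z => gz y z - hz y z).
Proof.
intros G H; apply has_C1_plus; [exact G|apply has_C1_opp, H].
Qed.

Lemma has_C1_C0 g gy gz : has_C1 g gy gz -> C0 g.
Proof. intros H; eapply C1_C0, has_C1_C1, H. Qed.

Lemma has_C1_mult g gy gz h hy hz : has_C1 g gy gz -> has_C1 h hy hz ->
  has_C1 (fun y z => g y z * h y z)
         (fun y z => gy y z * h y z + g y z * hy y z)
         (fun y z => gz y z * h y z + g y z * hz y z).
Proof.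
intros G H; pose proof (has_C1_C0 _ _ _ G) as G0; pose proof (has_C1_C0 _ _ _ H) as H0.
destruct G as (G1 & G2 & G3), H as (H1 & H2 & H3).
split; [apply C0_plus; apply C0_mult; assumption|].
split; [apply C0_plus; apply C0_mult; assumption|].
intros y z; split.
- apply (is_derive_mult (fun s => g s z) (fun s => h s z) y (gy y z) (hy y z)).
  + apply G3. + apply H3. + intros; apply Rmult_comm.
- apply (is_derive_mult (fun s => g y s) (fun s => h y s) z (gz y z) (hz y z)).
  + apply G3. + apply H3. + intros; apply Rmult_comm.
Qed.

Lemma has_C1_comp (phi dphi : R -> R) g gy gz :
  (forall y z, is_derive phi (g y z) (dphi (g y z))) ->
  (forall y z, continuity_pt dphi (g y z)) ->
  has_C1 g gy gz ->
  has_C1 (fun y z => phi (g y z)) (fun y z => gy y z * dphi (g y z))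
         (fun y z => gz y z * dphi (g y z)).
Proof.
intros P1 P2 G; pose proof (has_C1_C0 _ _ _ G) as G0.
destruct G as (G1 & G2 & G3).
split; [apply C0_mult; [assumption|apply C0_comp; assumption]|].
split; [apply C0_mult; [assumption|apply C0_comp; assumption]|].
intros y z; split.
- apply (is_derive_comp phi (fun s => g s z)); [apply P1|apply G3].
- apply (is_derive_comp phi (fun s => g y s)); [apply P1|apply G3].
Qed.

Lemma C1_const k : C1 (fun _ _ => k).
Proof. eapply has_C1_C1, has_C1_const. Qed.

Lemma C1_plus g h : C1 g -> C1 h -> C1 (fun y z => g y z + h y z).
Proof. intros G H; eapply has_C1_C1, has_C1_plus; apply has_C1_intro; assumption. Qed.

Lemma C1_minus g h : C1 g -> C1 h -> C1 (fun y z => g y z - h y z).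
Proof. intros G H; eapply has_C1_C1, has_C1_minus; apply has_C1_intro; assumption. Qed.

Lemma C1_opp g : C1 g -> C1 (fun y z => - g y z).
Proof. intros G; eapply has_C1_C1, has_C1_opp; apply has_C1_intro; assumption. Qed.

Lemma C1_mult g h : C1 g -> C1 h -> C1 (fun y z => g y z * h y z).
Proof. intros G H; eapply has_C1_C1, has_C1_mult; apply has_C1_intro; assumption. Qed.

Lemma C1_comp (phi dphi : R -> R) g :
  (forall y z, is_derive phi (g y z) (dphi (g y z))) ->
  (forall y z, continuity_pt dphi (g y z)) ->
  C1 g -> C1 (fun y z => phi (g y z)).
Proof. intros P1 P2 G; eapply has_C1_C1, has_C1_comp; eauto using has_C1_intro. Qed.

Lemma C2_C1 g : C2 g -> C1 g.
Proof. intros H; apply H. Qed.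

Lemma has_C1_C2 g gy gz : has_C1 g gy gz -> C1 gy -> C1 gz -> C2 g.
Proof.
intros H Hy Hz; split; [eapply has_C1_C1, H|].
rewrite (has_C1_dy _ _ _ H), (has_C1_dz _ _ _ H); split; assumption.
Qed.

Lemma C2_const k : C2 (fun _ _ => k).
Proof. eapply has_C1_C2; [apply has_C1_const| |]; apply C1_const. Qed.

Lemma C2_y : C2 (fun y _ => y).
Proof. eapply has_C1_C2; [apply has_C1_y| |]; apply C1_const. Qed.

Lemma C2_z : C2 (fun _ z => z).
Proof. eapply has_C1_C2; [apply has_C1_z| |]; apply C1_const. Qed.

Lemma C2_plus g h : C2 g -> C2 h -> C2 (fun y z => g y z + h y z).
Proof.
intros (G1 & G2 & G3) (H1 & H2 & H3).
eapply has_C1_C2; [apply has_C1_plus; apply has_C1_intro; assumption| |];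
  apply C1_plus; assumption.
Qed.

Lemma C2_opp g : C2 g -> C2 (fun y z => - g y z).
Proof.
intros (G1 & G2 & G3).
eapply has_C1_C2; [apply has_C1_opp; apply has_C1_intro; assumption| |];
  apply C1_opp; assumption.
Qed.

Lemma C2_minus g h : C2 g -> C2 h -> C2 (fun y z => g y z - h y z).
Proof. intros G H; apply C2_plus; [exact G|apply C2_opp, H]. Qed.

Lemma C2_mult g h : C2 g -> C2 h -> C2 (fun y z => g y z * h y z).
Proof.
intros (G1 & G2 & G3) (H1 & H2 & H3).
eapply has_C1_C2; [apply has_C1_mult; apply has_C1_intro; assumption| |];
  apply C1_plus; apply C1_mult; assumption.
Qed.

Lemma C2_mixed g : C2 g -> forall y z, dy (dz g) y z = dz (dy g) y z.
Proof.
intros (H1 & H2 & H3) y z; apply (Schwarz g y z).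
- exists (mkposreal 1 Rlt_0_1); intros u v _ _.
  repeat split; [apply (H1 u v)|apply (H1 u v)|apply (H3 u v)|apply (H2 u v)].
- apply (H3 y z).
- apply (H2 y z).
Qed.

Lemma continuity_Rmax0 x : continuity_pt (Rmax 0) x.
Proof.
apply continuity_pt_ext with (fun s => (s + Rabs s) * / 2); [|reg].
intros t; unfold Rmax, Rabs; destruct (Rle_dec 0 t), (Rcase_abs t); lra.
Qed.

Lemma is_derive_pospart_sq x :
  is_derive (fun s => Rmax 0 s * Rmax 0 s) x (2 * Rmax 0 x).
Proof.
destruct (Rtotal_order x 0) as [H|[H|H]].
- apply is_derive_ext_loc with (fun _ => 0).
  + exists (mkposreal (- x) ltac:(lra)); intros y Hy.
    change (Rabs (y - x) < - x) in Hy; apply Rabs_def2 in Hy.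
    rewrite (Rmax_left 0 y) by lra; rewrite Rmult_0_l; reflexivity.
  + rewrite Rmax_left by lra; rewrite Rmult_0_r; apply @is_derive_const.
- subst x; rewrite Rmax_left by lra; rewrite Rmult_0_r.
  apply is_derive_Reals; intros eps Heps; exists (mkposreal eps Heps).
  intros h Hh Hh'; simpl in Hh'.
  rewrite Rplus_0_l, (Rmax_left 0 0) by lra.
  destruct (Rle_lt_dec h 0).
  + rewrite Rmax_left by lra.
    replace ((0 * 0 - 0 * 0) / h - 0) with 0 by (field; assumption).
    rewrite Rabs_R0; assumption.
  + rewrite Rmax_right by lra.
    replace ((h * h - 0 * 0) / h - 0) with h by (field; assumption); assumption.
- apply is_derive_ext_loc with (fun s => s * s).
  + exists (mkposreal x H); intros y Hy.
    change (Rabs (y - x) < x) in Hy; apply Rabs_def2 in Hy.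
    rewrite (Rmax_right 0 y) by lra; reflexivity.
  + rewrite Rmax_right by lra.
    auto_derive; [exact I|ring].
Qed.

(** Quantities positive on the rectangle only, such as the area element, are passed
    through this C^1 function: it leaves large values alone and keeps the others
    away from 0, so that roots and inverses are C^1 on the whole plane. *)
Definition lift_above (m s : R) : R :=
  s + Rmax 0 (2 * m - s) * Rmax 0 (2 * m - s) / (4 * m).

Lemma lift_above_id m s : 2 * m <= s -> lift_above m s = s.
Proof.
intros H; unfold lift_above; rewrite Rmax_left by lra; unfold Rdiv; ring.
Qed.

Lemma lift_above_ge m s : 0 < m -> m <= lift_above m s.
Proof.
intros Hm; destruct (Rle_lt_dec (2 * m) s).
- rewrite lift_above_id; lra.
- unfold lift_above; rewrite Rmax_right by lra.
  (* completing the square: the parabola has its minimum [m] at 0 *)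
  replace (s + (2 * m - s) * (2 * m - s) / (4 * m))
    with (m + s * s / (4 * m)) by (field; lra).
  assert (0 <= s * s / (4 * m)); [|lra].
  apply Rmult_le_pos; [nra|apply Rlt_le, Rinv_0_lt_compat; lra].
Qed.

Lemma C1_lift_above m g : C1 g -> C1 (fun y z => lift_above m (g y z)).
Proof.
intros H; unfold lift_above, Rdiv; apply C1_plus; [exact H|].
apply C1_mult; [|apply C1_const].
apply (C1_comp (fun s => Rmax 0 s * Rmax 0 s) (fun s => 2 * Rmax 0 s)
         (fun y z => 2 * m - g y z)).
- intros; apply is_derive_pospart_sq.
- intros y z; apply continuity_pt_mult.
  + apply continuity_pt_const; intros ? ?; reflexivity.
  + apply continuity_Rmax0.
- apply C1_minus; [apply C1_const|exact H].
Qed.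

Lemma C1_inv g : (forall y z, 0 < g y z) -> C1 g -> C1 (fun y z => / g y z).
Proof.
intros P H.
apply (C1_comp (fun s => / s) (fun s => - / (s ^ 2))); [| |exact H].
- intros y z; specialize (P y z); auto_derive; [lra|field; lra].
- intros y z; specialize (P y z); reg; intros K; nra.
Qed.

Lemma C1_sqrt g : (forall y z, 0 < g y z) -> C1 g -> C1 (fun y z => sqrt (g y z)).
Proof.
intros P H.
apply (C1_comp sqrt (fun s => / (2 * sqrt s))); [| |exact H].
- intros y z; specialize (P y z); auto_derive; [lra|field].
  apply Rgt_not_eq, sqrt_lt_R0, P.
- intros y z; specialize (P y z).
  assert (K := sqrt_lt_R0 _ P).
  apply continuity_pt_inv; [|lra].
  apply continuity_pt_mult; [apply continuity_pt_const; intros ? ?; reflexivity|].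
  apply continuity_pt_sqrt; lra.
Qed.

(** * Integrals of continuous functions *)

Lemma continuous_ex_RInt (f : R -> R) a b :
  (forall x, continuous f x) -> ex_RInt f a b.
Proof. intros H; apply (@ex_RInt_continuous R_CompleteNormedModule); intros; apply H. Qed.

Lemma ex_RInt_diff_bound f g a b M : a <= b ->
  ex_RInt f a b -> ex_RInt g a b ->
  (forall x, a <= x <= b -> Rabs (f x - g x) <= M) ->
  Rabs (RInt f a b - RInt g a b) <= (b - a) * M.
Proof.
intros Hab Hf Hg H.
replace (RInt f a b - RInt g a b) with (RInt (fun x => f x - g x) a b)
  by exact (RInt_minus f g a b Hf Hg).
apply abs_RInt_le_const; [exact Hab|apply @ex_RInt_minus; assumption|exact H].
Qed.

Lemma C0_RInt_shift F a b : a <= b -> C0 F ->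
  C0 (fun y z => RInt (fun s => F (y + s) z) a b).
Proof.
intros Hab HF y0 z0 eps.
assert (Hc : 0 < b - a + 1) by lra.
assert (He : 0 < eps / (b - a + 1)) by (apply Rdiv_lt_0_compat; [apply eps|lra]).
destruct (uniform_continuity_2d F (y0 + a - 1) (y0 + b + 1) (z0 - 1) (z0 + 1)
  (fun x y _ _ => HF x y) (mkposreal _ He)) as [d Hd]; simpl in Hd.
assert (Hm : 0 < Rmin d 1) by (apply Rmin_pos; [apply d|lra]).
exists (mkposreal _ Hm); simpl; intros u v Hu Hv.
assert (Rmin d 1 <= d) by apply Rmin_l; assert (Rmin d 1 <= 1) by apply Rmin_r.
assert (Hu' : Rabs (u - y0) < 1) by lra; apply Rabs_def2 in Hu'.
assert (Hv' : Rabs (v - z0) < 1) by lra; apply Rabs_def2 in Hv'.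
apply Rle_lt_trans with ((b - a) * (eps / (b - a + 1))).
- assert (HC : forall p q, ex_RInt (fun s => F (p + s) q) a b).
  { intros p q; apply continuous_ex_RInt; intros x.
    apply (continuous_ext (fun s => F (s + p) (q + 0))).
    - intros s; rewrite Rplus_0_r, Rplus_comm; reflexivity.
    - apply (C0_slice_y (fun y z => F (y + p) (z + 0))), C0_shift, HF. }
  apply ex_RInt_diff_bound; auto.
  intros x Hx; apply Rlt_le, Hd; try lra.
  replace (u + x - (y0 + x)) with (u - y0) by ring; lra.
- apply Rmult_lt_reg_r with (b - a + 1); [lra|].
  replace ((b - a) * (eps / (b - a + 1)) * (b - a + 1))
    with ((b - a) * eps) by (field; lra).
  assert (0 < eps) by apply eps; nra.
Qed.

Lemma continuous_RInt_y F a b : a <= b -> C0 F ->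
  forall z, continuous (fun z => RInt (fun y => F y z) a b) z.
Proof.
intros Hab HF z.
apply (continuous_ext (fun z => RInt (fun s => F (0 + s) z) a b)).
- intros t; apply RInt_ext; intros s _; rewrite Rplus_0_l; reflexivity.
- apply (C0_slice_z (fun y z => RInt (fun s => F (y + s) z) a b) 0).
  apply C0_RInt_shift; assumption.
Qed.

Lemma is_derive_RInt_y G Gz a b z : C0 G -> C0 Gz ->
  (forall y z, is_derive (fun t => G y t) z (Gz y z)) ->
  is_derive (fun z => RInt (fun y => G y z) a b) z (RInt (fun y => Gz y z) a b).
Proof.
intros HG HGz HD.
assert (E : forall u y, Derive (fun t => G y t) u = Gz y u)
  by (intros; apply is_derive_unique, HD).
rewrite (RInt_ext _ (fun y => Derive (fun t => G y t) z))
  by (intros; symmetry; apply E).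
apply (is_derive_RInt_param (fun z y => G y z) a b z).
- apply filter_forall; intros u t _; eexists; apply HD.
- intros t _; apply (continuity_2d_pt_ext (fun u v => Gz v u)).
  + intros u v; symmetry; apply E.
  + apply (C0_swap Gz HGz).
- apply filter_forall; intros u; apply continuous_ex_RInt; intros x.
  apply (C0_slice_y G u HG).
Qed.

(** * Approximation of C^1 functions by C^2 functions *)

Definition avg_y (h : R) (g : R -> R -> R) (y z : R) : R :=
  / h * RInt (fun s => g (y + s) z) 0 h.

Definition avg_z (h : R) (g : R -> R -> R) (y z : R) : R :=
  avg_y h (fun a b => g b a) z y.

(** Means over forward squares, so that the value at a point of the rectangle uses
    values of [g] slightly outside it. *)
Definition steklov (h : R) (g : R -> R -> R) : R -> R -> R := avg_z h (avg_y h g).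

Lemma C0_avg_y h g : 0 < h -> C0 g -> C0 (avg_y h g).
Proof.
intros Hh Hg; apply C0_mult; [apply C0_const|].
apply C0_RInt_shift; [lra|exact Hg].
Qed.

Lemma C0_avg_z h g : 0 < h -> C0 g -> C0 (avg_z h g).
Proof.
intros Hh Hg; apply (C0_swap (avg_y h (fun a b => g b a))).
apply C0_avg_y; [exact Hh|apply C0_swap, Hg].
Qed.

(** Averaging in [y] commutes with differentiation in [z]; in the direction of
    averaging it produces a derivative out of mere continuity. *)
Lemma avg_y_derive_z h g gz : C0 g -> C0 gz ->
  (forall y z, is_derive (fun t => g y t) z (gz y z)) ->
  forall y z, is_derive (fun t => avg_y h g y t) z (avg_y h gz y z).
Proof.
intros Hg Hgz H y z; unfold avg_y.
apply is_derive_scal.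
apply (is_derive_RInt_y (fun s t => g (y + s) t) (fun s t => gz (y + s) t)).
- intros a b; apply (continuity_2d_pt_ext (fun s t => g (s + y) (t + 0))).
  + intros; rewrite Rplus_0_r, (Rplus_comm y); reflexivity.
  + apply C0_shift, Hg.
- intros a b; apply (continuity_2d_pt_ext (fun s t => gz (s + y) (t + 0))).
  + intros; rewrite Rplus_0_r, (Rplus_comm y); reflexivity.
  + apply C0_shift, Hgz.
- intros a b; apply H.
Qed.

Lemma avg_y_primitive h g y z : C0 g ->
  avg_y h g y z = / h * (RInt (fun s => g s z) 0 (y + h) - RInt (fun s => g s z) 0 y).
Proof.
intros Hg; unfold avg_y; f_equal.
assert (EX : forall a b, ex_RInt (fun s => g s z) a b)
  by (intros; apply continuous_ex_RInt, C0_slice_y, Hg).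
assert (CL := RInt_comp_lin (fun s => g s z) 1 y 0 h (EX _ _)).
rewrite Rmult_0_r, Rplus_0_l, Rmult_1_l, (Rplus_comm h y) in CL.
replace (RInt (fun s => g (y + s) z) 0 h) with (RInt (fun s => g s z) y (y + h)).
2:{ rewrite <- CL; apply RInt_ext; intros s _.
    change (1 * g (1 * s + y) z = g (y + s) z).
    rewrite !Rmult_1_l, Rplus_comm; reflexivity. }
assert (C := RInt_Chasles (fun s => g s z) 0 y (y + h) (EX _ _) (EX _ _)).
change plus with Rplus in C; simpl in C; lra.
Qed.

Lemma avg_y_derive_y h g : C0 g ->
  forall y z, is_derive (fun s => avg_y h g s z) y (/ h * (g (y + h) z - g y z)).
Proof.
intros Hg y z.
apply (is_derive_ext
  (fun y => / h * (RInt (fun s => g s z) 0 (y + h) - RInt (fun s => g s z) 0 y))).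
{ intros t; symmetry; apply avg_y_primitive, Hg. }
assert (P : forall x, is_derive (fun u => RInt (fun s => g s z) 0 u) x (g x z)).
{ intros x; apply (is_derive_RInt (fun s => g s z) _ 0).
  - apply filter_forall; intros u; apply (@RInt_correct R_CompleteNormedModule).
    apply continuous_ex_RInt, C0_slice_y, Hg.
  - apply C0_slice_y, Hg. }
apply is_derive_scal, @is_derive_minus; [|apply P].
replace (g (y + h) z) with (1 * g (y + h) z) by ring.
apply (is_derive_comp (fun u => RInt (fun s => g s z) 0 u) (fun y => y + h)).
- apply P.
- auto_derive; [exact I|reflexivity].
Qed.

Lemma avg_y_derive_y' h g gy : 0 < h -> C0 g -> C0 gy ->
  (forall y z, is_derive (fun t => g t z) y (gy y z)) ->
  forall y z, is_derive (fun t => avg_y h g t z) y (avg_y h gy y z).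
Proof.
intros Hh Hg Hgy H y z.
rewrite (avg_y_primitive h gy y z Hgy).
assert (FTC : forall x, RInt (fun s => gy s z) 0 x = g x z - g 0 z).
{ intros x; apply is_RInt_unique.
  apply (is_RInt_derive (fun s => g s z) (fun s => gy s z)).
  - intros; apply H. - intros; apply (C0_slice_y gy z Hgy). }
rewrite !FTC.
replace (g (y + h) z - g 0 z - (g y z - g 0 z)) with (g (y + h) z - g y z) by ring.
apply avg_y_derive_y, Hg.
Qed.

Lemma steklov_has_C1 h g gy gz : 0 < h -> has_C1 g gy gz ->
  has_C1 (steklov h g) (steklov h gy) (steklov h gz).
Proof.
intros Hh H; assert (Hg := has_C1_C0 _ _ _ H).
destruct H as (Hy & Hz & HD).
assert (D1 := avg_y_derive_y' h g gy Hh Hg Hy (fun y z => proj1 (HD y z))).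
assert (D2 := avg_y_derive_z h g gz Hg Hz (fun y z => proj2 (HD y z))).
assert (K := C0_avg_y h g Hh Hg).
assert (Ky := C0_avg_y h gy Hh Hy).
assert (Kz := C0_avg_y h gz Hh Hz).
split; [apply C0_avg_z; assumption|split; [apply C0_avg_z; assumption|]].
intros y z; split.
- apply (avg_y_derive_z h (fun a b => avg_y h g b a) (fun a b => avg_y h gy b a));
    try apply C0_swap; auto.
- apply (avg_y_derive_y' h (fun a b => avg_y h g b a) (fun a b => avg_y h gz b a));
    try apply C0_swap; auto.
Qed.

(** One averaging gains one order of differentiability. *)
Lemma steklov_C1 h g : 0 < h -> C0 g -> C1 (steklov h g).
Proof.
intros Hh Hg.
assert (Sh : C0 (fun y z => / h * (g (y + h) z - g y z))).
{ apply C0_mult; [apply C0_const|apply C0_minus; [|exact Hg]].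
  intros y z; apply (continuity_2d_pt_ext (fun y z => g (y + h) (z + 0))).
  - intros; rewrite Rplus_0_r; reflexivity.
  - apply C0_shift, Hg. }
assert (K := C0_avg_y h g Hh Hg).
eapply has_C1_C1 with
  (gy := avg_z h (fun y z => / h * (g (y + h) z - g y z)))
  (gz := fun y z => / h * (avg_y h g y (z + h) - avg_y h g y z)).
split; [apply C0_avg_z; assumption|split].
- apply C0_mult; [apply C0_const|apply C0_minus; [|exact K]].
  intros y z; apply (continuity_2d_pt_ext (fun y z => avg_y h g (y + 0) (z + h))).
  + intros; rewrite Rplus_0_r; reflexivity.
  + apply C0_shift, K.
- intros y z; split.
  + apply (avg_y_derive_z h (fun a b => avg_y h g b a)
             (fun a b => / h * (g (b + h) a - g b a))).
    * apply C0_swap, K.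
    * apply (C0_swap _ Sh).
    * intros a b; apply avg_y_derive_y, Hg.
  + apply (avg_y_derive_y h (fun a b => avg_y h g b a)), C0_swap, K.
Qed.

Lemma steklov_C2 h g : 0 < h -> C1 g -> C2 (steklov h g).
Proof.
intros Hh Hg; assert (H := has_C1_intro g Hg).
eapply has_C1_C2; [apply steklov_has_C1; [exact Hh|apply H]| |];
  apply steklov_C1; try exact Hh; apply H.
Qed.

Lemma avg_bound h f c eps : 0 < h -> (forall x, continuous f x) ->
  (forall s, 0 <= s <= h -> Rabs (f s - c) <= eps) ->
  Rabs (/ h * RInt f 0 h - c) <= eps.
Proof.
intros Hh Hf H.
assert (K := ex_RInt_diff_bound f (fun _ => c) 0 h eps (Rlt_le _ _ Hh)
  (continuous_ex_RInt _ _ _ Hf)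
  (continuous_ex_RInt _ _ _ (fun x => continuous_const c x)) H).
rewrite RInt_const in K; change scal with Rmult in K; simpl in K.
rewrite Rminus_0_r in K.
replace (/ h * RInt f 0 h - c) with (/ h * (RInt f 0 h - h * c)) by (field; lra).
rewrite Rabs_mult, (Rabs_right (/ h)) by (apply Rle_ge, Rlt_le, Rinv_0_lt_compat, Hh).
apply Rmult_le_reg_l with h; [exact Hh|].
rewrite <- Rmult_assoc, Rinv_r, Rmult_1_l by lra; exact K.
Qed.

Lemma steklov_bound h g y z eps : 0 < h -> C0 g ->
  (forall s t, 0 <= s <= h -> 0 <= t <= h ->
     Rabs (g (y + s) (z + t) - g y z) <= eps) ->
  Rabs (steklov h g y z - g y z) <= eps.
Proof.
intros Hh Hg H; unfold steklov, avg_z; unfold avg_y at 1.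
assert (K := C0_avg_y h g Hh Hg).
apply avg_bound; [exact Hh| |].
- intros x; apply (continuous_ext (fun t => avg_y h g (y + 0) (t + z))).
  + intros t; rewrite Rplus_0_r, Rplus_comm; reflexivity.
  + apply (C0_slice_z (fun a b => avg_y h g (a + 0) (b + z)) y), C0_shift, K.
- intros t Ht; apply avg_bound; [exact Hh| |].
  + intros x; apply (continuous_ext (fun s => g (s + y) ((z + t) + 0))).
    * intros s; rewrite Rplus_0_r, Rplus_comm; reflexivity.
    * apply (C0_slice_y (fun a b => g (a + y) (b + 0))), C0_shift, Hg.
  + intros s Hs; apply H; assumption.
Qed.

(** * Uniform convergence on the rectangle *)

Lemma C0_eps y z g : C0 g -> forall eps, 0 < eps ->
  exists d : posreal, forall u v, Rabs (u - y) < d -> Rabs (v - z) < d ->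
    Rabs (g u v - g y z) < eps.
Proof. intros H eps He; exact (H y z (mkposreal eps He)). Qed.

(** Compactness is used through a Lebesgue number: [delta] is chosen below half the
    value at the centre, so a lower bound for the radii bounds [g] as well. *)
Lemma positive_bounded_below rho g : C0 g ->
  (forall y z, inS0 rho y z -> 0 < g y z) ->
  exists m, 0 < m /\ forall y z, inS0 rho y z -> m <= g y z.
Proof.
intros Hg Hp.
assert (E : forall u v, exists d : posreal, inS0 rho u v ->
  d <= g u v / 2 /\
  forall y z, Rabs (y - u) < d -> Rabs (z - v) < d -> g u v / 2 <= g y z).
{ intros u v; destruct (Rlt_dec 0 (g u v)) as [P|P].
  - destruct (C0_eps u v g Hg (g u v / 2)) as [d Hd]; [lra|].
    assert (Hm : 0 < Rmin d (g u v / 2)) by (apply Rmin_pos; [apply d|lra]).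
    exists (mkposreal _ Hm); simpl; intros _.
    split; [apply Rmin_r|]; intros y z Hy Hz.
    assert (K := Rmin_l d (g u v / 2)).
    assert (Q := Hd y z ltac:(lra) ltac:(lra)); apply Rabs_def2 in Q; lra.
  - exists (mkposreal 1 Rlt_0_1); intros K; apply Hp in K; lra. }
set (delta u v := proj1_sig (constructive_indefinite_description _ (E u v))).
assert (D : forall u v, inS0 rho u v -> delta u v <= g u v / 2 /\
  forall y z, Rabs (y - u) < delta u v -> Rabs (z - v) < delta u v ->
  g u v / 2 <= g y z)
  by (intros u v; exact (proj2_sig (constructive_indefinite_description _ (E u v)))).
destruct (compactness_value_2d (-1) 1 0 rho delta) as [d Hd].
exists d; split; [apply d|]; intros y z (Hy & Hz).
apply Rnot_lt_le; intros K; apply (Hd y z Hy Hz).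
intros (u & v & Hu & Hv & H1 & H2 & H3).
destruct (D u v (conj Hu Hv)) as (D1 & D2); specialize (D2 y z H1 H2); lra.
Qed.

Lemma bounded_on_S0 rho g : C0 g ->
  exists M, 0 < M /\ forall y z, inS0 rho y z -> Rabs (g y z) <= M.
Proof.
intros Hg.
assert (P : forall y z, 0 < 1 + Rabs (g y z))
  by (intros y z; assert (K := Rabs_pos (g y z)); lra).
assert (HC : C0 (fun y z => 1 + Rabs (g y z))).
{ apply C0_plus; [apply C0_const|].
  apply C0_comp; [intros; apply Rcontinuity_abs|exact Hg]. }
destruct (positive_bounded_below rho (fun y z => / (1 + Rabs (g y z)))) as (m & Hm & H).
- intros y z; apply continuity_2d_pt_inv; [apply HC|specialize (P y z); lra].
- intros y z _; apply Rinv_0_lt_compat, P.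
- exists (/ m); split; [apply Rinv_0_lt_compat, Hm|]; intros y z HS.
  specialize (H y z HS); specialize (P y z).
  apply Rinv_le_contravar in H; [|exact Hm]; rewrite Rinv_inv in H; lra.
Qed.

(** Continuity is made part of the convergence: it provides the bounds on the
    rectangle on which convergence of products depends. *)
Definition cv0 (rho : R) (gk : nat -> R -> R -> R) (g : R -> R -> R) : Prop :=
  (forall k, C0 (gk k)) /\ C0 g /\
  forall eps, 0 < eps -> exists N, forall k, (N <= k)%nat ->
  forall y z, inS0 rho y z -> Rabs (gk k y z - g y z) <= eps.

Definition cv1 (rho : R) (gk : nat -> R -> R -> R) (g : R -> R -> R) : Prop :=
  (forall k, C1 (gk k)) /\ C1 g /\
  cv0 rho gk g /\ cv0 rho (fun k => dy (gk k)) (dy g) /\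
  cv0 rho (fun k => dz (gk k)) (dz g).

Lemma cv0_ext rho gk g hk h :
  (forall k y z, gk k y z = hk k y z) -> (forall y z, g y z = h y z) ->
  cv0 rho gk g -> cv0 rho hk h.
Proof.
intros E1 E2 H; replace hk with gk; [replace h with g; [exact H|apply funext2, E2]|].
apply functional_extensionality; intros k; apply funext2, E1.
Qed.

Lemma cv0_const rho g : C0 g -> cv0 rho (fun _ => g) g.
Proof.
intros Hg; split; [auto|split; [exact Hg|]].
intros eps He; exists 0%nat; intros; rewrite Rminus_eq_0, Rabs_R0; lra.
Qed.

Lemma cv0_plus rho gk g hk h : cv0 rho gk g -> cv0 rho hk h ->
  cv0 rho (fun k y z => gk k y z + hk k y z) (fun y z => g y z + h y z).
Proof.
intros (Cgk & Cg & G) (Chk & Ch & H).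
split; [intros k; exact (C0_plus _ _ (Cgk k) (Chk k))|split; [exact (C0_plus _ _ Cg Ch)|]].
intros eps He.
destruct (G (eps / 2)) as [N1 H1]; [lra|]; destruct (H (eps / 2)) as [N2 H2]; [lra|].
exists (N1 + N2)%nat; intros k Hk y z HS.
specialize (H1 k ltac:(lia) y z HS); specialize (H2 k ltac:(lia) y z HS).
replace (gk k y z + hk k y z - (g y z + h y z))
  with ((gk k y z - g y z) + (hk k y z - h y z)) by ring.
eapply Rle_trans; [apply Rabs_triang|lra].
Qed.

Lemma cv0_mult rho gk g hk h : cv0 rho gk g -> cv0 rho hk h ->
  cv0 rho (fun k y z => gk k y z * hk k y z) (fun y z => g y z * h y z).
Proof.
intros (Cgk & Cg & G) (Chk & Ch & H).
split; [intros k; exact (C0_mult _ _ (Cgk k) (Chk k))|split; [exact (C0_mult _ _ Cg Ch)|]].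
intros eps He; destruct (bounded_on_S0 rho g Cg) as (A & HA & BA).
destruct (bounded_on_S0 rho h Ch) as (B & HB & BB).
set (e := Rmin 1 (eps / (A + B + 1))).
assert (He' : 0 < e) by (apply Rmin_pos; [lra|apply Rdiv_lt_0_compat; lra]).
destruct (G e He') as [N1 H1]; destruct (H e He') as [N2 H2].
exists (N1 + N2)%nat; intros k Hk y z HS.
specialize (H1 k ltac:(lia) y z HS); specialize (H2 k ltac:(lia) y z HS).
specialize (BA y z HS); specialize (BB y z HS).
replace (gk k y z * hk k y z - g y z * h y z)
  with ((gk k y z - g y z) * (hk k y z - h y z) +
        ((gk k y z - g y z) * h y z + g y z * (hk k y z - h y z))) by ring.
assert (E1 : e <= 1) by apply Rmin_l.
assert (E2 : e * (A + B + 1) <= eps).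
{ apply Rle_trans with (eps / (A + B + 1) * (A + B + 1)).
  - apply Rmult_le_compat_r; [lra|apply Rmin_r].
  - right; field; lra. }
eapply Rle_trans; [apply Rabs_triang|].
eapply Rle_trans; [apply Rplus_le_compat_l, Rabs_triang|].
rewrite !Rabs_mult.
assert (P1 := Rabs_pos (gk k y z - g y z)); assert (P2 := Rabs_pos (hk k y z - h y z)).
assert (P3 := Rabs_pos (g y z)); assert (P4 := Rabs_pos (h y z)).
assert (Rabs (gk k y z - g y z) * Rabs (hk k y z - h y z) <= e * 1)
  by (apply Rmult_le_compat; lra).
assert (Rabs (gk k y z - g y z) * Rabs (h y z) <= e * B)
  by (apply Rmult_le_compat; lra).
assert (Rabs (g y z) * Rabs (hk k y z - h y z) <= A * e)
  by (apply Rmult_le_compat; lra).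
nra.
Qed.

Lemma cv0_minus rho gk g hk h : cv0 rho gk g -> cv0 rho hk h ->
  cv0 rho (fun k y z => gk k y z - hk k y z) (fun y z => g y z - h y z).
Proof.
intros G H.
apply (cv0_ext rho (fun k y z => gk k y z + -1 * hk k y z) (fun y z => g y z + -1 * h y z));
  try (intros; ring).
apply cv0_plus; [exact G|].
exact (cv0_mult rho _ _ _ _ (cv0_const rho _ (C0_const (-1))) H).
Qed.

Lemma cv1_intro rho gk ak bk g a b :
  (forall k, has_C1 (gk k) (ak k) (bk k)) -> has_C1 g a b ->
  cv0 rho gk g -> cv0 rho ak a -> cv0 rho bk b -> cv1 rho gk g.
Proof.
intros Hk H H0 H1 H2.
split; [intros k; exact (has_C1_C1 _ _ _ (Hk k))|split; [exact (has_C1_C1 _ _ _ H)|]].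
split; [exact H0|split].
- apply (cv0_ext rho ak a); [| |exact H1].
  + intros k y z; rewrite (has_C1_dy _ _ _ (Hk k)); reflexivity.
  + intros y z; rewrite (has_C1_dy _ _ _ H); reflexivity.
- apply (cv0_ext rho bk b); [| |exact H2].
  + intros k y z; rewrite (has_C1_dz _ _ _ (Hk k)); reflexivity.
  + intros y z; rewrite (has_C1_dz _ _ _ H); reflexivity.
Qed.

Lemma cv1_const rho g : C1 g -> cv1 rho (fun _ => g) g.
Proof.
intros Hg; pose proof (has_C1_intro g Hg) as K.
apply (cv1_intro rho _ _ _ _ _ _ (fun _ => K) K); apply cv0_const;
  [apply C1_C0, Hg|apply K|apply K].
Qed.

Lemma cv1_plus rho gk g hk h : cv1 rho gk g -> cv1 rho hk h ->
  cv1 rho (fun k y z => gk k y z + hk k y z) (fun y z => g y z + h y z).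
Proof.
intros (Cgk & Cg & G1 & G2 & G3) (Chk & Ch & H1 & H2 & H3).
apply (cv1_intro rho _ _ _ _ _ _
  (fun k => has_C1_plus _ _ _ _ _ _ (has_C1_intro _ (Cgk k)) (has_C1_intro _ (Chk k)))
  (has_C1_plus _ _ _ _ _ _ (has_C1_intro _ Cg) (has_C1_intro _ Ch)));
  apply cv0_plus; assumption.
Qed.

Lemma cv1_mult rho gk g hk h : cv1 rho gk g -> cv1 rho hk h ->
  cv1 rho (fun k y z => gk k y z * hk k y z) (fun y z => g y z * h y z).
Proof.
intros (Cgk & Cg & G1 & G2 & G3) (Chk & Ch & H1 & H2 & H3).
apply (cv1_intro rho _ _ _ _ _ _
  (fun k => has_C1_mult _ _ _ _ _ _ (has_C1_intro _ (Cgk k)) (has_C1_intro _ (Chk k)))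
  (has_C1_mult _ _ _ _ _ _ (has_C1_intro _ Cg) (has_C1_intro _ Ch)));
  [|apply cv0_plus|apply cv0_plus]; apply cv0_mult; assumption.
Qed.

Lemma cv1_minus rho gk g hk h : cv1 rho gk g -> cv1 rho hk h ->
  cv1 rho (fun k y z => gk k y z - hk k y z) (fun y z => g y z - h y z).
Proof.
intros (Cgk & Cg & G1 & G2 & G3) (Chk & Ch & H1 & H2 & H3).
apply (cv1_intro rho _ _ _ _ _ _
  (fun k => has_C1_minus _ _ _ _ _ _ (has_C1_intro _ (Cgk k)) (has_C1_intro _ (Chk k)))
  (has_C1_minus _ _ _ _ _ _ (has_C1_intro _ Cg) (has_C1_intro _ Ch)));
  apply cv0_minus; assumption.
Qed.

Definition mesh (k : nat) : R := / (INR k + 1).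

Lemma mesh_pos k : 0 < mesh k.
Proof. apply Rinv_0_lt_compat; assert (K := pos_INR k); lra. Qed.

Lemma mesh_small d : 0 < d -> exists N, forall k, (N <= k)%nat -> mesh k <= d.
Proof.
intros Hd; destruct (INR_unbounded (/ d)) as [N HN]; exists N; intros k Hk.
apply le_INR in Hk; unfold mesh; rewrite <- (Rinv_inv d).
apply Rinv_le_contravar; [apply Rinv_0_lt_compat, Hd|lra].
Qed.

Lemma steklov_cv0 rho g : C0 g -> cv0 rho (fun k => steklov (mesh k) g) g.
Proof.
intros Hg; split; [intros k; apply C1_C0, steklov_C1; [apply mesh_pos|exact Hg]|].
split; [exact Hg|]; intros eps He.
destruct (uniform_continuity_2d g (-1) 2 0 (rho + 1) (fun x y _ _ => Hg x y)
  (mkposreal eps He)) as [d Hd]; simpl in Hd.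
destruct (mesh_small (Rmin (d / 2) 1)) as [N HN].
{ apply Rmin_pos; [assert (0 < d) by apply d; lra|lra]. }
exists N; intros k Hk y z (Hy & Hz).
specialize (HN k Hk); assert (M := mesh_pos k).
assert (Hmd := Rmin_l (d / 2) 1); assert (Hm1 := Rmin_r (d / 2) 1).
assert (0 < d) by apply d.
apply steklov_bound; [exact M|exact Hg|]; intros s t Hs Ht.
apply Rlt_le, Hd; try lra.
- replace (y + s - y) with s by ring; rewrite Rabs_right; lra.
- replace (z + t - z) with t by ring; rewrite Rabs_right; lra.
Qed.

Lemma C1_approx rho g : C1 g -> exists gk, (forall k, C2 (gk k)) /\ cv1 rho gk g.
Proof.
intros Hg; assert (K := has_C1_intro g Hg).
exists (fun k => steklov (mesh k) g); split.
- intros k; apply steklov_C2; [apply mesh_pos|exact Hg].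
- apply (cv1_intro rho _ _ _ _ _ _ (fun k => steklov_has_C1 (mesh k) _ _ _ (mesh_pos k) K) K);
    apply steklov_cv0; [apply C1_C0, Hg|apply K|apply K].
Qed.

(** Two successive averages: one reaches C^1, the other C^2. *)
Lemma C0_approx rho g : C0 g -> exists gk, (forall k, C2 (gk k)) /\ cv0 rho gk g.
Proof.
intros Hg.
assert (E : forall k, exists h, C2 h /\
  forall y z, inS0 rho y z -> Rabs (h y z - g y z) <= mesh k).
{ intros k; assert (M := mesh_pos k).
  destruct (proj2 (proj2 (steklov_cv0 rho g Hg)) (mesh k / 2)) as [N HN]; [lra|].
  set (g1 := steklov (mesh N) g) in *.
  assert (Hg1 : C1 g1) by (apply steklov_C1; [apply mesh_pos|exact Hg]).
  destruct (proj2 (proj2 (steklov_cv0 rho g1 (C1_C0 _ Hg1))) (mesh k / 2)) as [N' HN']; [lra|].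
  exists (steklov (mesh N') g1); split.
  - apply steklov_C2; [apply mesh_pos|exact Hg1].
  - intros y z HS; specialize (HN N (le_n _) y z HS); specialize (HN' N' (le_n _) y z HS).
    fold g1 in HN; simpl in HN.
    replace (steklov (mesh N') g1 y z - g y z)
      with ((steklov (mesh N') g1 y z - g1 y z) + (g1 y z - g y z)) by ring.
    eapply Rle_trans; [apply Rabs_triang|lra]. }
set (hk := fun k => proj1_sig (constructive_indefinite_description _ (E k))).
assert (Hk : forall k, C2 (hk k) /\
  forall y z, inS0 rho y z -> Rabs (hk k y z - g y z) <= mesh k)
  by (intros k; exact (proj2_sig (constructive_indefinite_description _ (E k)))).
exists hk; split; [intros k; apply Hk|].
split; [intros k; apply C1_C0, C2_C1, Hk|split; [exact Hg|]].
intros eps He; destruct (mesh_small eps He) as [N HN]; exists N; intros k HkN y z HS.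
eapply Rle_trans; [apply Hk, HS|apply HN, HkN].
Qed.

(** * Integration over the rectangle and along its edges *)

(** Iterated in the same order as [surf_int], which unfolds to it. *)
Definition dbl (rho : R) (F : R -> R -> R) : R :=
  RInt (fun z => RInt (fun y => F y z) (-1) 1) 0 rho.

Lemma ex_inner F z : C0 F -> ex_RInt (fun y => F y z) (-1) 1.
Proof. intros H; apply continuous_ex_RInt, C0_slice_y, H. Qed.

Lemma ex_outer rho F : C0 F ->
  ex_RInt (fun z => RInt (fun y => F y z) (-1) 1) 0 rho.
Proof. intros H; apply continuous_ex_RInt, continuous_RInt_y; [lra|exact H]. Qed.

Lemma dbl_ext rho F G : 0 < rho ->
  (forall y z, -1 < y < 1 -> 0 < z < rho -> F y z = G y z) -> dbl rho F = dbl rho G.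
Proof.
intros Hr H; apply RInt_ext; intros z Hz.
apply RInt_ext; intros y Hy.
rewrite Rmin_left, Rmax_right in Hz, Hy by lra.
apply H; assumption.
Qed.

Lemma dbl_plus rho F G : C0 F -> C0 G ->
  dbl rho (fun y z => F y z + G y z) = dbl rho F + dbl rho G.
Proof.
intros HF HG; unfold dbl.
transitivity (RInt (fun z => plus (RInt (fun y => F y z) (-1) 1)
                                  (RInt (fun y => G y z) (-1) 1)) 0 rho).
- apply RInt_ext; intros z _; apply @RInt_plus; apply ex_inner; assumption.
- apply @RInt_plus; apply ex_outer; assumption.
Qed.

Lemma dbl_scal rho k F : C0 F -> dbl rho (fun y z => k * F y z) = k * dbl rho F.
Proof.
intros HF; unfold dbl.
transitivity (RInt (fun z => scal k (RInt (fun y => F y z) (-1) 1)) 0 rho).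
- apply RInt_ext; intros z _; apply @RInt_scal; apply ex_inner; assumption.
- apply @RInt_scal; apply ex_outer; assumption.
Qed.

Lemma dbl_minus rho F G : C0 F -> C0 G ->
  dbl rho (fun y z => F y z - G y z) = dbl rho F - dbl rho G.
Proof.
intros HF HG; replace (dbl rho F - dbl rho G) with (dbl rho F + (-1) * dbl rho G) by ring.
rewrite <- dbl_scal, <- dbl_plus by (try apply C0_mult; try apply C0_const; assumption).
f_equal; apply funext2; intros; ring.
Qed.

Lemma is_lim_seq_of_bound (u : nat -> R) l c : 0 <= c ->
  (forall eps, 0 < eps -> exists N, forall k, (N <= k)%nat -> Rabs (u k - l) <= c * eps) ->
  is_lim_seq u l.
Proof.
intros Hc H; apply is_lim_seq_spec; intros eps.
destruct (H (eps / (c + 1))) as [N HN].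
{ apply Rdiv_lt_0_compat; [apply eps|lra]. }
exists N; intros k Hk; eapply Rle_lt_trans; [apply HN, Hk|].
assert (0 < eps) by apply eps.
apply Rmult_lt_reg_r with (c + 1); [lra|].
replace (c * (eps / (c + 1)) * (c + 1)) with (c * eps) by (field; lra); nra.
Qed.

Lemma dbl_lim rho Fk F : 0 < rho -> cv0 rho Fk F ->
  is_lim_seq (fun k => dbl rho (Fk k)) (dbl rho F).
Proof.
intros Hr (Hk & HF & H); apply is_lim_seq_of_bound with (rho * 2); [lra|].
intros eps He; destruct (H eps He) as [N HN]; exists N; intros k HkN.
replace (rho * 2 * eps) with ((rho - 0) * ((1 - -1) * eps)) by ring.
apply ex_RInt_diff_bound; [lra|apply ex_outer, Hk|apply ex_outer, HF|].
intros z Hz; apply ex_RInt_diff_bound; [lra|apply ex_inner, Hk|apply ex_inner, HF|].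
intros y Hy; apply HN; [exact HkN|unfold inS0; lra].
Qed.

Definition on_edge (rho : R) (e : edge) (g : R -> R -> R) (s : R) : R :=
  g (edge_y e s) (edge_z rho e s).

(** The factor -1 follows the counterclockwise orientation, as in [edge_vel]; the
    parameter [s] itself increases on every edge. *)
Definition edge_diff (rho : R) (e : edge) (g : R -> R -> R) (s : R) : R :=
  match e with
  | e_bottom => on_edge rho e (dy g) s
  | e_right => on_edge rho e (dz g) s
  | e_top => -1 * on_edge rho e (dy g) s
  | e_left => -1 * on_edge rho e (dz g) s
  end.

Definition edge_int (rho : R) (e : edge) (p : R -> R) : R :=
  RInt p (edge_lo e) (edge_hi rho e).

Definition bd_int (rho : R) (p : edge -> R -> R) : R :=
  edge_int rho e_bottom (p e_bottom) + edge_int rho e_right (p e_right) +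
  edge_int rho e_top (p e_top) + edge_int rho e_left (p e_left).

Definition in_edge (rho : R) (e : edge) (s : R) : Prop := edge_lo e <= s <= edge_hi rho e.

Lemma in_edge_S0 rho e s : 0 < rho -> in_edge rho e s ->
  inS0 rho (edge_y e s) (edge_z rho e s).
Proof. intros Hr; unfold in_edge, inS0; destruct e; simpl; lra. Qed.

Lemma edge_lt rho e : 0 < rho -> edge_lo e < edge_hi rho e.
Proof. intros Hr; destruct e; simpl; lra. Qed.

Lemma continuous_on_edge rho e g : C0 g -> forall s, continuous (on_edge rho e g) s.
Proof.
intros H; destruct e; intros s; unfold on_edge; simpl;
  try apply (C0_slice_y g _ H); apply (C0_slice_z g _ H).
Qed.

Lemma continuous_edge_diff rho e g : C1 g -> forall s, continuous (edge_diff rho e g) s.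
Proof.
intros H s; apply has_C1_intro in H; destruct H as (H1 & H2 & _).
destruct e; unfold edge_diff.
- apply continuous_on_edge, H1.
- apply continuous_on_edge, H2.
- apply (continuous_on_edge rho e_top (fun y z => -1 * dy g y z)).
  apply C0_mult; [apply C0_const|exact H1].
- apply (continuous_on_edge rho e_left (fun y z => -1 * dz g y z)).
  apply C0_mult; [apply C0_const|exact H2].
Qed.

Lemma bounded_on_edges rho (p : edge -> R -> R) : 0 < rho ->
  (forall e s, in_edge rho e s -> continuous (p e) s) ->
  exists W, 0 < W /\ forall e s, in_edge rho e s -> Rabs (p e s) <= W.
Proof.
intros Hr Hc.
assert (B : forall e, exists W, 0 < W /\ forall s, in_edge rho e s -> Rabs (p e s) <= W).
{ intros e; destruct (continuity_ab_maj (fun s => Rabs (p e s)) (edge_lo e) (edge_hi rho e))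
    as (x & Hx & _).
  - apply Rlt_le, edge_lt, Hr.
  - intros s Hs; apply (continuity_pt_comp (p e) Rabs); [|apply Rcontinuity_abs].
    apply continuity_pt_filterlim, Hc, Hs.
  - exists (Rabs (p e x) + 1); assert (K := Rabs_pos (p e x)); split; [lra|].
    intros s Hs; specialize (Hx s Hs); lra. }
destruct (B e_bottom) as (W1 & P1 & Q1), (B e_right) as (W2 & P2 & Q2),
  (B e_top) as (W3 & P3 & Q3), (B e_left) as (W4 & P4 & Q4).
exists (W1 + W2 + W3 + W4); split; [lra|]; intros [] s Hs;
  [specialize (Q1 s Hs)|specialize (Q2 s Hs)|specialize (Q3 s Hs)|specialize (Q4 s Hs)]; lra.
Qed.

Lemma edge_int_ext rho e p q : 0 < rho ->
  (forall s, edge_lo e < s < edge_hi rho e -> p s = q s) ->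
  edge_int rho e p = edge_int rho e q.
Proof.
intros Hr H; apply RInt_ext; intros s Hs; apply H.
assert (K := edge_lt rho e Hr); rewrite Rmin_left, Rmax_right in Hs by lra; exact Hs.
Qed.

Lemma bd_int_ext rho p q : 0 < rho ->
  (forall e s, edge_lo e < s < edge_hi rho e -> p e s = q e s) ->
  bd_int rho p = bd_int rho q.
Proof.
intros Hr H; assert (E : forall e, edge_int rho e (p e) = edge_int rho e (q e))
  by (intros e; apply edge_int_ext; [exact Hr|apply H]).
unfold bd_int; rewrite !E; reflexivity.
Qed.

Lemma bd_int_scal rho k p :
  (forall e, ex_RInt (p e) (edge_lo e) (edge_hi rho e)) ->
  bd_int rho (fun e s => k * p e s) = k * bd_int rho p.
Proof.
intros H; unfold bd_int, edge_int.
assert (E : forall e, RInt (fun s => k * p e s) (edge_lo e) (edge_hi rho e) =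
                 k * RInt (p e) (edge_lo e) (edge_hi rho e))
  by (intros e; apply @RInt_scal, H).
rewrite !E; ring.
Qed.

Lemma bd_int_plus rho p q :
  (forall e, ex_RInt (p e) (edge_lo e) (edge_hi rho e)) ->
  (forall e, ex_RInt (q e) (edge_lo e) (edge_hi rho e)) ->
  bd_int rho (fun e s => p e s + q e s) = bd_int rho p + bd_int rho q.
Proof.
intros H K; unfold bd_int, edge_int.
assert (E : forall e, RInt (fun s => p e s + q e s) (edge_lo e) (edge_hi rho e) =
  RInt (p e) (edge_lo e) (edge_hi rho e) + RInt (q e) (edge_lo e) (edge_hi rho e))
  by (intros e; apply @RInt_plus; [apply H|apply K]).
rewrite !E; ring.
Qed.

Lemma bd_int_lim rho (pk : nat -> edge -> R -> R) p : 0 < rho ->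
  (forall k e, ex_RInt (pk k e) (edge_lo e) (edge_hi rho e)) ->
  (forall e, ex_RInt (p e) (edge_lo e) (edge_hi rho e)) ->
  (forall eps, 0 < eps -> exists N, forall k, (N <= k)%nat ->
     forall e s, in_edge rho e s -> Rabs (pk k e s - p e s) <= eps) ->
  is_lim_seq (fun k => bd_int rho (pk k)) (bd_int rho p).
Proof.
intros Hr Hk Hp H.
assert (L : forall e, is_lim_seq (fun k => edge_int rho e (pk k e)) (edge_int rho e (p e))).
{ intros e; assert (Hl := edge_lt rho e Hr).
  apply is_lim_seq_of_bound with (edge_hi rho e - edge_lo e); [lra|].
  intros eps He; destruct (H eps He) as [N HN]; exists N; intros k HkN.
  apply ex_RInt_diff_bound; [lra|apply Hk|apply Hp|].
  intros s Hs; apply HN; assumption. }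
exact (is_lim_seq_plus' _ _ _ _ (is_lim_seq_plus' _ _ _ _ (is_lim_seq_plus' _ _ _ _
  (L e_bottom) (L e_right)) (L e_top)) (L e_left)).
Qed.

Lemma edge_diff_cv rho e gk g : 0 < rho -> cv1 rho gk g ->
  forall eps, 0 < eps -> exists N, forall k, (N <= k)%nat ->
  forall s, in_edge rho e s -> Rabs (edge_diff rho e (gk k) s - edge_diff rho e g s) <= eps.
Proof.
intros Hr (_ & _ & _ & (_ & _ & H1) & (_ & _ & H2)) eps He.
destruct (H1 eps He) as [N1 K1], (H2 eps He) as [N2 K2].
exists (N1 + N2)%nat; intros k Hk s Hs.
apply in_edge_S0 in Hs; [|exact Hr].
specialize (K1 k ltac:(lia) _ _ Hs); specialize (K2 k ltac:(lia) _ _ Hs).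
destruct e; unfold edge_diff, on_edge; try assumption;
  rewrite <- Rmult_minus_distr_l, Rabs_mult, (Rabs_left (-1)) by lra; lra.
Qed.

Lemma is_lim_seq_eq (u v : nat -> R) l m :
  (forall k, u k = v k) -> is_lim_seq u (Finite l) -> is_lim_seq v (Finite m) -> l = m.
Proof.
intros E U V; apply (is_lim_seq_ext u v) in U; [|exact E].
apply is_lim_seq_unique in U; apply is_lim_seq_unique in V.
rewrite U in V; injection V; auto.
Qed.

(** * Green's formula for C^1 functions *)

Definition bracket (F G : R -> R -> R) (y z : R) : R :=
  dy F y z * dz G y z - dz F y z * dy G y z.

Lemma C0_bracket F G : C1 F -> C1 G -> C0 (bracket F G).
Proof.
intros HF HG; destruct (has_C1_intro _ HF) as (Fy & Fz & _).
destruct (has_C1_intro _ HG) as (Gy & Gz & _).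
exact (C0_minus _ _ (C0_mult _ _ Fy Gz) (C0_mult _ _ Fz Gy)).
Qed.

Lemma dbl_dy rho P : C1 P ->
  dbl rho (dy P) = RInt (fun z => P 1 z - P (-1) z) 0 rho.
Proof.
intros H; apply has_C1_intro in H; destruct H as (H1 & _ & H3).
apply RInt_ext; intros z _; apply is_RInt_unique.
apply (is_RInt_derive (fun s => P s z) (fun s => dy P s z)).
- intros; apply H3. - intros; apply (C0_slice_y _ _ H1).
Qed.

Lemma dbl_dz rho P : C1 P ->
  dbl rho (dz P) = RInt (fun y => P y rho) (-1) 1 - RInt (fun y => P y 0) (-1) 1.
Proof.
intros H; assert (H0 := C1_C0 _ H).
apply has_C1_intro in H; destruct H as (_ & H2 & H3).
apply is_RInt_unique.
apply (is_RInt_derive (fun z => RInt (fun y => P y z) (-1) 1)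
         (fun z => RInt (fun y => dz P y z) (-1) 1)).
- intros z _; apply is_derive_RInt_y; [exact H0|exact H2|apply H3].
- intros z _; apply continuous_RInt_y; [lra|exact H2].
Qed.

(** Here the integrand is [d(F dG)], written with partial derivatives that exist:
    the second derivatives of [G] cancel by symmetry. *)
Lemma green_C2 rho F G : 0 < rho -> C1 F -> C2 G ->
  dbl rho (bracket F G) = bd_int rho (fun e s => on_edge rho e F s * edge_diff rho e G s).
Proof.
intros Hr HF HG; assert (GG := HG); destruct GG as (G1 & G2 & G3).
assert (Py := has_C1_mult _ _ _ _ _ _ (has_C1_intro _ HF) (has_C1_intro _ G3)).
assert (Pz := has_C1_mult _ _ _ _ _ _ (has_C1_intro _ HF) (has_C1_intro _ G2)).
set (P := fun y z => F y z * dz G y z) in *.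
set (Q := fun y z => F y z * dy G y z) in *.
assert (CP := has_C1_C1 _ _ _ Py); assert (CQ := has_C1_C1 _ _ _ Pz).
rewrite (dbl_ext rho _ (fun y z => dy P y z - dz Q y z) Hr).
2:{ intros y z _ _; rewrite (has_C1_dy _ _ _ Py), (has_C1_dz _ _ _ Pz).
    unfold bracket; rewrite (C2_mixed G HG); ring. }
rewrite dbl_minus by (apply (has_C1_intro _ CP) || apply (has_C1_intro _ CQ)).
rewrite (dbl_dy rho P CP), (dbl_dz rho Q CQ).
assert (XP : forall c a b, ex_RInt (fun z => P c z) a b)
  by (intros; apply continuous_ex_RInt, C0_slice_z, C1_C0, CP).
assert (XQ : forall c a b, ex_RInt (fun y => Q y c) a b)
  by (intros; apply continuous_ex_RInt, C0_slice_y, C1_C0, CQ).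
assert (E1 : RInt (fun z => P 1 z - P (-1) z) 0 rho =
  RInt (fun z => P 1 z) 0 rho - RInt (fun z => P (-1) z) 0 rho)
  by exact (RInt_minus (fun z => P 1 z) (fun z => P (-1) z) 0 rho (XP _ _ _) (XP _ _ _)).
rewrite E1; unfold bd_int, edge_int, edge_diff, on_edge; simpl.
assert (E2 : RInt (fun s => F s rho * (-1 * dy G s rho)) (-1) 1 =
             - RInt (fun y => Q y rho) (-1) 1).
{ transitivity (RInt (fun y => opp (Q y rho)) (-1) 1).
  - apply RInt_ext; intros y _; unfold Q, opp; simpl; ring.
  - apply @RInt_opp, XQ. }
assert (E3 : RInt (fun s => F (-1) s * (-1 * dz G (-1) s)) 0 rho =
             - RInt (fun z => P (-1) z) 0 rho).
{ transitivity (RInt (fun z => opp (P (-1) z)) 0 rho).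
  - apply RInt_ext; intros z _; unfold P, opp; simpl; ring.
  - apply @RInt_opp, XP. }
rewrite E2, E3; unfold P, Q; ring.
Qed.

(** No second derivative of [G] occurs in the formula, and both sides are continuous
    in [G] for C^1 convergence; so the C^2 case extends by approximation. *)
Lemma green rho F G : 0 < rho -> C1 F -> C1 G ->
  dbl rho (bracket F G) = bd_int rho (fun e s => on_edge rho e F s * edge_diff rho e G s).
Proof.
intros Hr HF HG; destruct (C1_approx rho G HG) as (Gk & Ck & HGk).
assert (F0 := C1_C0 _ HF); assert (KF := has_C1_intro _ HF).
eapply is_lim_seq_eq; [exact (fun k => green_C2 rho F (Gk k) Hr HF (Ck k))| |].
- apply dbl_lim; [exact Hr|].
  pose proof HGk as (_ & _ & _ & H1 & H2); destruct KF as (Fy & Fz & _).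
  exact (cv0_minus rho _ _ _ _ (cv0_mult rho _ _ _ _ (cv0_const rho _ Fy) H2)
    (cv0_mult rho _ _ _ _ (cv0_const rho _ Fz) H1)).
- assert (EX : forall g e, C1 g -> ex_RInt (fun s => on_edge rho e F s * edge_diff rho e g s)
                             (edge_lo e) (edge_hi rho e)).
  { intros g e Hg; apply continuous_ex_RInt; intros s.
    apply @continuous_mult; [apply continuous_on_edge, F0|apply continuous_edge_diff, Hg]. }
  apply bd_int_lim; [exact Hr|intros; apply EX, C2_C1, Ck|intros; apply EX, HG|].
  intros eps He; destruct (bounded_on_S0 rho F F0) as (M & HM & BM).
  assert (L : forall e, exists N, forall k, (N <= k)%nat -> forall s, in_edge rho e s ->
    Rabs (edge_diff rho e (Gk k) s - edge_diff rho e G s) <= eps / M).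
  { intros e; apply edge_diff_cv; [exact Hr|exact HGk|apply Rdiv_lt_0_compat; lra]. }
  destruct (L e_bottom) as [N1 L1], (L e_right) as [N2 L2],
           (L e_top) as [N3 L3], (L e_left) as [N4 L4].
  exists (N1 + N2 + N3 + N4)%nat; intros k Hk e s Hs.
  rewrite <- Rmult_minus_distr_l, Rabs_mult.
  replace eps with (M * (eps / M)) by (field; lra).
  apply Rmult_le_compat; try apply Rabs_pos; [apply BM, in_edge_S0; assumption|].
  destruct e; [apply L1|apply L2|apply L3|apply L4]; auto; lia.
Qed.

(** * The fundamental lemma of the calculus of variations *)

Lemma RInt_nonneg f a b : a <= b -> ex_RInt f a b ->
  (forall x, a < x < b -> 0 <= f x) -> 0 <= RInt f a b.
Proof.
intros Hab Hf H; replace 0 with (RInt (fun _ : R => 0) a b).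
- apply RInt_le; [exact Hab|apply ex_RInt_const|exact Hf|exact H].
- rewrite RInt_const; change ((b - a) * 0 = 0); ring.
Qed.

Lemma between_locally a b x : a < x < b ->
  exists d : posreal, forall u, Rabs (u - x) < d -> a < u < b.
Proof.
intros H; assert (Hd : 0 < Rmin (x - a) (b - x)) by (apply Rmin_pos; lra).
exists (mkposreal _ Hd); simpl; intros u Hu; apply Rabs_def2 in Hu.
assert (K1 := Rmin_l (x - a) (b - x)); assert (K2 := Rmin_r (x - a) (b - x)); lra.
Qed.

Lemma RInt_nonneg_eq0 f a b : a < b -> (forall x, continuous f x) ->
  (forall x, a < x < b -> 0 <= f x) -> RInt f a b = 0 ->
  forall x, a < x < b -> f x = 0.
Proof.
intros Hab Hc Hp Hi.
assert (EX : forall u v, ex_RInt f u v) by (intros; apply continuous_ex_RInt, Hc).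
assert (Z : forall x, a < x < b -> RInt f a x = 0).
{ intros x Hx.
  assert (C := RInt_Chasles f a x b (EX _ _) (EX _ _)).
  change plus with Rplus in C; rewrite Hi in C.
  assert (0 <= RInt f a x) by (apply RInt_nonneg; [lra|apply EX|intros; apply Hp; lra]).
  assert (0 <= RInt f x b) by (apply RInt_nonneg; [lra|apply EX|intros; apply Hp; lra]).
  lra. }
intros x Hx.
assert (D : is_derive (fun u => RInt f a u) x (f x)).
{ apply (is_derive_RInt f _ a); [|apply Hc].
  apply filter_forall; intros u; apply (@RInt_correct R_CompleteNormedModule), EX. }
apply is_derive_unique in D; rewrite <- D.
rewrite (Derive_ext_loc _ (fun _ => 0)); [apply Derive_const|].
destruct (between_locally a b x Hx) as [d Hd]; exists d; intros u Hu; apply Z, Hd, Hu.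
Qed.

Lemma dbl_nonneg_eq0 rho F : 0 < rho -> C0 F ->
  (forall y z, -1 < y < 1 -> 0 < z < rho -> 0 <= F y z) -> dbl rho F = 0 ->
  forall y z, -1 < y < 1 -> 0 < z < rho -> F y z = 0.
Proof.
intros Hr HF Hp Hi y z Hy Hz.
apply (RInt_nonneg_eq0 (fun y => F y z) (-1) 1); [lra|apply C0_slice_y, HF| | |exact Hy].
- intros x Hx; apply Hp; assumption.
- apply (RInt_nonneg_eq0 (fun z => RInt (fun y => F y z) (-1) 1) 0 rho);
    [exact Hr|apply continuous_RInt_y; [lra|exact HF]| |exact Hi|exact Hz].
  intros x Hx; apply RInt_nonneg; [lra|apply ex_inner, HF|intros; apply Hp; assumption].
Qed.

(** Testing against C^2 functions converging to [h] gives [w * h^2] a vanishing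
    integral. *)
Lemma fundamental_lemma rho w h : 0 < rho -> C0 w -> C0 h ->
  (forall y z, -1 < y < 1 -> 0 < z < rho -> 0 < w y z) ->
  (forall phi, C2 phi -> dbl rho (fun y z => w y z * phi y z * h y z) = 0) ->
  forall y z, -1 < y < 1 -> 0 < z < rho -> h y z = 0.
Proof.
intros Hr Hw Hh Hp H.
destruct (C0_approx rho h Hh) as (hk & Ck & Lk).
assert (Z : dbl rho (fun y z => w y z * h y z * h y z) = 0).
{ symmetry.
  apply (is_lim_seq_eq (fun _ => 0) (fun k => dbl rho (fun y z => w y z * hk k y z * h y z))).
  - intros k; symmetry; apply H, Ck.
  - apply is_lim_seq_const.
  - apply dbl_lim; [exact Hr|].
    exact (cv0_mult rho _ _ _ _ (cv0_mult rho _ _ _ _ (cv0_const rho w Hw) Lk)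
      (cv0_const rho h Hh)). }
intros y z Hy Hz; specialize (Hp y z Hy Hz) as Hpos.
assert (E := dbl_nonneg_eq0 rho _ Hr
  (C0_mult _ _ (C0_mult _ _ Hw Hh) Hh)
  (fun a b Ha Hb => ltac:(specialize (Hp a b Ha Hb); cbv beta; rewrite Rmult_assoc;
     apply Rmult_le_pos; [lra|apply Rle_0_sqr])) Z y z Hy Hz); simpl in E.
destruct (Req_dec (h y z) 0) as [|N]; [assumption|exfalso].
rewrite Rmult_assoc in E; apply Rmult_integral in E.
destruct E as [E|E]; [lra|apply Rmult_integral in E; tauto].
Qed.

Lemma bd_int_nonneg_eq0 rho p : 0 < rho ->
  (forall e s, continuous (p e) s) ->
  (forall e s, edge_lo e < s < edge_hi rho e -> 0 <= p e s) ->
  bd_int rho p = 0 ->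
  forall e s, edge_lo e < s < edge_hi rho e -> p e s = 0.
Proof.
intros Hr Hc Hp Hi.
assert (N : forall e, 0 <= edge_int rho e (p e)).
{ intros e; apply RInt_nonneg; [apply Rlt_le, edge_lt, Hr|
    apply continuous_ex_RInt, Hc|apply Hp]. }
assert (Z : forall e, edge_int rho e (p e) = 0).
{ unfold bd_int in Hi; assert (N1 := N e_bottom); assert (N2 := N e_right).
  assert (N3 := N e_top); assert (N4 := N e_left); intros []; lra. }
intros e s Hs; apply (RInt_nonneg_eq0 (p e) (edge_lo e) (edge_hi rho e));
  [apply edge_lt, Hr|apply Hc|apply Hp|apply Z|exact Hs].
Qed.

(** Same argument on the boundary; test functions are functions on the plane, so
    that all edges are treated at once. *)
Lemma fundamental_lemma_edges rho w h : 0 < rho ->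
  (forall e s, continuous (w e) s) -> C0 h ->
  (forall e s, edge_lo e < s < edge_hi rho e -> 0 <= w e s) ->
  (forall phi, C2 phi ->
     bd_int rho (fun e s => w e s * on_edge rho e phi s * on_edge rho e h s) = 0) ->
  forall e s, edge_lo e < s < edge_hi rho e -> w e s <> 0 -> on_edge rho e h s = 0.
Proof.
intros Hr Hw Hh Hp H.
destruct (C0_approx rho h Hh) as (hk & Ck & Lk).
assert (CE : forall g e s, C0 g -> continuous (fun s => w e s * on_edge rho e g s *
  on_edge rho e h s) s).
{ intros g e s Hg; apply @continuous_mult; [apply @continuous_mult; [apply Hw|]|];
    apply continuous_on_edge; assumption. }
assert (Z : bd_int rho (fun e s => w e s * on_edge rho e h s * on_edge rho e h s) = 0).
{ symmetry.
  apply (is_lim_seq_eq (fun _ => 0)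
    (fun k => bd_int rho (fun e s => w e s * on_edge rho e (hk k) s * on_edge rho e h s))).
  - intros k; symmetry; apply H, Ck.
  - apply is_lim_seq_const.
  - apply bd_int_lim; [exact Hr| | |].
    + intros k e; apply continuous_ex_RInt; intros s; apply CE, C1_C0, C2_C1, Ck.
    + intros e; apply continuous_ex_RInt; intros s; apply CE, Hh.
    + destruct (bounded_on_edges rho w Hr (fun e s _ => Hw e s)) as (W & HW & BW).
      destruct (bounded_on_S0 rho h Hh) as (M & HM & BM).
      intros eps He; destruct (proj2 (proj2 Lk) (eps / (W * M))) as [N HN].
      { apply Rdiv_lt_0_compat; [lra|nra]. }
      exists N; intros k Hk e s Hs; assert (K := in_edge_S0 rho e s Hr Hs).
      specialize (HN k Hk _ _ K); specialize (BM _ _ K); specialize (BW e s Hs).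
      replace (w e s * on_edge rho e (hk k) s * on_edge rho e h s -
               w e s * on_edge rho e h s * on_edge rho e h s)
        with (w e s * on_edge rho e h s * (on_edge rho e (hk k) s - on_edge rho e h s))
        by ring.
      rewrite !Rabs_mult.
      replace eps with (W * M * (eps / (W * M))) by (field; lra).
      apply Rmult_le_compat; try apply Rabs_pos.
      * apply Rmult_le_pos; apply Rabs_pos.
      * apply Rmult_le_compat; try apply Rabs_pos; assumption.
      * exact HN. }
intros e s Hs Hn.
assert (E := bd_int_nonneg_eq0 rho _ Hr (fun e s => CE h e s Hh)
  (fun e s He => ltac:(specialize (Hp e s He); cbv beta; rewrite Rmult_assoc;
     apply Rmult_le_pos; [lra|apply Rle_0_sqr])) Z e s Hs); simpl in E.
rewrite Rmult_assoc in E; apply Rmult_integral in E.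
destruct E as [E|E]; [lra|apply Rmult_integral in E; tauto].
Qed.

(** * Vector algebra *)

Definition vsub (u w : vec) : vec := fun i => u i - w i.

(** The bracket [[u,w] = u_y x w_z - u_z x w_y], which is symmetric in [u] and [w]. *)
Definition wedge (uy uz wy wz : vec) : vec := vsub (cross uy wz) (cross uz wy).

Ltac vexpand :=
  unfold wedge, dot, cross, vsub, vadd, vscal, vzero, sum3, mkvec in *; cbv beta iota in *.
Ltac vring := vexpand; ring.

Lemma dot_comm u w : dot u w = dot w u.
Proof. vring. Qed.

Lemma dot_ge0 u : 0 <= dot u u.
Proof.
unfold dot, sum3; repeat apply Rplus_le_le_0_compat; apply Rle_0_sqr.
Qed.

Lemma vnorm_sqr u : vnorm u * vnorm u = dot u u.
Proof. apply sqrt_sqrt, dot_ge0. Qed.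

Lemma vnorm_gt0 u : u <> vzero -> 0 < vnorm u.
Proof.
intros H; apply sqrt_lt_R0; apply dot_self_neq0 in H.
assert (K := dot_ge0 u); lra.
Qed.

(** * The wires are two opposite edges *)

Definition radius2 (p : vec) : R := p ax_x * p ax_x + p ax_y * p ax_y.

(** Among the points of the closed unit cylinder, those of the wires are the
    zeros of this continuous function. *)
Definition wire_gauge (rho theta0 : R) (p : vec) : R :=
  (p ax_x * p ax_x + p ax_z * p ax_z) *
  ((p ax_z - rho) * (p ax_z - rho) +
   (p ax_x * cos theta0 + p ax_y * sin theta0) *
   (p ax_x * cos theta0 + p ax_y * sin theta0)).

Lemma vec_ext (p q : vec) :
  p ax_x = q ax_x -> p ax_y = q ax_y -> p ax_z = q ax_z -> p = q.
Proof. intros; apply functional_extensionality; intros []; assumption. Qed.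

Lemma cos_sin_1 t : cos t * cos t + sin t * sin t = 1.
Proof. assert (K := sin2_cos2 t); unfold Rsqr in K; lra. Qed.

Lemma Rabs_le1_sqr s : Rabs s <= 1 <-> s * s <= 1.
Proof.
split; intros H.
- assert (K : Rabs s * Rabs s <= 1) by (assert (P := Rabs_pos s); nra).
  rewrite <- Rabs_mult, Rabs_right in K; [exact K|]; apply Rle_ge, Rle_0_sqr.
- apply Rabs_le; split; nra.
Qed.

Lemma wires_gauge rho theta0 p : wires rho theta0 p ->
  wire_gauge rho theta0 p = 0 /\ radius2 p <= 1 /\ (p ax_z = 0 \/ p ax_z = rho).
Proof.
assert (T := cos_sin_1 theta0); unfold wire_gauge, radius2.
intros [(s & Hs & ->)|(s & Hs & ->)]; apply Rabs_le1_sqr in Hs; simpl.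
- repeat split; [ring|nra|auto].
- repeat split; [ring| |auto].
  replace (- s * sin theta0 * (- s * sin theta0) + s * cos theta0 * (s * cos theta0))
    with (s * s * (cos theta0 * cos theta0 + sin theta0 * sin theta0)) by ring.
  rewrite T; lra.
Qed.

Lemma gauge_wires rho theta0 p : wire_gauge rho theta0 p = 0 -> radius2 p <= 1 ->
  wires rho theta0 p.
Proof.
assert (T := cos_sin_1 theta0); unfold wire_gauge, radius2; intros H HR.
apply Rmult_integral in H; destruct H as [H|H].
- apply Rplus_sqr_eq_0 in H; destruct H as (H1 & H2).
  left; exists (p ax_y); split; [apply Rabs_le1_sqr; nra|apply vec_ext; auto].
- apply Rplus_sqr_eq_0 in H; destruct H as (Hz & Hp).
  right; exists (- p ax_x * sin theta0 + p ax_y * cos theta0); split.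
  + apply Rabs_le1_sqr.
    replace ((- p ax_x * sin theta0 + p ax_y * cos theta0) *
             (- p ax_x * sin theta0 + p ax_y * cos theta0))
      with ((p ax_x * p ax_x + p ax_y * p ax_y) *
            (cos theta0 * cos theta0 + sin theta0 * sin theta0) -
            (p ax_x * cos theta0 + p ax_y * sin theta0) *
            (p ax_x * cos theta0 + p ax_y * sin theta0)) by ring.
    rewrite T, Hp; lra.
  + apply vec_ext; simpl; [| |lra].
    * replace (- (- p ax_x * sin theta0 + p ax_y * cos theta0) * sin theta0)
        with (p ax_x * (cos theta0 * cos theta0 + sin theta0 * sin theta0) -
              cos theta0 * (p ax_x * cos theta0 + p ax_y * sin theta0)) by ring.
      rewrite T, Hp; ring.
    * replace ((- p ax_x * sin theta0 + p ax_y * cos theta0) * cos theta0)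
        with (p ax_y * (cos theta0 * cos theta0 + sin theta0 * sin theta0) -
              sin theta0 * (p ax_x * cos theta0 + p ax_y * sin theta0)) by ring.
      rewrite T, Hp; ring.
Qed.

(** Wires are radial segments through the axis. *)
Lemma wires_shrink rho theta0 p t : wires rho theta0 p -> 0 <= t <= 1 ->
  wires rho theta0 (mkvec ((1 - t) * p ax_x) ((1 - t) * p ax_y) (p ax_z)).
Proof.
intros [(s & Hs & ->)|(s & Hs & ->)] Ht; [left|right]; exists ((1 - t) * s);
  (split; [rewrite Rabs_mult, (Rabs_right (1 - t)) by lra; assert (K := Rabs_pos s); nra|]);
  apply vec_ext; simpl; ring.
Qed.

Lemma wire_axis_points rho theta0 : wires rho theta0 (mkvec 0 0 0) /\
  wires rho theta0 (mkvec 0 0 rho).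
Proof.
split; [left|right]; exists 0; (split; [rewrite Rabs_R0; lra|]);
  apply vec_ext; simpl; ring.
Qed.

Lemma bd_edge rho y z : in_bdS0 rho y z ->
  exists e s, in_edge rho e s /\ y = edge_y e s /\ z = edge_z rho e s.
Proof.
intros ((Hy & Hz) & [->|[->|[->| ->]]]); unfold in_edge.
- exists e_left, z; simpl; auto. - exists e_right, z; simpl; auto.
- exists e_bottom, y; simpl; auto. - exists e_top, y; simpl; auto.
Qed.

Lemma edge_bd rho e s : 0 < rho -> in_edge rho e s ->
  in_bdS0 rho (edge_y e s) (edge_z rho e s).
Proof.
intros Hr Hs; split; [apply in_edge_S0; assumption|]; destruct e; simpl; auto.
Qed.

Lemma open_in_edge rho e s : edge_lo e < s < edge_hi rho e -> in_edge rho e s.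
Proof. unfold in_edge; lra. Qed.

(** Used to carry identities from the open edges to the corners. *)
Lemma edge_closure rho e g : 0 < rho -> (forall s, continuous g s) ->
  (forall s, edge_lo e < s < edge_hi rho e -> g s = 0) ->
  forall s, in_edge rho e s -> g s = 0.
Proof.
intros Hr Hc H s Hs; assert (L := edge_lt rho e Hr); unfold in_edge in Hs.
destruct (Req_dec (g s) 0) as [|N]; [assumption|exfalso].
assert (C := Hc s); apply continuity_pt_filterlim in C.
destruct (C (Rabs (g s)) (Rabs_pos_lt _ N)) as (d & Hd & K).
set (m := (edge_lo e + edge_hi rho e) / 2) in *.
assert (HA : exists x, edge_lo e < x < edge_hi rho e /\ Rabs (x - s) < d).
{ destruct (Rle_lt_dec s m).
  - exists (s + Rmin (d / 2) ((edge_hi rho e - s) / 2)).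
    assert (0 < Rmin (d / 2) ((edge_hi rho e - s) / 2))
      by (apply Rmin_pos; unfold m in *; lra).
    assert (K1 := Rmin_l (d / 2) ((edge_hi rho e - s) / 2)).
    assert (K2 := Rmin_r (d / 2) ((edge_hi rho e - s) / 2)).
    split; [unfold m in *; lra|]; apply Rabs_def1; lra.
  - exists (s - Rmin (d / 2) ((s - edge_lo e) / 2)).
    assert (0 < Rmin (d / 2) ((s - edge_lo e) / 2))
      by (apply Rmin_pos; unfold m in *; lra).
    assert (K1 := Rmin_l (d / 2) ((s - edge_lo e) / 2)).
    assert (K2 := Rmin_r (d / 2) ((s - edge_lo e) / 2)).
    split; [unfold m in *; lra|]; apply Rabs_def1; lra. }
destruct HA as (x & Hx & Hxs).
destruct (Req_dec x s) as [->|Nx]; [apply N, H, Hx|].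
assert (Q : R_dist (g x) (g s) < Rabs (g s))
  by (apply K; split; [split; [exact I|auto]|exact Hxs]).
unfold R_dist in Q; rewrite (H x Hx), Rminus_0_l, Rabs_Ropp in Q; lra.
Qed.

Lemma IVT_between g a b c : (forall s, continuous g s) -> g a < c < g b ->
  exists s, (a <= s <= b \/ b <= s <= a) /\ g s = c.
Proof.
intros Hc H; destruct (IVT_gen g a b c) as (s & Hs).
- intros x; apply continuity_pt_filterlim, Hc.
- rewrite Rmin_left, Rmax_right by lra; lra.
- exists s; split; [|apply Hs]; destruct Hs as (Hs & _); revert Hs.
  unfold Rmin, Rmax; destruct (Rle_dec a b); lra.
Qed.

Lemma derive_zero_of_return g s l : is_derive g s l ->
  (forall d, 0 < d -> exists t, t <> s /\ Rabs (t - s) < d /\ g t = g s) -> l = 0.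
Proof.
intros D H; apply is_derive_Reals in D.
destruct (Req_dec l 0) as [|N]; [assumption|exfalso].
destruct (D (Rabs l) (Rabs_pos_lt _ N)) as (d & Hd).
destruct (H d (cond_pos d)) as (t & T1 & T2 & T3).
specialize (Hd (t - s) ltac:(lra) T2).
replace (s + (t - s)) with t in Hd by (symmetry; apply Rplus_minus).
rewrite T3 in Hd; unfold Rdiv in Hd.
rewrite Rminus_eq_0, Rmult_0_l, Rminus_0_l, Rabs_Ropp in Hd; lra.
Qed.

Lemma derive_zero_of_max g s l a b : a < s < b -> is_derive g s l ->
  (forall t, a < t < b -> g t <= g s) -> l = 0.
Proof.
intros Hs D H; apply is_derive_Reals in D.
set (pr := exist (fun l => derivable_pt_abs g s l) l D : derivable_pt g s).
replace l with (derive_pt g s pr) by reflexivity.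
apply (deriv_maximum g a b s pr); try apply Hs; intros; apply H; lra.
Qed.

Lemma pigeonhole4 {T : Type} (a b c d m p1 p2 p3 p4 : T) :
  p1 <> p2 -> p1 <> p3 -> p1 <> p4 -> p2 <> p3 -> p2 <> p4 -> p3 <> p4 ->
  m <> p1 -> m <> p2 -> m <> p3 -> m <> p4 ->
  (p1 = a \/ p1 = b \/ p1 = c \/ p1 = d) -> (p2 = a \/ p2 = b \/ p2 = c \/ p2 = d) ->
  (p3 = a \/ p3 = b \/ p3 = c \/ p3 = d) -> (p4 = a \/ p4 = b \/ p4 = c \/ p4 = d) ->
  ~ (m = a \/ m = b \/ m = c \/ m = d).
Proof.
intros n1 n2 n3 n4 n5 n6 m1 m2 m3 m4 A B C D [M|[M|[M|M]]];
  destruct A as [A|[A|[A|A]]]; try congruence;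
  destruct B as [B|[B|[B|B]]]; try congruence;
  destruct C as [C|[C|[C|C]]]; try congruence;
  destruct D as [D|[D|[D|D]]]; congruence.
Qed.

Definition edge_sgn (e : edge) : R :=
  match e with e_bottom | e_right => 1 | e_top | e_left => -1 end.

Lemma on_edge_derive rho e g s : C1 g ->
  is_derive (on_edge rho e g) s (edge_sgn e * edge_diff rho e g s).
Proof.
intros H; apply has_C1_intro in H; destruct H as (_ & _ & H).
destruct e; unfold edge_diff, on_edge, edge_sgn; cbv beta iota; simpl edge_y; simpl edge_z.
- rewrite Rmult_1_l; apply (H s 0).
- rewrite Rmult_1_l; apply (H 1 s).
- replace (-1 * (-1 * dy g s rho)) with (dy g s rho) by ring; apply (H s rho).
- replace (-1 * (-1 * dz g (-1) s)) with (dz g (-1) s) by ring; apply (H (-1) s).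
Qed.

Lemma edge_sgn_neq0 e : edge_sgn e <> 0.
Proof. destruct e; simpl; lra. Qed.

Lemma edge_vel_comp rho f e s i :
  edge_vel rho f e s i = edge_diff rho e (fun y z => f y z i) s.
Proof. destruct e; reflexivity. Qed.

Lemma edge_vel_neq0 rho f e s :
  area_vec f (edge_y e s) (edge_z rho e s) <> vzero ->
  edge_vel rho f e s <> vzero.
Proof.
intros H K; apply H; clear H.
assert (K1 := equal_f K); clear K.
assert (Kx := K1 ax_x); assert (Ky := K1 ax_y); assert (Kz := K1 ax_z).
assert (Cr : forall u w : vec, (forall i, u i = 0) \/ (forall i, w i = 0) ->
  cross u w = vzero).
{ intros u w [Z|Z]; apply vec_ext; unfold cross, mkvec, vzero; rewrite !Z; ring. }
apply Cr; destruct e; [left|right|left|right]; unfold edge_vel, vscal, vzero in *;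
  simpl in *; intros []; lra.
Qed.

Section boundary_of_admissible.

Variables (rho theta0 : R) (f : R -> R -> vec).
Hypothesis rho_gt0 : 0 < rho.
Hypothesis adm : admissible rho theta0 f.

Let p (e : edge) (s : R) : vec := f (edge_y e s) (edge_z rho e s).

Lemma f_C0 i : C0 (fun y z => f y z i).
Proof. apply C1_C0, C2_C1, adm. Qed.

Lemma p_continuous e i s : continuous (fun s => p e s i) s.
Proof. apply (continuous_on_edge rho e _ (f_C0 i)). Qed.

Lemma edge_radius2_le1 e s : in_edge rho e s -> radius2 (p e s) <= 1.
Proof.
intros Hs; assert (B := edge_bd rho e s rho_gt0 Hs).
destruct (excluded_middle_informative (wires rho theta0 (p e s))) as [W|W].
- apply (wires_gauge _ _ _ W).
- destruct adm as (_ & _ & _ & _ & H); destruct (H _ _ B W) as (H1 & _).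
  unfold radius2; fold (p e s) in H1; simpl in H1; lra.
Qed.

Lemma edge_Y_radius2 e s : in_edge rho e s -> ~ wires rho theta0 (p e s) ->
  radius2 (p e s) = 1.
Proof.
intros Hs W; assert (B := edge_bd rho e s rho_gt0 Hs).
destruct adm as (_ & _ & _ & _ & H); destruct (H _ _ B W) as (H1 & _).
unfold radius2; fold (p e s) in H1; simpl in H1; lra.
Qed.

(** The inverse of an injective map on a compact set is continuous.  The function
    minimized adds to the squared distance in space a term that is positive only
    near [(y0,z0)]; where the squared distance is below the minimum, this term
    cannot vanish. *)
Lemma inverse_continuous y0 z0 d : inS0 rho y0 z0 -> 0 < d ->
  exists eta, 0 < eta /\ forall y z, inS0 rho y z ->
    dot (vsub (f y z) (f y0 z0)) (vsub (f y z) (f y0 z0)) < eta ->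
    Rabs (y - y0) + Rabs (z - z0) < d.
Proof.
intros HS Hd.
set (dist2 := fun y z => dot (vsub (f y z) (f y0 z0)) (vsub (f y z) (f y0 z0))).
set (away := fun y z => Rmax 0 (d - (Rabs (y - y0) + Rabs (z - z0)))).
destruct (positive_bounded_below rho (fun y z => dist2 y z + away y z)) as (m & Hm & K).
- apply C0_plus.
  + unfold dist2, dot, sum3, vsub; apply C0_plus; [apply C0_plus|]; apply C0_mult;
      (apply C0_minus; [apply f_C0|apply C0_const]).
  + unfold away; apply (C0_comp (Rmax 0) (fun y z => d - (Rabs (y - y0) + Rabs (z - z0)))).
    * intros; apply continuity_Rmax0.
    * apply C0_minus; [apply C0_const|apply C0_plus];
        (apply C0_comp; [intros; apply Rcontinuity_abs|]); apply C0_minus;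
        apply C0_y || apply C0_z || apply C0_const.
- intros y z HS'; assert (D : 0 <= dist2 y z) by apply dot_ge0.
  assert (A : 0 <= away y z) by apply Rmax_l.
  destruct (Req_dec (dist2 y z) 0) as [E|E]; [|lra].
  assert (Q : f y z = f y0 z0).
  { apply NNPP; intros N; apply (dot_self_neq0 (vsub (f y z) (f y0 z0))); [|exact E].
    intros Z; apply N, functional_extensionality; intros i.
    apply Rminus_diag_uniq, (equal_f Z i). }
  apply adm in Q; [|exact HS'|exact HS]; destruct Q as (-> & ->).
  assert (d <= away y0 z0); [|lra].
  unfold away; rewrite !Rminus_eq_0, Rabs_R0, Rplus_0_r, Rminus_0_r; apply Rmax_r.
- exists m; split; [exact Hm|]; intros y z HS' L; specialize (K y z HS').
  fold (dist2 y z) in L; unfold away in K.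
  destruct (Rle_lt_dec d (Rabs (y - y0) + Rabs (z - z0))) as [H|H]; [|exact H].
  rewrite Rmax_left in K by lra; lra.
Qed.

Lemma near_open_edge e s0 : edge_lo e < s0 < edge_hi rho e ->
  forall d, 0 < d -> exists d', 0 < d' /\ forall y z, in_bdS0 rho y z ->
    Rabs (y - edge_y e s0) + Rabs (z - edge_z rho e s0) < d' ->
    exists s, edge_lo e < s < edge_hi rho e /\ Rabs (s - s0) < d /\
      y = edge_y e s /\ z = edge_z rho e s.
Proof.
intros Hs d Hd.
set (r := Rmin (Rmin (s0 - edge_lo e) (edge_hi rho e - s0)) (Rmin 1 rho)).
assert (Hr : 0 < r) by (repeat apply Rmin_pos; lra).
assert (R1 : r <= s0 - edge_lo e) by (eapply Rle_trans; [apply Rmin_l|apply Rmin_l]).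
assert (R2 : r <= edge_hi rho e - s0) by (eapply Rle_trans; [apply Rmin_l|apply Rmin_r]).
assert (R3 : r <= 1) by (eapply Rle_trans; [apply Rmin_r|apply Rmin_l]).
assert (R4 : r <= rho) by (eapply Rle_trans; [apply Rmin_r|apply Rmin_r]).
assert (M1 := Rmin_l r d); assert (M2 := Rmin_r r d).
exists (Rmin r d); split; [apply Rmin_pos; assumption|].
intros y z (_ & B) L.
assert (P1 := Rabs_pos (y - edge_y e s0)); assert (P2 := Rabs_pos (z - edge_z rho e s0)).
assert (L1 : Rabs (y - edge_y e s0) < r) by lra; assert (L3 := L1).
assert (L2 : Rabs (z - edge_z rho e s0) < r) by lra; assert (L4 := L2).
apply Rabs_def2 in L3; apply Rabs_def2 in L4.
exists (match e with e_bottom | e_top => y | e_right | e_left => z end).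
destruct e; simpl in *; (split; [lra|split; [lra|]]); split;
  try reflexivity; destruct B as [B|[B|[B|B]]]; lra.
Qed.

(** The surface would have no tangent plane where a wire ends inside an edge:
    the tangent of the edge would be radial because the edge comes from the wire,
    and orthogonal to the radius because the edge does not leave the cylinder. *)
Lemma wire_end_not_open e s0 : edge_lo e < s0 < edge_hi rho e ->
  wires rho theta0 (p e s0) -> radius2 (p e s0) <> 1.
Proof.
intros Hs W R1.
assert (HS := in_edge_S0 rho e s0 rho_gt0 (open_in_edge _ _ _ Hs)).
destruct adm as (HC & _ & Hreg & Hcover & _).
assert (HC1 : forall i, C1 (fun y z => f y z i)) by (intros i; apply C2_C1, HC).
set (l := fun i => edge_sgn e * edge_vel rho f e s0 i).
assert (D : forall i, is_derive (fun s => p e s i) s0 (l i)).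
{ intros i; unfold l; rewrite edge_vel_comp; apply on_edge_derive, HC1. }
set (a := p e s0 ax_x) in *; set (b := p e s0 ax_y) in *.
assert (Hab : a * a + b * b = 1) by exact R1.
assert (T1 : 2 * (a * l ax_x + b * l ax_y) = 0).
{ apply (derive_zero_of_max (fun s => radius2 (p e s)) s0 _ (edge_lo e) (edge_hi rho e) Hs).
  - unfold radius2.
    replace (2 * (a * l ax_x + b * l ax_y))
      with ((l ax_x * a + a * l ax_x) + (l ax_y * b + b * l ax_y)) by ring.
    apply @is_derive_plus.
    + apply (is_derive_mult (fun s => p e s ax_x) (fun s => p e s ax_x));
        [apply D|apply D|intros; apply Rmult_comm].
    + apply (is_derive_mult (fun s => p e s ax_y) (fun s => p e s ax_y));
        [apply D|apply D|intros; apply Rmult_comm].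
  - intros t Ht; rewrite R1; apply edge_radius2_le1, open_in_edge, Ht. }
(* points of the wire close to its end have preimages close to [s0] *)
assert (Ret : forall d, 0 < d -> exists t, t <> s0 /\ Rabs (t - s0) < d /\
  p e t ax_z = p e s0 ax_z /\ a * p e t ax_y - b * p e t ax_x = 0).
{ intros d Hd; destruct (near_open_edge e s0 Hs d Hd) as (d' & Hd' & N).
  destruct (inverse_continuous _ _ d' HS Hd') as (eta & Heta & I).
  set (t := Rmin (eta / 2) (1 / 2)).
  assert (Ht : 0 < t) by (apply Rmin_pos; lra).
  assert (t <= eta / 2) by apply Rmin_l; assert (t <= 1 / 2) by apply Rmin_r.
  destruct (Hcover _ (wires_shrink _ _ _ t W ltac:(lra))) as (y & z & B & E).
  assert (Ex : f y z ax_x = (1 - t) * a) by (rewrite E; reflexivity).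
  assert (Ey : f y z ax_y = (1 - t) * b) by (rewrite E; reflexivity).
  assert (Ez : f y z ax_z = p e s0 ax_z) by (rewrite E; reflexivity).
  clear E.
  destruct (N y z B) as (s & S1 & S2 & -> & ->).
  - apply I; [apply B|]; unfold dot, sum3, vsub; rewrite Ex, Ey, Ez.
    fold (p e s0); fold a; fold b.
    replace (_ + _ + _) with (t * t * (a * a + b * b)) by ring.
    rewrite Hab; nra.
  - exists s; fold (p e s) in Ex, Ey, Ez; split; [|split; [exact S2|split; [exact Ez|]]].
    + intros ->; fold a in Ex; fold b in Ey.
      assert (t * (a * a + b * b) = 0); [|rewrite Hab in *; lra].
      replace (t * (a * a + b * b)) with (a * (t * a) + b * (t * b)) by ring.
      replace (t * a) with 0 by lra; replace (t * b) with 0 by lra; ring.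
    + rewrite Ex, Ey; ring. }
assert (T2 : l ax_z = 0).
{ apply (derive_zero_of_return (fun s => p e s ax_z) s0 _ (D ax_z)).
  intros d Hd; destruct (Ret d Hd) as (t & H1 & H2 & H3 & _); exists t; auto. }
assert (T3 : a * l ax_y - b * l ax_x = 0).
{ apply (derive_zero_of_return (fun s => a * p e s ax_y - b * p e s ax_x) s0).
  - apply @is_derive_minus; apply is_derive_scal, D.
  - intros d Hd; destruct (Ret d Hd) as (t & H1 & H2 & _ & H3); exists t.
    split; [exact H1|split; [exact H2|]]; rewrite H3; fold a; fold b.
    symmetry; rewrite Rmult_comm; apply Rminus_eq_0. }
apply (edge_vel_neq0 rho f e s0 (Hreg _ _ HS)).
assert (Hx : l ax_x = 0).
{ replace (l ax_x) with ((a * a + b * b) * l ax_x) by (rewrite Hab; ring).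
  replace ((a * a + b * b) * l ax_x)
    with (a * (a * l ax_x + b * l ax_y) - b * (a * l ax_y - b * l ax_x)) by ring.
  rewrite T3; replace (a * l ax_x + b * l ax_y) with 0 by lra; ring. }
assert (Hy : l ax_y = 0).
{ replace (l ax_y) with ((a * a + b * b) * l ax_y) by (rewrite Hab; ring).
  replace ((a * a + b * b) * l ax_y)
    with (b * (a * l ax_x + b * l ax_y) + a * (a * l ax_y - b * l ax_x)) by ring.
  rewrite T3; replace (a * l ax_x + b * l ax_y) with 0 by lra; ring. }
assert (NZ := edge_sgn_neq0 e); unfold l in Hx, Hy, T2.
apply Rmult_integral in Hx; apply Rmult_integral in Hy; apply Rmult_integral in T2.
apply vec_ext; unfold vzero; tauto.
Qed.

(** On an open edge the gauge of the wires and the distance to the cylinder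
    never vanish together, so that their difference keeps its sign. *)
Lemma open_edge_uniform e s s' :
  edge_lo e < s < edge_hi rho e -> edge_lo e < s' < edge_hi rho e ->
  wires rho theta0 (p e s) -> wires rho theta0 (p e s').
Proof.
intros Hs Hs' W; apply NNPP; intros W'.
set (phi := fun s => wire_gauge rho theta0 (p e s) - (1 - radius2 (p e s))).
assert (Hphi : forall t, continuous phi t).
{ intros t; apply (continuous_on_edge rho e (fun y z =>
    wire_gauge rho theta0 (f y z) - (1 - radius2 (f y z)))).
  unfold wire_gauge, radius2.
  repeat first [apply C0_minus | apply C0_plus | apply C0_mult | apply C0_const | apply f_C0]. }
assert (Neg : forall t, edge_lo e < t < edge_hi rho e -> wires rho theta0 (p e t) ->
  phi t < 0).
{ intros t Ht Wt; assert (K := wire_end_not_open e t Ht Wt).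
  destruct (wires_gauge _ _ _ Wt) as (E & L & _); unfold phi; rewrite E; lra. }
assert (Pos : forall t, edge_lo e < t < edge_hi rho e -> ~ wires rho theta0 (p e t) ->
  0 < phi t).
{ intros t Ht Wt; assert (K := edge_Y_radius2 e t (open_in_edge _ _ _ Ht) Wt).
  unfold phi; rewrite K.
  assert (0 <= wire_gauge rho theta0 (p e t)).
  { apply Rmult_le_pos; apply Rplus_le_le_0_compat; apply Rle_0_sqr. }
  destruct (Req_dec (wire_gauge rho theta0 (p e t)) 0) as [E|]; [|lra].
  exfalso; apply Wt, gauge_wires; [exact E|lra]. }
specialize (Neg s Hs W) as N; specialize (Pos s' Hs' W') as P.
destruct (IVT_between phi s s' 0 Hphi) as (t & Ht & E); [lra|].
assert (Ht' : edge_lo e < t < edge_hi rho e) by lra.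
destruct (excluded_middle_informative (wires rho theta0 (p e t))) as [Wt|Wt].
- specialize (Neg t Ht' Wt); lra.
- specialize (Pos t Ht' Wt); lra.
Qed.

Lemma open_edge_closed e s : edge_lo e < s < edge_hi rho e ->
  wires rho theta0 (p e s) -> forall t, in_edge rho e t -> wires rho theta0 (p e t).
Proof.
intros Hs W t Ht; apply gauge_wires; [|apply edge_radius2_le1, Ht].
apply (edge_closure rho e (fun t => wire_gauge rho theta0 (p e t)) rho_gt0);
  [| |exact Ht].
- intros x; apply (continuous_on_edge rho e (fun y z => wire_gauge rho theta0 (f y z))).
  unfold wire_gauge.
  repeat first [apply C0_minus | apply C0_plus | apply C0_mult | apply C0_const | apply f_C0].
- intros x Hx; apply (wires_gauge _ _ _ (open_edge_uniform e s x Hs Hx W)).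
Qed.

(** Wire points have height 0 or [rho], and the height is continuous. *)
Lemma wire_edge_height e :
  (forall t, in_edge rho e t -> wires rho theta0 (p e t)) ->
  forall s t, in_edge rho e s -> in_edge rho e t -> p e s ax_z = p e t ax_z.
Proof.
intros W.
assert (K : forall s t, in_edge rho e s -> in_edge rho e t ->
  p e s ax_z = 0 -> p e t ax_z = rho -> False).
{ intros s t Hs Ht E1 E2.
  destruct (IVT_between (fun s => p e s ax_z) s t (rho / 2) (p_continuous e ax_z))
    as (x & Hx & E); [lra|].
  assert (Hx' : in_edge rho e x) by (unfold in_edge in *; lra).
  destruct (wires_gauge _ _ _ (W x Hx')) as (_ & _ & [Z|Z]); lra. }
intros s t Hs Ht.
destruct (wires_gauge _ _ _ (W s Hs)) as (_ & _ & [Z|Z]),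
         (wires_gauge _ _ _ (W t Ht)) as (_ & _ & [Z'|Z']); try lra; exfalso; eauto.
Qed.

(** The four ends of the wires take up the four corners. *)
Lemma axis_point_on_open_edge h : h = 0 \/ h = rho ->
  exists e s, edge_lo e < s < edge_hi rho e /\ p e s = mkvec 0 0 h.
Proof.
intros Hh.
assert (Corner : forall q, wires rho theta0 q -> radius2 q = 1 ->
  q = f (-1) 0 \/ q = f 1 0 \/ q = f 1 rho \/ q = f (-1) rho).
{ intros q W R1; destruct adm as (_ & _ & _ & Hc & _).
  destruct (Hc q W) as (y & z & B & E).
  destruct (bd_edge rho y z B) as (e & s & Hs & -> & ->).
  destruct (excluded_middle_informative (edge_lo e < s < edge_hi rho e)) as [O|O].
  - exfalso; apply (wire_end_not_open e s O); unfold p; rewrite E; assumption.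
  - assert (Hs' : s = edge_lo e \/ s = edge_hi rho e) by (unfold in_edge in Hs; lra).
    destruct e; simpl in Hs', E; destruct Hs'; subst s; auto. }
assert (T := cos_sin_1 theta0).
assert (W0 : wires rho theta0 (mkvec 0 0 h)).
{ destruct Hh as [->| ->]; apply wire_axis_points. }
destruct adm as (_ & _ & _ & Hc & _).
destruct (Hc _ W0) as (y & z & B & E).
destruct (bd_edge rho y z B) as (e & s & Hs & -> & ->).
destruct (excluded_middle_informative (edge_lo e < s < edge_hi rho e)) as [O|O].
{ exists e, s; split; [exact O|exact E]. }
exfalso.
assert (Hs' : s = edge_lo e \/ s = edge_hi rho e) by (unfold in_edge in Hs; lra).
assert (C : mkvec 0 0 h = f (-1) 0 \/ mkvec 0 0 h = f 1 0 \/
  mkvec 0 0 h = f 1 rho \/ mkvec 0 0 h = f (-1) rho).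
{ destruct e; simpl in Hs', E; destruct Hs'; subst s; auto. }
revert C.
assert (V : forall (u v : vec) i, u i <> v i -> u <> v) by (intros u v i N ->; auto).
assert (A1 : forall s, s = 1 \/ s = -1 -> wires rho theta0 (mkvec 0 s 0)).
{ intros s' [->| ->]; left; eexists; (split; [|reflexivity]); apply Rabs_le1_sqr; lra. }
assert (A2 : forall s, s = 1 \/ s = -1 ->
  wires rho theta0 (mkvec (- s * sin theta0) (s * cos theta0) rho)).
{ intros s' [->| ->]; right; eexists; (split; [|reflexivity]); apply Rabs_le1_sqr; lra. }
assert (X : forall s, s = 1 \/ s = -1 ->
  mkvec 0 0 h <> mkvec (- s * sin theta0) (s * cos theta0) rho).
{ intros s' Hs1 Q; assert (Qx := equal_f Q ax_x); assert (Qy := equal_f Q ax_y).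
  simpl in Qx, Qy; destruct Hs1; subst s'; nra. }
apply (pigeonhole4 (f (-1) 0) (f 1 0) (f 1 rho) (f (-1) rho) (mkvec 0 0 h)
  (mkvec 0 1 0) (mkvec 0 (-1) 0)
  (mkvec (- 1 * sin theta0) (1 * cos theta0) rho)
  (mkvec (- -1 * sin theta0) (-1 * cos theta0) rho)).
- apply (V _ _ ax_y); simpl; lra.
- apply (V _ _ ax_z); simpl; lra.
- apply (V _ _ ax_z); simpl; lra.
- apply (V _ _ ax_z); simpl; lra.
- apply (V _ _ ax_z); simpl; lra.
- intros Q; assert (Qx := equal_f Q ax_x); assert (Qy := equal_f Q ax_y).
  simpl in Qx, Qy; nra.
- apply (V _ _ ax_y); simpl; lra.
- apply (V _ _ ax_y); simpl; lra.
- apply X; auto.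
- apply X; auto.
- apply Corner; [apply A1; auto|unfold radius2; simpl; lra].
- apply Corner; [apply A1; auto|unfold radius2; simpl; lra].
- apply Corner; [apply A2; auto|unfold radius2; simpl; lra].
- apply Corner; [apply A2; auto|unfold radius2; simpl; lra].
Qed.

Lemma height_edge h : h = 0 \/ h = rho ->
  exists e, forall t, in_edge rho e t -> wires rho theta0 (p e t) /\ p e t ax_z = h.
Proof.
intros Hh; destruct (axis_point_on_open_edge h Hh) as (e & s & Hs & E).
assert (W : forall t, in_edge rho e t -> wires rho theta0 (p e t)).
{ apply (open_edge_closed e s Hs); rewrite E.
  destruct Hh as [->| ->]; apply wire_axis_points. }
exists e; intros t Ht; split; [apply W, Ht|].
rewrite (wire_edge_height e W t s Ht (open_in_edge _ _ _ Hs)), E; reflexivity.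
Qed.

End boundary_of_admissible.

(** [horizontal = true] when the wires are the images of the two edges on which
    [y] varies. *)
Definition wire_edge (horizontal : bool) (e : edge) : bool :=
  match e with e_bottom | e_top => horizontal | e_right | e_left => negb horizontal end.

Definition wires_are_edges (rho theta0 : R) (f : R -> R -> vec) (h : bool) : Prop :=
  (forall e s, wire_edge h e = true -> in_edge rho e s ->
     wires rho theta0 (f (edge_y e s) (edge_z rho e s))) /\
  (forall e s, wire_edge h e = false -> edge_lo e < s < edge_hi rho e ->
     ~ wires rho theta0 (f (edge_y e s) (edge_z rho e s))).

Lemma admissible_wire_edges rho theta0 f : 0 < rho -> admissible rho theta0 f ->
  exists h, wires_are_edges rho theta0 f h.
Proof.
intros Hr adm.
destruct (height_edge rho theta0 f Hr adm 0 (or_introl eq_refl)) as (e1 & H1).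
destruct (height_edge rho theta0 f Hr adm rho (or_intror eq_refl)) as (e2 & H2).
(* the two wire edges have no corner in common *)
assert (C : forall s1 s2, in_edge rho e1 s1 -> in_edge rho e2 s2 ->
  edge_y e1 s1 = edge_y e2 s2 -> edge_z rho e1 s1 = edge_z rho e2 s2 -> False).
{ intros s1 s2 I1 I2 Ey Ez; destruct (H1 s1 I1) as (_ & Z1), (H2 s2 I2) as (_ & Z2).
  rewrite Ey, Ez, Z2 in Z1; lra. }
unfold in_edge in C.
(* an edge joining them is no wire: its height takes both values *)
assert (J : forall e s1 t1 s2 t2, in_edge rho e1 s1 -> in_edge rho e t1 ->
  in_edge rho e2 s2 -> in_edge rho e t2 ->
  edge_y e1 s1 = edge_y e t1 -> edge_z rho e1 s1 = edge_z rho e t1 ->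
  edge_y e2 s2 = edge_y e t2 -> edge_z rho e2 s2 = edge_z rho e t2 ->
  forall s, edge_lo e < s < edge_hi rho e ->
  ~ wires rho theta0 (f (edge_y e s) (edge_z rho e s))).
{ intros e s1 t1 s2 t2 I1 K1 I2 K2 Y1 Z1 Y2 Z2 s Hs W.
  assert (WW := open_edge_closed rho theta0 f Hr adm e s Hs W).
  assert (E := wire_edge_height rho theta0 f Hr adm e WW t1 t2 K1 K2); cbv beta in E.
  destruct (H1 s1 I1) as (_ & A1), (H2 s2 I2) as (_ & A2).
  rewrite Y1, Z1 in A1; rewrite Y2, Z2 in A2; lra. }
unfold in_edge in J, H1, H2.
destruct e1, e2; simpl in C, H1, H2, J;
  try (exfalso; first [ apply (C (-1) (-1)); lra | apply (C 1 0); lra | apply (C 0 1); lra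
    | apply (C (-1) 0); lra | apply (C 0 (-1)); lra | apply (C 1 rho); lra
    | apply (C rho 1); lra | apply (C (-1) rho); lra | apply (C rho (-1)); lra
    | apply (C 0 0); lra ]).
- exists true; split; intros e s We Hs; destruct e; simpl in We; try discriminate.
  + apply H1, Hs. + apply H2, Hs.
  + apply (J e_right 1 0 1 rho); simpl; try lra; exact Hs.
  + apply (J e_left (-1) 0 (-1) rho); simpl; try lra; exact Hs.
- exists false; split; intros e s We Hs; destruct e; simpl in We; try discriminate.
  + apply H1, Hs. + apply H2, Hs.
  + apply (J e_bottom 0 1 0 (-1)); simpl; try lra; exact Hs.
  + apply (J e_top rho 1 rho (-1)); simpl; try lra; exact Hs.
- exists true; split; intros e s We Hs; destruct e; simpl in We; try discriminate.
  + apply H2, Hs. + apply H1, Hs.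
  + apply (J e_right 1 rho 1 0); simpl; try lra; exact Hs.
  + apply (J e_left (-1) rho (-1) 0); simpl; try lra; exact Hs.
- exists false; split; intros e s We Hs; destruct e; simpl in We; try discriminate.
  + apply H2, Hs. + apply H1, Hs.
  + apply (J e_bottom 0 (-1) 0 1); simpl; try lra; exact Hs.
  + apply (J e_top rho (-1) rho 1); simpl; try lra; exact Hs.
Qed.

(** * The pointwise identities *)

Lemma cross_tangent n a b x : dot n n = 1 -> dot a n = 0 -> dot b n = 0 ->
  dot (cross a b) x = dot n (cross a b) * dot n x.
Proof.
intros H Ha Hb.
assert (E : dot n n * dot (cross a b) x - dot n (cross a b) * dot n x =
  dot b n * dot a (cross n x) - dot a n * dot b (cross n x)) by vring.
rewrite H, Ha, Hb in E; lra.
Qed.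

(** The two relations say that the derivative of the normal is symmetric and
    trace free; it then anticommutes with the rotation by a right angle.  The proof
    expands the double product [f_z x [n,f]]. *)
Lemma minimal_rotation_y fy fz ny nz w :
  wedge ny nz fy fz = vzero -> dot ny fz = dot nz fy ->
  dot fz fz * dot ny w - dot fy fz * dot nz w = - dot w (cross nz (cross fy fz)).
Proof.
intros H S.
assert (H0 : dot (cross fz (wedge ny nz fy fz)) w = 0) by (rewrite H; vring).
assert (E : dot fz fz * dot ny w - dot fy fz * dot nz w =
  dot (cross fz (wedge ny nz fy fz)) w + (dot ny fz - dot nz fy) * dot fz w
  - dot w (cross nz (cross fy fz))) by vring.
rewrite E, H0, S; ring.
Qed.

Lemma minimal_rotation_z fy fz ny nz w :
  wedge ny nz fy fz = vzero -> dot ny fz = dot nz fy ->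
  dot fy fy * dot nz w - dot fy fz * dot ny w = dot w (cross ny (cross fy fz)).
Proof.
intros H S.
assert (H0 : dot (cross fy (wedge ny nz fy fz)) w = 0) by (rewrite H; vring).
assert (E : dot fy fy * dot nz w - dot fy fz * dot ny w =
  - dot (cross fy (wedge ny nz fy fz)) w - (dot ny fz - dot nz fy) * dot fy w
  + dot w (cross ny (cross fy fz))) by vring.
rewrite E, H0, S; ring.
Qed.

(** The first fundamental form acts on covectors [(p,q)] by this quadratic form,
    up to the area element: it is [|p dual_y + q dual_z|^2 |area_vec|] for
    [mu = 1 / |area_vec|]. *)
Definition dirichlet (mu : R) (fy fz : vec) (p q : R) : R :=
  mu * (dot fz fz * (p * p) - 2 * dot fy fz * (p * q) + dot fy fy * (q * q)).

(** Splitting [v = w + c n] gives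
      [n . [v,v] = n . [w,w] + 2 c n . [w,n] + c^2 n . [n,n]],
    the last term being the density of [2 K c^2].  Integrating the first two by
    parts, with the exact forms [d (n x w . dw)] and [2 d (c n x w . dn)], leaves no derivative of
    [w] other than [n . dw = - w . dn].  What remains is a quadratic expression in
    [dc] and [w . dn]; by the rotation lemmas it cancels against the difference of
    the Dirichlet terms, as [n . dv = dc - w . dn]. *)
Lemma second_variation_density mu fy fz n ny nz v vy vz c cy cz w wy wz :
  n = vscal mu (cross fy fz) -> dot n n = 1 -> dot ny n = 0 -> dot nz n = 0 ->
  wedge ny nz fy fz = vzero -> dot ny fz = dot nz fy ->
  c = dot v n -> cy = dot vy n + dot v ny -> cz = dot vz n + dot v nz ->
  w = vsub v (vscal c n) ->
  wy = vsub vy (vadd (vscal cy n) (vscal c ny)) ->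
  wz = vsub vz (vadd (vscal cz n) (vscal c nz)) ->
  dirichlet mu fy fz (dot n vy) (dot n vz) + 2 * dot n (cross vy vz) =
  dirichlet mu fy fz cy cz + 2 * (c * c) * dot n (cross ny nz) +
  (dot (vadd (cross ny w) (cross n wy)) wz - dot (vadd (cross nz w) (cross n wz)) wy) +
  2 * (dot (vadd (vscal cy (cross n w)) (vscal c (vadd (cross ny w) (cross n wy)))) nz -
       dot (vadd (vscal cz (cross n w)) (vscal c (vadd (cross nz w) (cross n wz)))) ny).
Proof.
intros Hn H1 Hy Hz HH HS Hc Hcy Hcz Hw Hwy Hwz.
assert (Vy : vy = vadd wy (vadd (vscal cy n) (vscal c ny)))
  by (rewrite Hwy; apply functional_extensionality; intros i; vexpand; ring).
assert (Vz : vz = vadd wz (vadd (vscal cz n) (vscal c nz)))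
  by (rewrite Hwz; apply functional_extensionality; intros i; vexpand; ring).
set (P := dot ny w); set (Q := dot nz w).
set (jy := dot n (cross w ny)); set (jz := dot n (cross w nz)).
assert (Wn : dot w n = 0).
{ rewrite Hw; replace (dot (vsub v (vscal c n)) n) with (dot v n - c * dot n n) by vring.
  rewrite H1, Hc; ring. }
assert (Pv : dot v ny = P).
{ unfold P; rewrite Hw.
  replace (dot ny (vsub v (vscal c n))) with (dot v ny - c * dot ny n) by vring.
  rewrite Hy; ring. }
assert (Qv : dot v nz = Q).
{ unfold Q; rewrite Hw.
  replace (dot nz (vsub v (vscal c n))) with (dot v nz - c * dot nz n) by vring.
  rewrite Hz; ring. }
assert (Ny : dot n vy = cy - P) by (rewrite Hcy, Pv, dot_comm; ring).
assert (Nz : dot n vz = cz - Q) by (rewrite Hcz, Qv, dot_comm; ring).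
assert (Wy : dot n wy = - P).
{ rewrite Hwy.
  replace (dot n (vsub vy (vadd (vscal cy n) (vscal c ny))))
    with (dot n vy - cy * dot n n - c * dot ny n) by vring.
  rewrite Ny, H1, Hy; ring. }
assert (Wz : dot n wz = - Q).
{ rewrite Hwz.
  replace (dot n (vsub vz (vadd (vscal cz n) (vscal c nz))))
    with (dot n vz - cz * dot n n - c * dot nz n) by vring.
  rewrite Nz, H1, Hz; ring. }
assert (Ry : mu * (dot fz fz * P - dot fy fz * Q) = - jz).
{ unfold P, Q, jz; rewrite (minimal_rotation_y fy fz ny nz w HH HS), Hn; vring. }
assert (Rz : mu * (dot fy fy * Q - dot fy fz * P) = jy).
{ unfold P, Q, jy; rewrite (minimal_rotation_z fy fz ny nz w HH HS), Hn; vring. }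
assert (D : dirichlet mu fy fz (cy - P) (cz - Q) =
  dirichlet mu fy fz cy cz + 2 * cy * jz - 2 * cz * jy - P * jz + Q * jy).
{ replace (dirichlet mu fy fz (cy - P) (cz - Q)) with
    (dirichlet mu fy fz cy cz
     - 2 * (cy * (mu * (dot fz fz * P - dot fy fz * Q)) +
            cz * (mu * (dot fy fy * Q - dot fy fz * P)))
     + P * (mu * (dot fz fz * P - dot fy fz * Q))
     + Q * (mu * (dot fy fy * Q - dot fy fz * P))) by (unfold dirichlet; ring).
  rewrite Ry, Rz; ring. }
rewrite Ny, Nz, D.
assert (X1 : dot (cross w ny) wz = - jy * Q).
{ rewrite (cross_tangent n w ny wz H1 Wn Hy), Wz; unfold jy; ring. }
assert (X2 : dot (cross w nz) wy = - jz * P).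
{ rewrite (cross_tangent n w nz wy H1 Wn Hz), Wy; unfold jz; ring. }
assert (X3 : dot (cross ny nz) w = 0).
{ rewrite (cross_tangent n ny nz w H1 Hy Hz), (dot_comm n w), Wn; ring. }
rewrite Vy, Vz.
replace (dot n (cross (vadd wy (vadd (vscal cy n) (vscal c ny)))
                      (vadd wz (vadd (vscal cz n) (vscal c nz)))))
  with (dot n (cross wy wz) + c * (dot n (cross wy nz) - dot n (cross wz ny)) +
        c * c * dot n (cross ny nz)) by vring.
replace (dot (vadd (cross ny w) (cross n wy)) wz - dot (vadd (cross nz w) (cross n wz)) wy)
  with (2 * dot n (cross wy wz) - dot (cross w ny) wz + dot (cross w nz) wy) by vring.
replace (dot (vadd (vscal cy (cross n w)) (vscal c (vadd (cross ny w) (cross n wy)))) nz -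
       dot (vadd (vscal cz (cross n w)) (vscal c (vadd (cross nz w) (cross n wz)))) ny)
  with (cy * jz - cz * jy - 2 * c * dot (cross ny nz) w
        + c * (dot n (cross wy nz) - dot n (cross wz ny)))
  by (unfold jy, jz; vring).
rewrite X1, X2, X3; ring.
Qed.

(** The last difference is the exact form [d (n x v . df)]. *)
Lemma first_variation_density n ny nz v vy vz fy fz :
  dot n (wedge vy vz fy fz) =
  dot v (wedge ny nz fy fz) +
  (dot (vadd (cross ny v) (cross n vy)) fz - dot (vadd (cross nz v) (cross n vz)) fy).
Proof. vring. Qed.

(** * Densities in the parameter plane *)

Lemma area_factor L : 0 < L -> / (L * L) * L = / L.
Proof. intros H; field; lra. Qed.

Lemma normal_area f y z :
  normal f y z = vscal (/ vnorm (area_vec f y z)) (cross (dyv f y z) (dzv f y z)).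
Proof. reflexivity. Qed.

Lemma sdiv_area f v y z : area_vec f y z <> vzero ->
  sdiv f v y z * vnorm (area_vec f y z) =
  dot (normal f y z) (wedge (dyv v y z) (dzv v y z) (dyv f y z) (dzv f y z)).
Proof.
intros H; apply vnorm_gt0 in H.
assert (E := area_factor _ H); assert (Q := vnorm_sqr (area_vec f y z)).
change (sdiv f v y z) with
  (sum3 (fun i => dyv v y z i * dual_y f y z i + dzv v y z i * dual_z f y z i)).
rewrite normal_area; unfold dual_y, dual_z; rewrite <- Q.
fold (area_vec f y z); cbv zeta.
set (N := area_vec f y z) in *; set (L := vnorm N) in *; clearbody N L.
rewrite <- E; set (k := / (L * L)); vring.
Qed.

Lemma trace_sqr_minors (M : mat) a b p q :
  (forall i j, M i j = a i * p j + b i * q j) ->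
  (mtrace M) ^ 2 - mtrace (mmul M M) = 2 * dot (cross a b) (cross p q).
Proof.
intros H; unfold mtrace, mmul, sum3; rewrite !H; vring.
Qed.

Lemma dual_cross_area f y z a : area_vec f y z <> vzero ->
  dot a (cross (dual_y f y z) (dual_z f y z)) * vnorm (area_vec f y z) =
  dot (normal f y z) a.
Proof.
intros H; apply vnorm_gt0 in H.
assert (Q := vnorm_sqr (area_vec f y z)).
unfold dual_y, dual_z; rewrite normal_area; cbv zeta; rewrite <- Q.
set (L := vnorm (area_vec f y z)) in *.
set (N := area_vec f y z) in *.
assert (X : dot a (cross (cross (dzv f y z) N) (cross N (dyv f y z))) = L * L * dot N a).
{ rewrite Q; unfold N, area_vec; vring. }
replace (dot a (cross (vscal (/ (L * L)) (cross (dzv f y z) N))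
                      (vscal (/ (L * L)) (cross N (dyv f y z)))))
  with (/ (L * L) * / (L * L) * dot a (cross (cross (dzv f y z) N) (cross N (dyv f y z))))
  by vring.
rewrite X; change (cross (dyv f y z) (dzv f y z)) with N.
replace (dot (vscal (/ L) N) a) with (/ L * dot N a) by vring.
field; lra.
Qed.

Lemma div_sqr_area f v y z : area_vec f y z <> vzero ->
  ((sdiv f v y z) ^ 2 - mtrace (mmul (vgrad f v y z) (vgrad f v y z))) *
    vnorm (area_vec f y z) =
  2 * dot (normal f y z) (cross (dyv v y z) (dzv v y z)).
Proof.
intros H; unfold sdiv.
rewrite (trace_sqr_minors _ (dyv v y z) (dzv v y z) (dual_y f y z) (dual_z f y z))
  by reflexivity.
rewrite Rmult_assoc, dual_cross_area by exact H; reflexivity.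
Qed.

Lemma gauss_curv_area f y z : area_vec f y z <> vzero ->
  gauss_curv f y z * vnorm (area_vec f y z) =
  dot (normal f y z) (cross (dyv (normal f) y z) (dzv (normal f) y z)).
Proof.
intros H; unfold gauss_curv, curv_tensor; cbv zeta.
rewrite (trace_sqr_minors _ (vscal (-1) (dyv (normal f) y z))
  (vscal (-1) (dzv (normal f) y z)) (dual_y f y z) (dual_z f y z)).
- replace (/ 2 * (2 * dot (cross (vscal (-1) (dyv (normal f) y z))
       (vscal (-1) (dzv (normal f) y z))) (cross (dual_y f y z) (dual_z f y z))) *
       vnorm (area_vec f y z))
    with (dot (cross (vscal (-1) (dyv (normal f) y z))
       (vscal (-1) (dzv (normal f) y z))) (cross (dual_y f y z) (dual_z f y z)) *
       vnorm (area_vec f y z)) by field.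
  rewrite dual_cross_area by exact H; vring.
- intros i j; unfold mopp, vgrad, sgrad, vadd, vscal, dyv, dzv; ring.
Qed.

Lemma covector_sqr_area f y z a b (g : vec) : area_vec f y z <> vzero ->
  (forall i, g i = a * dual_y f y z i + b * dual_z f y z i) ->
  (vnorm g) ^ 2 * vnorm (area_vec f y z) =
  dirichlet (/ vnorm (area_vec f y z)) (dyv f y z) (dzv f y z) a b.
Proof.
intros H Hg; apply vnorm_gt0 in H.
assert (Q := vnorm_sqr (area_vec f y z)).
replace ((vnorm g) ^ 2) with (dot g g) by (rewrite <- vnorm_sqr; ring).
assert (X : dot g g = / (vnorm (area_vec f y z) * vnorm (area_vec f y z)) *
  (dot (dzv f y z) (dzv f y z) * (a * a) - 2 * dot (dyv f y z) (dzv f y z) * (a * b) +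
   dot (dyv f y z) (dyv f y z) * (b * b))).
{ unfold dot at 1, sum3; rewrite !Hg.
  unfold dual_y, dual_z; cbv zeta; rewrite <- Q.
  set (L := vnorm (area_vec f y z)) in *.
  apply Rmult_eq_reg_l with (L * L * (L * L));
    [|repeat apply Rmult_integral_contrapositive_currified; lra].
  set (S := dot (dzv f y z) (dzv f y z) * (a * a) - _ + _).
  replace (L * L * (L * L) * (/ (L * L) * S)) with (L * L * S) by (field; lra).
  set (X := vadd (vscal a (cross (dzv f y z) (area_vec f y z)))
                 (vscal b (cross (area_vec f y z) (dyv f y z)))).
  transitivity (dot X X).
  - unfold X, dot, vadd, vscal, sum3; field; lra.
  - rewrite Q; unfold X, S, area_vec; vring. }
rewrite X; unfold dirichlet.
set (L := vnorm (area_vec f y z)) in *; rewrite <- (area_factor L H); ring.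
Qed.

(** * Vector fields of class C^1 *)

Definition C1v (v : R -> R -> vec) : Prop := forall i, C1 (fun y z => v y z i).

Lemma C2v_C1v v : C2v v -> C1v v.
Proof. intros H i; apply C2_C1, H. Qed.

Lemma C2v_dyv v : C2v v -> C1v (dyv v).
Proof. intros H i; apply (H i). Qed.

Lemma C2v_dzv v : C2v v -> C1v (dzv v).
Proof. intros H i; apply (H i). Qed.

Lemma C1v_has v i : C1v v ->
  has_C1 (fun y z => v y z i) (fun y z => dyv v y z i) (fun y z => dzv v y z i).
Proof. intros H; apply (has_C1_intro _ (H i)). Qed.

Lemma C1v_C0 v i : C1v v -> C0 (fun y z => v y z i).
Proof. intros H; apply C1_C0, H. Qed.

Lemma C0_dyv v i : C1v v -> C0 (fun y z => dyv v y z i).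
Proof. intros H; apply (C1v_has v i H). Qed.

Lemma C0_dzv v i : C1v v -> C0 (fun y z => dzv v y z i).
Proof. intros H; apply (C1v_has v i H). Qed.

Lemma has_C1_ext g gy gz hy hz : has_C1 g gy gz ->
  (forall y z, gy y z = hy y z) -> (forall y z, gz y z = hz y z) -> has_C1 g hy hz.
Proof.
intros H E1 E2; replace hy with gy by apply funext2, E1.
replace hz with gz by apply funext2, E2; exact H.
Qed.

Lemma has_C1_dot u v : C1v u -> C1v v ->
  has_C1 (fun y z => dot (u y z) (v y z))
    (fun y z => dot (dyv u y z) (v y z) + dot (u y z) (dyv v y z))
    (fun y z => dot (dzv u y z) (v y z) + dot (u y z) (dzv v y z)).
Proof.
intros Hu Hv.
assert (K := fun i => has_C1_mult _ _ _ _ _ _ (C1v_has u i Hu) (C1v_has v i Hv)).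
assert (S := has_C1_plus _ _ _ _ _ _ (has_C1_plus _ _ _ _ _ _ (K ax_x) (K ax_y)) (K ax_z)).
eapply has_C1_ext; [exact S| |]; intros; unfold dot, sum3; ring.
Qed.

Lemma C1_dot u v : C1v u -> C1v v -> C1 (fun y z => dot (u y z) (v y z)).
Proof. intros; eapply has_C1_C1, has_C1_dot; assumption. Qed.

Lemma C2_dot u v : C2v u -> C2v v -> C2 (fun y z => dot (u y z) (v y z)).
Proof.
intros Hu Hv; apply C2_plus; [apply C2_plus|]; (apply C2_mult; [apply Hu|apply Hv]).
Qed.

Lemma C0_dot u v : (forall i, C0 (fun y z => u y z i)) -> (forall i, C0 (fun y z => v y z i)) ->
  C0 (fun y z => dot (u y z) (v y z)).
Proof.
intros Hu Hv; apply C0_plus; [apply C0_plus|]; (apply C0_mult; [apply Hu|apply Hv]).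
Qed.

Lemma C0_cross u v : (forall i, C0 (fun y z => u y z i)) -> (forall i, C0 (fun y z => v y z i)) ->
  forall i, C0 (fun y z => cross (u y z) (v y z) i).
Proof.
intros Hu Hv []; unfold cross, mkvec; apply C0_minus; (apply C0_mult; [apply Hu|apply Hv]).
Qed.

Lemma C1v_scal c u : C1 c -> C1v u -> C1v (fun y z => vscal (c y z) (u y z)).
Proof. intros Hc Hu i; apply C1_mult; [exact Hc|apply Hu]. Qed.

Lemma C2v_scal c u : C2 c -> C2v u -> C2v (fun y z => vscal (c y z) (u y z)).
Proof. intros Hc Hu i; apply C2_mult; [exact Hc|apply Hu]. Qed.

Lemma C1v_sub u w : C1v u -> C1v w -> C1v (fun y z => vsub (u y z) (w y z)).
Proof. intros Hu Hw i; apply C1_minus; [apply Hu|apply Hw]. Qed.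

Lemma C2v_sub u w : C2v u -> C2v w -> C2v (fun y z => vsub (u y z) (w y z)).
Proof. intros Hu Hw i; apply C2_minus; [apply Hu|apply Hw]. Qed.

Lemma C1v_cross u v : C1v u -> C1v v -> C1v (fun y z => cross (u y z) (v y z)).
Proof.
intros Hu Hv []; unfold cross, mkvec; apply C1_minus; (apply C1_mult; [apply Hu|apply Hv]).
Qed.

Lemma dv_scal c u y z : C1 c -> C1v u ->
  dyv (fun y z => vscal (c y z) (u y z)) y z =
    vadd (vscal (dy c y z) (u y z)) (vscal (c y z) (dyv u y z)) /\
  dzv (fun y z => vscal (c y z) (u y z)) y z =
    vadd (vscal (dz c y z) (u y z)) (vscal (c y z) (dzv u y z)).
Proof.
intros Hc Hu.
assert (K := fun i => has_C1_mult _ _ _ _ _ _ (has_C1_intro _ Hc) (C1v_has u i Hu)).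
split; apply functional_extensionality; intros i.
- unfold dyv at 1, vscal at 1; rewrite (has_C1_dy _ _ _ (K i)); reflexivity.
- unfold dzv at 1, vscal at 1; rewrite (has_C1_dz _ _ _ (K i)); reflexivity.
Qed.

Lemma dv_sub u w y z : C1v u -> C1v w ->
  dyv (fun y z => vsub (u y z) (w y z)) y z = vsub (dyv u y z) (dyv w y z) /\
  dzv (fun y z => vsub (u y z) (w y z)) y z = vsub (dzv u y z) (dzv w y z).
Proof.
intros Hu Hw.
assert (K := fun i => has_C1_minus _ _ _ _ _ _ (C1v_has u i Hu) (C1v_has w i Hw)).
split; apply functional_extensionality; intros i.
- unfold dyv at 1, vsub at 1; rewrite (has_C1_dy _ _ _ (K i)); reflexivity.
- unfold dzv at 1, vsub at 1; rewrite (has_C1_dz _ _ _ (K i)); reflexivity.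
Qed.

Lemma dv_cross u v y z : C1v u -> C1v v ->
  dyv (fun y z => cross (u y z) (v y z)) y z =
    vadd (cross (dyv u y z) (v y z)) (cross (u y z) (dyv v y z)) /\
  dzv (fun y z => cross (u y z) (v y z)) y z =
    vadd (cross (dzv u y z) (v y z)) (cross (u y z) (dzv v y z)).
Proof.
intros Hu Hv.
assert (K := fun i j k l => has_C1_minus _ _ _ _ _ _
  (has_C1_mult _ _ _ _ _ _ (C1v_has u i Hu) (C1v_has v j Hv))
  (has_C1_mult _ _ _ _ _ _ (C1v_has u k Hu) (C1v_has v l Hv))).
split; apply functional_extensionality; intros i.
- unfold dyv at 1; destruct i; unfold cross at 1, mkvec;
    rewrite (has_C1_dy _ _ _ (K _ _ _ _)); vring.
- unfold dzv at 1; destruct i; unfold cross at 1, mkvec;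
    rewrite (has_C1_dz _ _ _ (K _ _ _ _)); vring.
Qed.

Definition vbracket (P Q : R -> R -> vec) (y z : R) : R :=
  dot (dyv P y z) (dzv Q y z) - dot (dzv P y z) (dyv Q y z).

Lemma C0_vbracket P Q : C1v P -> C1v Q -> C0 (vbracket P Q).
Proof.
intros HP HQ; apply C0_minus; apply C0_dot; intros i.
- apply C0_dyv, HP. - apply C0_dzv, HQ. - apply C0_dzv, HP. - apply C0_dyv, HQ.
Qed.

Lemma continuous_edge_vel rho f e i s : C1v f ->
  continuous (fun s => edge_vel rho f e s i) s.
Proof.
intros H; apply (continuous_ext (edge_diff rho e (fun y z => f y z i))).
- intros; symmetry; apply edge_vel_comp.
- apply continuous_edge_diff, H.
Qed.

Lemma continuous_dot_edge_vel rho (P Q : R -> R -> vec) e s :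
  (forall i, C0 (fun y z => P y z i)) -> C1v Q ->
  continuous (fun s => dot (P (edge_y e s) (edge_z rho e s)) (edge_vel rho Q e s)) s.
Proof.
intros HP HQ.
assert (K : forall i, continuous (fun s => P (edge_y e s) (edge_z rho e s) i *
  edge_vel rho Q e s i) s).
{ intros i; apply @continuous_mult; [apply (continuous_on_edge rho e _ (HP i))|
    apply continuous_edge_vel, HQ]. }
unfold dot, sum3; repeat apply @continuous_plus; apply K.
Qed.

Lemma green_vec rho P Q : 0 < rho -> C1v P -> C1v Q ->
  dbl rho (vbracket P Q) =
  bd_int rho (fun e s => dot (P (edge_y e s) (edge_z rho e s)) (edge_vel rho Q e s)).
Proof.
intros Hr HP HQ.
set (B := fun i => bracket (fun y z => P y z i) (fun y z => Q y z i)).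
set (I := fun i e s => on_edge rho e (fun y z => P y z i) s *
                       edge_diff rho e (fun y z => Q y z i) s).
assert (CB : forall i, C0 (B i)) by (intros i; apply C0_bracket; [apply HP|apply HQ]).
assert (EI : forall i e, ex_RInt (I i e) (edge_lo e) (edge_hi rho e)).
{ intros i e; apply continuous_ex_RInt; intros s; apply @continuous_mult;
    [apply continuous_on_edge, C1v_C0, HP|apply continuous_edge_diff, HQ]. }
assert (G : forall i, dbl rho (B i) = bd_int rho (I i))
  by (intros i; apply green; [exact Hr|apply HP|apply HQ]).
transitivity (dbl rho (fun y z => B ax_x y z + B ax_y y z + B ax_z y z)).
{ f_equal; apply funext2; intros; unfold vbracket, B, bracket, dot, sum3, dyv, dzv; ring. }
transitivity (bd_int rho (fun e s => I ax_x e s + I ax_y e s + I ax_z e s)).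
- rewrite (dbl_plus rho (fun y z => B ax_x y z + B ax_y y z) (B ax_z)
             (C0_plus _ _ (CB ax_x) (CB ax_y)) (CB ax_z)).
  rewrite (dbl_plus rho (B ax_x) (B ax_y) (CB ax_x) (CB ax_y)).
  rewrite (G ax_x), (G ax_y), (G ax_z).
  assert (E2 : forall e, ex_RInt (fun s => I ax_x e s + I ax_y e s) (edge_lo e) (edge_hi rho e))
    by (intros e; apply (@ex_RInt_plus R_CompleteNormedModule (I ax_x e)); apply EI).
  rewrite (bd_int_plus rho (fun e s => I ax_x e s + I ax_y e s) (I ax_z) E2 (EI ax_z)).
  rewrite (bd_int_plus rho (I ax_x) (I ax_y) (EI ax_x) (EI ax_y)); reflexivity.
- f_equal; apply functional_extensionality; intros e.
  apply functional_extensionality; intros s; unfold I, dot, sum3.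
  rewrite !edge_vel_comp; reflexivity.
Qed.

(** * The unit normal as a C^1 field on the plane *)

(** [mu] continues [1 / vnorm (area_vec f)], which need not exist far from the
    rectangle, and [n] continues the unit normal. *)
Definition normal_extension (rho : R) (f n : R -> R -> vec) (mu : R -> R -> R) : Prop :=
  C1v n /\ C1 mu /\ (forall y z, n y z = vscal (mu y z) (area_vec f y z)) /\
  forall y z, inS0 rho y z ->
    mu y z = / vnorm (area_vec f y z) /\ n y z = normal f y z /\
    dyv n y z = dyv (normal f) y z /\ dzv n y z = dzv (normal f) y z /\
    dot (n y z) (n y z) = 1 /\
    dot (dyv n y z) (n y z) = 0 /\ dot (dzv n y z) (n y z) = 0.

Lemma dy_dz_ext_loc g h y z : locally_2d (fun u v => g u v = h u v) y z ->
  dy g y z = dy h y z /\ dz g y z = dz h y z.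
Proof.
intros [d H]; split; apply Derive_ext_loc; exists d; intros t Ht; apply H;
  try exact Ht; rewrite Rminus_eq_0, Rabs_R0; apply d.
Qed.

Lemma exists_normal_extension rho f : C2v f ->
  (forall y z, inS0 rho y z -> area_vec f y z <> vzero) ->
  exists n mu, normal_extension rho f n mu.
Proof.
intros Hf Hreg.
assert (CN : C1v (area_vec f))
  by (apply (C1v_cross (dyv f) (dzv f)); [apply C2v_dyv, Hf|apply C2v_dzv, Hf]).
set (q := fun y z => dot (area_vec f y z) (area_vec f y z)).
assert (Cq : C1 q) by (apply C1_dot; exact CN).
destruct (positive_bounded_below rho q (C1_C0 _ Cq)) as (m0 & Hm0 & Hm).
{ intros y z HS; apply Hreg, dot_self_neq0 in HS.
  assert (K := dot_ge0 (area_vec f y z)); unfold q; lra. }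
(* [2 * m < m0], so that [n] is the unit normal on a neighbourhood of the rectangle
   and has the same derivatives *)
set (m := m0 / 3); assert (Hmp : 0 < m) by (unfold m; lra).
set (mu := fun y z => / sqrt (lift_above m (q y z))).
set (n := fun y z => vscal (mu y z) (area_vec f y z)).
assert (Pos : forall y z, 0 < lift_above m (q y z)).
{ intros y z; assert (K := lift_above_ge m (q y z) Hmp); lra. }
assert (Cmu : C1 mu).
{ apply C1_inv; [intros; apply sqrt_lt_R0, Pos|].
  apply C1_sqrt; [exact Pos|]; apply C1_lift_above, Cq. }
assert (Cn : C1v n) by (apply C1v_scal; assumption).
exists n, mu; split; [exact Cn|split; [exact Cmu|split; [reflexivity|]]].
intros y z HS.
assert (Loc : locally_2d (fun u v => 2 * m < q u v) y z).
{ destruct (C0_eps y z q (C1_C0 _ Cq) m Hmp) as [d Hd].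
  exists d; intros u v Hu Hv; specialize (Hd u v Hu Hv); apply Rabs_def2 in Hd.
  specialize (Hm y z HS); unfold m in *; lra. }
assert (Emu : forall u v, 2 * m < q u v -> mu u v = / vnorm (area_vec f u v)).
{ intros u v H; unfold mu; rewrite lift_above_id by lra; reflexivity. }
assert (En : forall u v, 2 * m < q u v -> n u v = normal f u v).
{ intros u v H; unfold n; rewrite Emu by exact H; reflexivity. }
assert (E1 : forall u v, 2 * m < q u v -> dot (n u v) (n u v) = 1).
{ intros u v H; unfold n; rewrite Emu by exact H.
  assert (Hv : 0 < vnorm (area_vec f u v))
    by (apply sqrt_lt_R0; change (0 < q u v); lra).
  replace (dot (vscal (/ vnorm (area_vec f u v)) (area_vec f u v))
               (vscal (/ vnorm (area_vec f u v)) (area_vec f u v)))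
    with (/ vnorm (area_vec f u v) * / vnorm (area_vec f u v) *
          dot (area_vec f u v) (area_vec f u v)) by vring.
  rewrite <- vnorm_sqr; field; lra. }
assert (Here := locally_2d_singleton _ _ _ Loc).
split; [apply Emu, Here|split; [apply En, Here|]].
assert (D : forall i, dyv n y z i = dyv (normal f) y z i /\
                      dzv n y z i = dzv (normal f) y z i).
{ intros i; apply dy_dz_ext_loc; destruct Loc as [d Hd]; exists d.
  intros u v Hu Hv; rewrite (En u v (Hd u v Hu Hv)); reflexivity. }
split; [apply functional_extensionality; intros i; apply D|].
split; [apply functional_extensionality; intros i; apply D|].
split; [apply E1, Here|].
assert (K := has_C1_dot n n Cn Cn).
destruct (dy_dz_ext_loc (fun y z => dot (n y z) (n y z)) (fun _ _ => 1) y z) as (Zy & Zz).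
{ destruct Loc as [d Hd]; exists d; intros u v Hu Hv; apply E1, (Hd u v Hu Hv). }
rewrite (has_C1_dy _ _ _ K), (has_C1_dy _ _ _ (has_C1_const 1)) in Zy.
rewrite (has_C1_dz _ _ _ K), (has_C1_dz _ _ _ (has_C1_const 1)) in Zz.
rewrite (dot_comm (n y z)) in Zy; rewrite (dot_comm (n y z)) in Zz; lra.
Qed.


(** * Restriction of functions to lines *)

Lemma has_C1_fix_z g a : C1 g ->
  has_C1 (fun y _ => g y a) (fun y _ => dy g y a) (fun _ _ => 0).
Proof.
intros H; apply has_C1_intro in H; destruct H as (H1 & _ & H3).
split; [|split; [apply C0_const|]].
- intros y z eps; destruct (H1 y a eps) as [d Hd]; exists d; intros u v Hu _.
  apply Hd; [exact Hu|rewrite Rminus_eq_0, Rabs_R0; apply d].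
- intros y z; split; [apply H3|apply @is_derive_const].
Qed.

Lemma has_C1_fix_y g a : C1 g ->
  has_C1 (fun _ z => g a z) (fun _ _ => 0) (fun _ z => dz g a z).
Proof.
intros H; apply has_C1_intro in H; destruct H as (_ & H2 & H3).
split; [apply C0_const|split].
- intros y z eps; destruct (H2 a z eps) as [d Hd]; exists d; intros u v _ Hv.
  apply Hd; [rewrite Rminus_eq_0, Rabs_R0; apply d|exact Hv].
- intros y z; split; [apply @is_derive_const|apply H3].
Qed.

Lemma C1_fix_z g a : C1 g -> C1 (fun y _ => g y a).
Proof. intros H; exact (has_C1_C1 _ _ _ (has_C1_fix_z g a H)). Qed.

Lemma C1_fix_y g a : C1 g -> C1 (fun _ z => g a z).
Proof. intros H; exact (has_C1_C1 _ _ _ (has_C1_fix_y g a H)). Qed.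

Lemma C2_fix_z g a : C2 g -> C2 (fun y _ => g y a).
Proof.
intros (H1 & H2 & _); exact (has_C1_C2 _ _ _ (has_C1_fix_z g a H1)
  (C1_fix_z _ a H2) (C1_const 0)).
Qed.

Lemma C2_fix_y g a : C2 g -> C2 (fun _ z => g a z).
Proof.
intros (H1 & _ & H3); exact (has_C1_C2 _ _ _ (has_C1_fix_y g a H1)
  (C1_const 0) (C1_fix_y _ a H3)).
Qed.

Lemma cv1_fix_z rho gk g a : 0 <= a <= rho -> cv1 rho gk g ->
  cv1 rho (fun k y _ => gk k y a) (fun y _ => g y a).
Proof.
intros Ha (Cgk & Cg & H0 & H1 & _).
assert (S : forall y z, inS0 rho y z -> inS0 rho y a) by (unfold inS0; intros; lra).
assert (K := has_C1_fix_z g a Cg); assert (Kk := fun k => has_C1_fix_z (gk k) a (Cgk k)).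
assert (U : forall hk h, (forall k, C0 (fun y _ => hk k y a)) -> C0 (fun y _ => h y a) ->
  cv0 rho hk h -> cv0 rho (fun k y _ => hk k y a) (fun y _ => h y a)).
{ intros hk h Ck Ch (_ & _ & H); split; [exact Ck|split; [exact Ch|]].
  intros eps He; destruct (H eps He) as [N HN]; exists N; eauto. }
apply (cv1_intro rho _ _ _ _ _ _ Kk K).
- apply U; [intros k; exact (has_C1_C0 _ _ _ (Kk k))|exact (has_C1_C0 _ _ _ K)|exact H0].
- apply (U (fun k => dy (gk k)) (dy g)); [intros k; apply Kk|apply K|exact H1].
- apply cv0_const, C0_const.
Qed.

Lemma cv1_fix_y rho gk g a : -1 <= a <= 1 -> cv1 rho gk g ->
  cv1 rho (fun k _ z => gk k a z) (fun _ z => g a z).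
Proof.
intros Ha (Cgk & Cg & H0 & _ & H1).
assert (S : forall y z, inS0 rho y z -> inS0 rho a z) by (unfold inS0; intros; lra).
assert (K := has_C1_fix_y g a Cg); assert (Kk := fun k => has_C1_fix_y (gk k) a (Cgk k)).
assert (U : forall hk h, (forall k, C0 (fun _ z => hk k a z)) -> C0 (fun _ z => h a z) ->
  cv0 rho hk h -> cv0 rho (fun k _ z => hk k a z) (fun _ z => h a z)).
{ intros hk h Ck Ch (_ & _ & H); split; [exact Ck|split; [exact Ch|]].
  intros eps He; destruct (H eps He) as [N HN]; exists N; eauto. }
apply (cv1_intro rho _ _ _ _ _ _ Kk K).
- apply U; [intros k; exact (has_C1_C0 _ _ _ (Kk k))|exact (has_C1_C0 _ _ _ K)|exact H0].
- apply cv0_const, C0_const.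
- apply (U (fun k => dz (gk k)) (dz g)); [intros k; apply Kk|apply K|exact H1].
Qed.

Lemma cv1_dot rho uk u v : C1v v ->
  (forall i, cv1 rho (fun k y z => uk k y z i) (fun y z => u y z i)) ->
  cv1 rho (fun k y z => dot (uk k y z) (v y z)) (fun y z => dot (u y z) (v y z)).
Proof.
intros Cv H.
assert (K := fun i => cv1_mult rho _ _ _ _ (H i) (cv1_const rho _ (Cv i))).
exact (cv1_plus rho _ _ _ _ (cv1_plus rho _ _ _ _ (K ax_x) (K ax_y)) (K ax_z)).
Qed.

(** * Critical points are minimal surfaces meeting the cylinder orthogonally *)

Definition unitv (i : axis) : vec :=
  match i with
  | ax_x => mkvec 1 0 0 | ax_y => mkvec 0 1 0 | ax_z => mkvec 0 0 1
  end.

Lemma dot_unitv i u : dot (unitv i) u = u i.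
Proof. destruct i; unfold unitv; vring. Qed.

Lemma C2v_const u : C2v (fun _ _ => u).
Proof. intros i; apply C2_const. Qed.

(** Cut-off factor for test fields, zero on the edges with [wire_edge h e = true]. *)
Definition edge_cut (rho : R) (h : bool) (y z : R) : R :=
  if h then z * (rho - z) else 1 - y * y.

Lemma C2_edge_cut rho h : C2 (edge_cut rho h).
Proof.
unfold edge_cut; destruct h.
- apply C2_mult; [apply C2_z|apply C2_minus; [apply C2_const|apply C2_z]].
- apply C2_minus; [apply C2_const|apply C2_mult; apply C2_y].
Qed.

Lemma edge_cut_eq0 rho h e s : wire_edge h e = true ->
  edge_cut rho h (edge_y e s) (edge_z rho e s) = 0.
Proof. destruct h, e; simpl; intros; try discriminate; ring. Qed.

Lemma edge_cut_gt0 rho h e s : 0 < rho -> wire_edge h e = false ->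
  edge_lo e < s < edge_hi rho e -> 0 < edge_cut rho h (edge_y e s) (edge_z rho e s).
Proof. intros Hr; destruct h, e; simpl; intros; try discriminate; nra. Qed.

Lemma edge_cut_interior rho h y z : -1 < y < 1 -> 0 < z < rho -> 0 < edge_cut rho h y z.
Proof. intros Hy Hz; destruct h; unfold edge_cut; nra. Qed.

(** On the two edges with [wire_edge h e = false] its values 1 and -1 undo the
    orientation of [edge_vel], so that both edges contribute with the same sign. *)
Definition side (rho : R) (h : bool) (y z : R) : R := if h then y else 1 - 2 / rho * z.

Lemma C2_side rho h : C2 (side rho h).
Proof.
unfold side; destruct h; [apply C2_y|].
apply C2_minus; [apply C2_const|apply C2_mult; [apply C2_const|apply C2_z]].
Qed.

Lemma side_edge rho h e s : 0 < rho -> wire_edge h e = false ->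
  side rho h (edge_y e s) (edge_z rho e s) = edge_sgn e.
Proof. intros Hr; destruct h, e; simpl; intros; try discriminate; try ring; field; lra. Qed.

Definition along (h : bool) (f : R -> R -> vec) : R -> R -> vec := if h then dzv f else dyv f.

Lemma edge_vel_along rho h f e s : wire_edge h e = false ->
  edge_vel rho f e s = vscal (edge_sgn e) (along h f (edge_y e s) (edge_z rho e s)).
Proof.
intros H; apply functional_extensionality; intros i.
destruct h, e; simpl in *; try discriminate; unfold vscal; try ring; reflexivity.
Qed.

Definition radial (f : R -> R -> vec) (y z : R) : vec := cyl_normal (f y z).

Lemma C2v_radial f : C2v f -> C2v (radial f).
Proof.
intros H [].
- exact (H ax_x).
- exact (H ax_y).
- exact (C2_const 0).
Qed.

Lemma dot_radial f y z : dot (radial f y z) (radial f y z) = radius2 (f y z).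
Proof. unfold radial, cyl_normal, radius2; vring. Qed.

Lemma derive_ge0_left g s l : is_derive g s l ->
  (exists d, 0 < d /\ forall t, s - d < t <= s -> g t <= g s) -> 0 <= l.
Proof.
intros D (d & Hd & H); apply is_derive_Reals in D.
apply Rnot_lt_le; intros Hl.
destruct (D (- l / 2)) as (d' & Hd'); [lra|].
set (k := - Rmin (d / 2) (d' / 2)).
assert (P : 0 < Rmin (d / 2) (d' / 2))
  by (apply Rmin_pos; [lra|assert (0 < d') by apply d'; lra]).
assert (M1 := Rmin_l (d / 2) (d' / 2)); assert (M2 := Rmin_r (d / 2) (d' / 2)).
assert (Hk : k < 0) by (unfold k; lra).
specialize (Hd' k ltac:(lra)).
assert (0 < d') by apply d'.
assert (Q : Rabs ((g (s + k) - g s) / k - l) < - l / 2).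
{ apply Hd'; rewrite Rabs_left by exact Hk; unfold k; lra. }
apply Rabs_def2 in Q; destruct Q as (Q & _).
assert (G : g (s + k) <= g s) by (apply H; unfold k; lra).
assert (X : (g (s + k) - g s) / k < 0) by lra.
assert (Y : 0 <= (g (s + k) - g s) / k); [|lra].
replace ((g (s + k) - g s) / k) with ((g s - g (s + k)) * / (- k)) by (field; lra).
apply Rmult_le_pos; [lra|apply Rlt_le, Rinv_0_lt_compat; lra].
Qed.

Lemma derive_le0_right g s l : is_derive g s l ->
  (exists d, 0 < d /\ forall t, s <= t < s + d -> g t <= g s) -> l <= 0.
Proof.
intros D (d & Hd & H).
assert (0 <= - l); [|lra].
apply (derive_ge0_left (fun t => g (- t)) (- s)).
- replace (- l) with (-1 * l) by ring.
  apply (is_derive_comp g (fun t => - t)); [rewrite Ropp_involutive; exact D|].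
  auto_derive; [exact I|reflexivity].
- exists d; split; [exact Hd|]; intros t Ht; rewrite Ropp_involutive; apply H; lra.
Qed.


Lemma edge_diff_dot rho (P Q : R -> R -> vec) e s : C1v P -> C1v Q ->
  edge_diff rho e (fun y z => dot (P y z) (Q y z)) s =
  dot (edge_vel rho P e s) (Q (edge_y e s) (edge_z rho e s)) +
  dot (P (edge_y e s) (edge_z rho e s)) (edge_vel rho Q e s).
Proof.
intros HP HQ; assert (K := has_C1_dot P Q HP HQ).
unfold edge_diff, on_edge, edge_vel; rewrite (has_C1_dy _ _ _ K), (has_C1_dz _ _ _ K).
destruct e; vring.
Qed.

Lemma edge_vel_const rho u e s : edge_vel rho (fun _ _ => u) e s = vzero.
Proof.
apply functional_extensionality; intros i; rewrite edge_vel_comp.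
unfold edge_diff, on_edge, vzero.
rewrite (has_C1_dy _ _ _ (has_C1_const (u i))), (has_C1_dz _ _ _ (has_C1_const (u i))).
destruct e; ring.
Qed.

Lemma edge_diff_eq0 rho e g s : C1 g -> edge_lo e < s < edge_hi rho e ->
  (forall t, edge_lo e < t < edge_hi rho e -> on_edge rho e g t = 0) ->
  edge_diff rho e g s = 0.
Proof.
intros Cg Hs H; assert (D := on_edge_derive rho e g s Cg).
apply is_derive_unique in D.
rewrite (Derive_ext_loc _ (fun _ => 0)) in D.
- rewrite Derive_const in D; symmetry in D; apply Rmult_integral in D.
  destruct D as [D|D]; [exfalso; exact (edge_sgn_neq0 e D)|exact D].
- destruct (between_locally _ _ s Hs) as [d Hd]; exists d; intros t Ht; apply H, Hd, Ht.
Qed.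

Lemma parallel_det d n a b : d <> vzero -> cross d a = vzero -> cross d b = vzero ->
  dot (cross n a) b = 0.
Proof.
intros Hd Ha Hb; apply dot_self_neq0 in Hd.
assert (E : dot d d * dot (cross n a) b =
  dot d a * dot n (cross d b) - dot n (cross (cross d (cross d a)) b)) by vring.
rewrite Ha, Hb in E.
replace (dot d a * dot n vzero - dot n (cross (cross d vzero) b)) with 0 in E by vring.
apply Rmult_integral in E; tauto.
Qed.

(** [u] is the velocity of an edge on the cylinder, whose radius [r] is the
    conormal; [w1], [n1] and [r1] are derivatives along the edge of the
    tangential part [w] of the velocity, the normal and the radius.  The
    acceleration of points that stay on the cylinder cancels all but the square
    of the normal component [c]. *)
Lemma boundary_density L u r n v c w w1 n1 r1 a :
  0 < L -> L * L = dot u u -> dot r r = 1 -> dot n n = 1 -> dot n u = 0 -> dot v r = 0 ->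
  r ax_z = 0 -> r1 = mkvec (u ax_x) (u ax_y) 0 ->
  cross u n = vscal L r -> c = dot v n -> w = vsub v (vscal c n) ->
  dot w1 r + dot w r1 = 0 -> dot n1 r + dot n r1 = 0 ->
  dot a r = (dot v ezed) ^ 2 - (vnorm v) ^ 2 ->
  dot (cross n w) w1 + 2 * dot (vscal c (cross n w)) n1 + dot (cross n a) u =
  - (u ax_z * u ax_z / L * (c * c)).
Proof.
intros HL HLu Hr Hn Hnu Hvr Hrz Hr1 Hun Hc Hw Hw1 Hn1 Ha.
assert (Hnr : dot n r = 0).
{ assert (E : L * dot n r = 0).
  { replace (L * dot n r) with (dot n (vscal L r)) by vring; rewrite <- Hun; vring. }
  apply Rmult_integral in E; destruct E; [lra|assumption]. }
assert (Hwn : dot w n = 0).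
{ rewrite Hw; replace (dot (vsub v (vscal c n)) n) with (dot v n - c * dot n n) by vring.
  rewrite Hn, Hc; ring. }
assert (Hwr : dot w r = 0).
{ rewrite Hw; replace (dot (vsub v (vscal c n)) r) with (dot v r - c * dot n r) by vring.
  rewrite Hvr, Hnr; ring. }
set (k := dot w u / L).
(* [u / L] completes [n] and [r] to an orthonormal frame *)
assert (Fr : forall x, dot x u = L * dot x (cross n r)).
{ intros x; replace (L * dot x (cross n r)) with (dot x (cross n (vscal L r))) by vring.
  rewrite <- Hun.
  replace (dot x (cross n (cross u n))) with (dot x u * dot n n - dot n u * dot x n) by vring.
  rewrite Hn, Hnu; ring. }
assert (Hnw : forall x, dot (cross n w) x = - k * dot r x).
{ intros x; rewrite (cross_tangent r n w x Hr Hnr Hwr); unfold k; rewrite (Fr w).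
  replace (dot r (cross n w)) with (- dot w (cross n r)) by vring; field; lra. }
assert (Hwx : forall x, dot w x = k * dot u x / L).
{ intros x; assert (E := Hnw (cross x n)).
  replace (dot (cross n w) (cross x n)) with (dot w n * dot x n - dot w x * dot n n) in E
    by vring.
  rewrite Hwn, Hn in E.
  rewrite (dot_comm u x), (Fr x).
  replace (dot r (cross x n)) with (dot x (cross n r)) in E by vring.
  replace (k * (L * dot x (cross n r)) / L) with (k * dot x (cross n r)) by (field; lra).
  lra. }
assert (Hv : v = vadd w (vscal c n))
  by (rewrite Hw; apply functional_extensionality; intros i; vexpand; ring).
assert (Ez : forall x : vec, dot x ezed = x ax_z) by (intros x; unfold ezed; vring).
assert (Hwz : w ax_z = k * u ax_z / L) by (rewrite <- !Ez; apply Hwx).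
assert (Hww : dot w w = k * k).
{ rewrite Hwx, (dot_comm u w); unfold k; field; lra. }
assert (Hvz : dot v ezed = k * u ax_z / L + c * n ax_z).
{ rewrite Ez, Hv; unfold vadd, vscal; rewrite Hwz; reflexivity. }
assert (Hvv : (vnorm v) ^ 2 = k * k + c * c).
{ replace ((vnorm v) ^ 2) with (vnorm v * vnorm v) by ring; rewrite vnorm_sqr, Hv.
  replace (dot (vadd w (vscal c n)) (vadd w (vscal c n)))
    with (dot w w + 2 * c * dot w n + c * c * dot n n) by vring.
  rewrite Hww, Hwn, Hn; ring. }
assert (Pyth : n ax_z * n ax_z + u ax_z * u ax_z / (L * L) = 1).
{ assert (G : dot ezed (cross n r) * dot ezed (cross n r) =
    dot n n * dot r r - dot n r * dot n r - n ax_z * n ax_z * dot r r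
    - r ax_z * r ax_z * dot n n + 2 * dot n r * n ax_z * r ax_z)
    by (unfold ezed; vring).
  rewrite Hn, Hr, Hnr, Hrz in G.
  assert (U : u ax_z = L * dot ezed (cross n r))
    by (rewrite <- Ez, (dot_comm u), Fr; reflexivity).
  rewrite U; replace (L * dot ezed (cross n r) * (L * dot ezed (cross n r)) / (L * L))
    with (dot ezed (cross n r) * dot ezed (cross n r)) by (field; lra).
  rewrite G; ring. }
assert (Wr1 : dot w r1 = k * L - k * u ax_z / L * u ax_z).
{ rewrite Hr1; replace (dot w (mkvec (u ax_x) (u ax_y) 0))
    with (dot w u - w ax_z * u ax_z) by vring.
  rewrite Hwz; unfold k; field; lra. }
assert (Nr1 : dot n r1 = - (n ax_z * u ax_z)).
{ rewrite Hr1; replace (dot n (mkvec (u ax_x) (u ax_y) 0))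
    with (dot n u - n ax_z * u ax_z) by vring.
  rewrite Hnu; ring. }
replace (dot (vscal c (cross n w)) n1) with (c * dot (cross n w) n1) by vring.
rewrite (Hnw w1), (Hnw n1), (dot_comm r w1), (dot_comm r n1).
replace (dot w1 r) with (- dot w r1) by lra.
replace (dot n1 r) with (- dot n r1) by lra.
replace (dot (cross n a) u) with (dot a (cross u n)) by vring.
rewrite Hun; replace (dot a (vscal L r)) with (L * dot a r) by vring.
rewrite Ha, Hvv, Hvz, Wr1, Nr1.
replace (u ax_z * u ax_z / L * (c * c))
  with (L * (u ax_z * u ax_z / (L * L)) * (c * c)) by (field; lra).
replace (u ax_z * u ax_z / (L * L)) with (1 - n ax_z * n ax_z) by lra.
field; lra.
Qed.

Section critical_surface.

Variables (rho theta0 sigma : R) (f : R -> R -> vec) (h : bool).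
Variables (n : R -> R -> vec) (mu : R -> R -> R).
Local Notation at_edge u e s := (u (edge_y e s) (edge_z rho e s)).

Hypotheses (rho_gt0 : 0 < rho) (sigma_gt0 : 0 < sigma).
Hypothesis adm : admissible rho theta0 f.
Hypothesis crit : critical rho theta0 sigma f.
Hypothesis Hwires : wires_are_edges rho theta0 f h.
Hypothesis Hn : normal_extension rho f n mu.

Let C2f : C2v f := proj1 adm.
Let C1f : C1v f := C2v_C1v f C2f.
Let C1n : C1v n := proj1 Hn.

Lemma regular y z : inS0 rho y z -> area_vec f y z <> vzero.
Proof. apply adm. Qed.

Lemma wire_edge_wires e s : edge_lo e < s < edge_hi rho e ->
  wires rho theta0 (at_edge f e s) -> wire_edge h e = true.
Proof.
intros Hs W; destruct (wire_edge h e) eqn:E; [reflexivity|].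
exfalso; exact (proj2 Hwires e s E Hs W).
Qed.

Lemma onY_edge y z : onY rho theta0 f y z -> exists e s,
  wire_edge h e = false /\ in_edge rho e s /\ y = edge_y e s /\ z = edge_z rho e s.
Proof.
intros (B & NW); destruct (bd_edge rho y z B) as (e & s & Hs & Ey & Ez); exists e, s.
split; [|auto]; destruct (wire_edge h e) eqn:E; [|reflexivity].
exfalso; apply NW; rewrite Ey, Ez; apply (proj1 Hwires e s E Hs).
Qed.

Lemma inV_intro v : C2v v ->
  (forall e s, wire_edge h e = true -> in_edge rho e s ->
     v (edge_y e s) (edge_z rho e s) = vzero) ->
  (forall e s, wire_edge h e = false -> in_edge rho e s ->
     dot (at_edge v e s) (at_edge (radial f) e s) = 0) ->
  inV rho theta0 f v.
Proof.
intros Cv HW HY; split; [exact Cv|split].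
- intros e s Hs W; rewrite (HW e s (wire_edge_wires e s Hs W) (open_in_edge _ _ _ Hs)).
  apply functional_extensionality; intros i; vring.
- intros y z HyZ; destruct (onY_edge y z HyZ) as (e & s & E & Hs & -> & ->).
  apply HY; assumption.
Qed.

Lemma C0_wedge u i : C1v u ->
  C0 (fun y z => wedge (dyv u y z) (dzv u y z) (dyv f y z) (dzv f y z) i).
Proof.
intros Cu; unfold wedge, vsub; apply C0_minus.
- apply (C0_cross (dyv u) (dzv f)); intros j; [apply C0_dyv, Cu|apply C0_dzv, C1f].
- apply (C0_cross (dzv u) (dyv f)); intros j; [apply C0_dzv, Cu|apply C0_dyv, C1f].
Qed.

Lemma vbracket_cross v y z : C1v v ->
  dot (n y z) (wedge (dyv v y z) (dzv v y z) (dyv f y z) (dzv f y z)) =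
  dot (v y z) (wedge (dyv n y z) (dzv n y z) (dyv f y z) (dzv f y z)) +
  vbracket (fun y z => cross (n y z) (v y z)) f y z.
Proof.
intros Cv; unfold vbracket.
destruct (dv_cross n v y z C1n Cv) as (-> & ->).
apply first_variation_density.
Qed.

Lemma first_variation_formula v : C1v v ->
  dbl rho (fun y z =>
    dot (n y z) (wedge (dyv v y z) (dzv v y z) (dyv f y z) (dzv f y z))) =
  dbl rho (fun y z =>
    dot (v y z) (wedge (dyv n y z) (dzv n y z) (dyv f y z) (dzv f y z))) +
  bd_int rho (fun e s =>
    dot (cross (at_edge n e s) (at_edge v e s))
        (edge_vel rho f e s)).
Proof.
intros Cv.
assert (CP : C1v (fun y z => cross (n y z) (v y z))) by (apply C1v_cross; assumption).
rewrite <- (green_vec rho (fun y z => cross (n y z) (v y z)) f rho_gt0 CP C1f).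
rewrite <- dbl_plus.
- f_equal; apply funext2; intros y z; apply vbracket_cross, Cv.
- apply C0_dot; intros i; [apply C1v_C0, Cv|apply C0_wedge, C1n].
- apply C0_vbracket; assumption.
Qed.

Lemma surf_int_sdiv v : C1v v ->
  surf_int rho f (fun y z => sigma * sdiv f v y z) =
  sigma * dbl rho (fun y z =>
    dot (n y z) (wedge (dyv v y z) (dzv v y z) (dyv f y z) (dzv f y z))).
Proof.
intros Cv; rewrite <- dbl_scal.
- apply (dbl_ext rho (fun y z => sigma * sdiv f v y z * vnorm (area_vec f y z)) _ rho_gt0).
  intros y z Hy Hz; assert (HS : inS0 rho y z) by (unfold inS0; lra).
  rewrite Rmult_assoc, (sdiv_area f v y z (regular y z HS)).
  pose proof Hn as (_ & _ & _ & K); destruct (K y z HS) as (_ & -> & _); reflexivity.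
- apply C0_dot; intros i; [apply C1v_C0, C1n|apply C0_wedge, Cv].
Qed.

Lemma critical_formula v : inV rho theta0 f v ->
  dbl rho (fun y z =>
    dot (v y z) (wedge (dyv n y z) (dzv n y z) (dyv f y z) (dzv f y z))) +
  bd_int rho (fun e s =>
    dot (cross (at_edge n e s) (at_edge v e s))
        (edge_vel rho f e s)) = 0.
Proof.
intros Hv; assert (K := crit v Hv); assert (Cv := C2v_C1v v (proj1 Hv)).
rewrite (surf_int_sdiv v Cv), (first_variation_formula v Cv) in K.
apply Rmult_integral in K; destruct K; lra.
Qed.

(** The test fields vanish on the boundary.  The vector [[n,f]] is [-2 H] times
    [area_vec]. *)
Lemma mean_curvature_zero y z : -1 < y < 1 -> 0 < z < rho ->
  wedge (dyv n y z) (dzv n y z) (dyv f y z) (dzv f y z) = vzero.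
Proof.
intros Hy Hz; apply functional_extensionality; intros i; unfold vzero.
set (b := fun y z => edge_cut rho true y z * edge_cut rho false y z).
assert (Cb : C2 b) by (apply C2_mult; apply C2_edge_cut).
apply (fundamental_lemma rho b
  (fun y z => wedge (dyv n y z) (dzv n y z) (dyv f y z) (dzv f y z) i) rho_gt0);
  [apply C1_C0, C2_C1, Cb|apply C0_wedge, C1n| | |exact Hy|exact Hz].
- intros a c Ha Hc; apply Rmult_lt_0_compat; apply edge_cut_interior; assumption.
- intros phi Cphi.
  set (v := fun y z => vscal (b y z * phi y z) (unitv i)).
  assert (Zb : forall e s, b (edge_y e s) (edge_z rho e s) = 0).
  { intros e s; unfold b; destruct (wire_edge true e) eqn:E.
    - rewrite edge_cut_eq0 by exact E; ring.
    - rewrite (edge_cut_eq0 rho false e s); [ring|destruct e; simpl in *; congruence]. }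
  assert (Zv : forall e s, v (edge_y e s) (edge_z rho e s) = vzero).
  { intros e s; unfold v; rewrite Zb; apply functional_extensionality; intros j; vring. }
  assert (Hv : inV rho theta0 f v).
  { apply inV_intro.
    - apply C2v_scal; [apply C2_mult; assumption|apply C2v_const].
    - intros e s _ _; apply Zv.
    - intros e s _ _; rewrite Zv; vring. }
  assert (K := critical_formula v Hv).
  rewrite (bd_int_ext rho _ (fun _ _ => 0 * 0) rho_gt0) in K.
  2:{ intros e s _; rewrite Zv; vring. }
  rewrite (bd_int_scal rho 0 (fun _ _ => 0)), Rmult_0_l, Rplus_0_r in K
    by (intros e; apply continuous_ex_RInt; intros; apply continuous_const).
  rewrite <- K; f_equal; apply funext2; intros y' z'.
  unfold v; set (X := wedge _ _ _ _).
  replace (dot (vscal (b y' z' * phi y' z') (unitv i)) X)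
    with (b y' z' * phi y' z' * dot (unitv i) X) by vring.
  rewrite dot_unitv; reflexivity.
Qed.

(** On Y, up to a factor, the component [i] of the projection of the conormal to the
    plane orthogonal to the radius. *)
Let q (i : axis) (y z : R) : R :=
  dot (vsub (unitv i) (vscal (radial f y z i) (radial f y z))) (cross (along h f y z) (n y z)).

Lemma C0_q i : C0 (q i).
Proof.
assert (Cr : forall j, C0 (fun y z => radial f y z j))
  by (intros j; apply C1v_C0, C2v_C1v, C2v_radial, C2f).
apply C0_dot.
- intros j; unfold vsub, vscal; apply C0_minus; [apply C0_const|].
  apply C0_mult; apply Cr.
- apply C0_cross; intros j; [|apply C1v_C0, C1n].
  unfold along; destruct h; [apply C0_dzv, C1f|apply C0_dyv, C1f].
Qed.

Lemma Y_radius e s : wire_edge h e = false -> in_edge rho e s ->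
  dot (at_edge (radial f) e s) (at_edge (radial f) e s) = 1.
Proof.
intros E Hs; rewrite dot_radial.
apply Rminus_diag_uniq.
apply (edge_closure rho e (fun s => radius2 (at_edge f e s) - 1) rho_gt0);
  [| |exact Hs].
- intros x; apply (continuous_on_edge rho e (fun y z => radius2 (f y z) - 1)).
  apply C0_minus; [|apply C0_const].
  unfold radius2; apply C0_plus; apply C0_mult; apply (C1v_C0 f _ C1f).
- intros x Hx; rewrite (edge_Y_radius2 rho theta0 f rho_gt0 adm e x (open_in_edge _ _ _ Hx)).
  + apply Rminus_eq_0.
  + apply (proj2 Hwires e x E Hx).
Qed.

(** The conormal is radial because the test fields range over all projections to
    the tangent planes of the cylinder. *)
Lemma conormal_projection e s i : wire_edge h e = false -> in_edge rho e s ->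
  on_edge rho e (q i) s = 0.
Proof.
intros E Hs; apply (edge_closure rho e (on_edge rho e (q i)) rho_gt0);
  [intros; apply continuous_on_edge, C0_q| |exact Hs]; clear s Hs; intros s Hs.
set (w := fun e s => on_edge rho e (edge_cut rho h) s).
apply (fundamental_lemma_edges rho w (q i) rho_gt0); [| apply C0_q | | |exact Hs|].
- intros e' s'; apply continuous_on_edge, C1_C0, C2_C1, C2_edge_cut.
- intros e' s' Hs'; unfold w, on_edge; destruct (wire_edge h e') eqn:E'.
  + rewrite edge_cut_eq0 by exact E'; lra.
  + apply Rlt_le, edge_cut_gt0; assumption.
- intros phi Cphi.
  set (v := fun y z => vscal (edge_cut rho h y z * side rho h y z * phi y z)
     (vsub (unitv i) (vscal (radial f y z i) (radial f y z)))).
  assert (Zv : forall e s, wire_edge h e = true -> v (edge_y e s) (edge_z rho e s) = vzero).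
  { intros e' s' E'; unfold v; rewrite edge_cut_eq0 by exact E'.
    apply functional_extensionality; intros j; vring. }
  assert (Hv : inV rho theta0 f v).
  { apply inV_intro; [|intros; apply Zv; assumption|].
    - apply C2v_scal.
      + apply C2_mult; [apply C2_mult; [apply C2_edge_cut|apply C2_side]|exact Cphi].
      + apply C2v_sub; [apply C2v_const|apply C2v_scal; [apply C2v_radial, C2f|]].
        apply C2v_radial, C2f.
    - intros e' s' E' Hs'; unfold v.
      set (r := radial f (edge_y e' s') (edge_z rho e' s')); set (k := _ * _ * _).
      replace (dot (vscal k (vsub (unitv i) (vscal (r i) r))) r)
        with (k * (dot (unitv i) r - r i * dot r r)) by vring.
      unfold r; rewrite Y_radius by assumption; rewrite dot_unitv; ring. }
  assert (K := critical_formula v Hv).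
  rewrite (dbl_ext rho _ (fun _ _ => 0 * 0) rho_gt0) in K.
  2:{ intros y z Hy Hz; rewrite mean_curvature_zero by assumption; vring. }
  rewrite (dbl_scal rho 0 (fun _ _ => 0)), Rmult_0_l, Rplus_0_l in K by apply C0_const.
  rewrite <- K; apply (bd_int_ext rho _ _ rho_gt0); intros e' s' Hs'.
  destruct (wire_edge h e') eqn:E'.
  + rewrite Zv by exact E'; unfold w, on_edge; rewrite edge_cut_eq0 by exact E'; vring.
  + rewrite (edge_vel_along rho h f e' s' E'); unfold v, w, q, on_edge.
    rewrite (side_edge rho h e' s' rho_gt0 E').
    set (c := edge_cut _ _ _ _); set (D := along _ _ _ _); set (N := n _ _).
    set (P := vsub _ _); set (ph := phi _ _).
    transitivity (c * ph * (edge_sgn e' * edge_sgn e') * dot P (cross D N)); [|vring].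
    replace (edge_sgn e' * edge_sgn e') with 1 by (destruct e'; simpl; ring); ring.
- unfold w, on_edge; apply Rgt_not_eq, edge_cut_gt0; assumption.
Qed.

Let kappa (e : edge) (s : R) : R :=
  dot (at_edge (radial f) e s)
      (cross (edge_vel rho f e s) (at_edge n e s)).

Lemma conormal_radial e s : wire_edge h e = false -> in_edge rho e s ->
  cross (edge_vel rho f e s) (at_edge n e s) =
  vscal (kappa e s) (at_edge (radial f) e s).
Proof.
intros E Hs; apply functional_extensionality; intros i.
assert (K := conormal_projection e s i E Hs); unfold on_edge, q in K; unfold kappa.
rewrite (edge_vel_along rho h f e s E).
set (r := radial f _ _) in *; set (D := along h f _ _) in *; set (N := n _ _) in *.
assert (X : cross D N i - r i * dot r (cross D N) = 0).
{ rewrite <- K, <- (dot_unitv i (cross D N)); vring. }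
replace (cross (vscal (edge_sgn e) D) N i) with (edge_sgn e * cross D N i)
  by (destruct i; vring).
replace (vscal (dot r (cross (vscal (edge_sgn e) D) N)) r i)
  with (edge_sgn e * (r i * dot r (cross D N))) by (unfold vscal at 1; vring).
f_equal; lra.
Qed.

Lemma dot_normal_dyv y z : dot (n y z) (dyv f y z) = 0.
Proof. rewrite (proj1 (proj2 (proj2 Hn))); unfold area_vec; vring. Qed.

Lemma dot_normal_dzv y z : dot (n y z) (dzv f y z) = 0.
Proof. rewrite (proj1 (proj2 (proj2 Hn))); unfold area_vec; vring. Qed.

Lemma dot_normal_edge_vel e s :
  dot (at_edge n e s) (edge_vel rho f e s) = 0.
Proof.
assert (Ky := dot_normal_dyv (edge_y e s) (edge_z rho e s)).
assert (Kz := dot_normal_dzv (edge_y e s) (edge_z rho e s)).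
destruct e; simpl in *; try assumption.
- replace 0 with (-1 * 0) by ring; rewrite <- Ky; vring.
- replace 0 with (-1 * 0) by ring; rewrite <- Kz; vring.
Qed.

Lemma normal_unit y z : inS0 rho y z -> dot (n y z) (n y z) = 1.
Proof. intros HS; apply Hn, HS. Qed.

Lemma edge_vel_norm_gt0 e s : in_edge rho e s -> 0 < vnorm (edge_vel rho f e s).
Proof.
intros Hs; apply vnorm_gt0, edge_vel_neq0, regular, in_edge_S0; assumption.
Qed.

Lemma kappa_sqr e s : wire_edge h e = false -> in_edge rho e s ->
  kappa e s * kappa e s = vnorm (edge_vel rho f e s) * vnorm (edge_vel rho f e s).
Proof.
intros E Hs; rewrite vnorm_sqr; assert (K := conormal_radial e s E Hs).
assert (R := Y_radius e s E Hs).
set (r := radial f _ _) in *; set (N := n _ _) in *; set (u := edge_vel _ _ _ _) in *.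
assert (NN : dot N N = 1) by (apply normal_unit, in_edge_S0; assumption).
assert (Nu : dot N u = 0) by apply dot_normal_edge_vel.
transitivity (dot (cross u N) (cross u N)).
- rewrite K; replace (dot (vscal (kappa e s) r) (vscal (kappa e s) r))
    with (kappa e s * kappa e s * dot r r) by vring; rewrite R; ring.
- replace (dot (cross u N) (cross u N)) with (dot u u * dot N N - dot N u * dot N u) by vring.
  rewrite NN, Nu; ring.
Qed.


(** Where the surface meets the cylinder next to a wire, it comes from inside the
    cylinder, hence its outward conormal points away from the axis. *)
Definition outward (e : edge) (y z : R) : vec :=
  match e with
  | e_right => dyv f y z | e_left => vscal (-1) (dyv f y z)
  | e_top => dzv f y z | e_bottom => vscal (-1) (dzv f y z)
  end.

Lemma outward_conormal e s : in_edge rho e s ->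
  0 < dot (at_edge (outward e) e s)
          (cross (edge_vel rho f e s) (at_edge n e s)).
Proof.
intros Hs; assert (HS := in_edge_S0 rho e s rho_gt0 Hs).
assert (K := vnorm_gt0 _ (regular _ _ HS)).
assert (E : dot (at_edge n e s) (area_vec f (edge_y e s) (edge_z rho e s)) =
  vnorm (area_vec f (edge_y e s) (edge_z rho e s))).
{ pose proof Hn as (_ & _ & E1 & E2); rewrite E1, (proj1 (E2 _ _ HS)).
  set (N := area_vec f _ _) in *.
  replace (dot (vscal (/ vnorm N) N) N) with (/ vnorm N * dot N N) by vring.
  rewrite <- vnorm_sqr; field; lra. }
rewrite <- E in K; unfold area_vec in K.
apply (Rlt_le_trans _ _ _ K); right; destruct e; simpl; vring.
Qed.

Lemma radius2_has_C1 : has_C1 (fun y z => radius2 (f y z))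
  (fun y z => 2 * dot (radial f y z) (dyv f y z))
  (fun y z => 2 * dot (radial f y z) (dzv f y z)).
Proof.
assert (K := fun i => has_C1_mult _ _ _ _ _ _ (C1v_has f i C1f) (C1v_has f i C1f)).
eapply has_C1_ext; [exact (has_C1_plus _ _ _ _ _ _ (K ax_x) (K ax_y))| |];
  intros; unfold radial, cyl_normal; vring.
Qed.

Lemma corner_outward e : wire_edge h e = false ->
  0 <= dot (radial f (edge_y e (edge_lo e)) (edge_z rho e (edge_lo e)))
           (outward e (edge_y e (edge_lo e)) (edge_z rho e (edge_lo e))).
Proof.
intros E.
assert (H1 : radius2 (f (edge_y e (edge_lo e)) (edge_z rho e (edge_lo e))) = 1).
{ rewrite <- dot_radial; apply Y_radius; [exact E|].
  assert (L := edge_lt rho e rho_gt0); unfold in_edge; lra. }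
pose proof radius2_has_C1 as (_ & _ & D).
assert (LE := edge_radius2_le1 rho theta0 f rho_gt0 adm).
destruct h, e; simpl in E; try discriminate; simpl in *; unfold vscal.
- assert (K : 0 <= 2 * dot (radial f 1 0) (dyv f 1 0)); [|lra].
  apply (derive_ge0_left (fun t => radius2 (f t 0)) 1); [apply (D 1 0)|].
  exists 1; split; [lra|]; intros t Ht; rewrite H1.
  apply (LE e_bottom t); unfold in_edge; simpl; lra.
- replace (dot (radial f (-1) 0) (fun i => -1 * dyv f (-1) 0 i))
    with (- dot (radial f (-1) 0) (dyv f (-1) 0)) by vring.
  assert (K : 2 * dot (radial f (-1) 0) (dyv f (-1) 0) <= 0); [|lra].
  apply (derive_le0_right (fun t => radius2 (f t 0)) (-1)); [apply (D (-1) 0)|].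
  exists 1; split; [lra|]; intros t Ht; rewrite H1.
  apply (LE e_bottom t); unfold in_edge; simpl; lra.
- replace (dot (radial f (-1) 0) (fun i => -1 * dzv f (-1) 0 i))
    with (- dot (radial f (-1) 0) (dzv f (-1) 0)) by vring.
  assert (K : 2 * dot (radial f (-1) 0) (dzv f (-1) 0) <= 0); [|lra].
  apply (derive_le0_right (fun t => radius2 (f (-1) t)) 0); [apply (D (-1) 0)|].
  exists rho; split; [lra|]; intros t Ht; rewrite H1.
  apply (LE e_left t); unfold in_edge; simpl; lra.
- assert (K : 0 <= 2 * dot (radial f (-1) rho) (dzv f (-1) rho)); [|lra].
  apply (derive_ge0_left (fun t => radius2 (f (-1) t)) rho); [apply (D (-1) rho)|].
  exists rho; split; [lra|]; intros t Ht; rewrite H1.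
  apply (LE e_left t); unfold in_edge; simpl; lra.
Qed.

Lemma kappa_continuous e s : continuous (kappa e) s.
Proof.
assert (E : forall s, dot (cross (at_edge n e s)
  (at_edge (radial f) e s)) (edge_vel rho f e s) = kappa e s)
  by (intros t; unfold kappa; vring).
apply (continuous_ext _ _ _ E).
apply (continuous_dot_edge_vel rho (fun y z => cross (n y z) (radial f y z)) f e s).
- apply C0_cross; intros i; apply C1v_C0; [exact C1n|apply C2v_C1v, C2v_radial, C2f].
- exact C1f.
Qed.

(** [kappa] does not vanish on an edge of Y, so its sign is that at a corner.  There
    the outward direction has nonnegative radial component because it continues a
    wire edge, on which the radius is at most 1. *)
Lemma kappa_gt0 e s : wire_edge h e = false -> in_edge rho e s -> 0 < kappa e s.
Proof.
intros E Hs.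
assert (NZ : forall t, in_edge rho e t -> kappa e t <> 0).
{ intros t Ht Z; assert (K := kappa_sqr e t E Ht); assert (P := edge_vel_norm_gt0 e t Ht).
  rewrite Z in K; nra. }
set (s0 := edge_lo e).
assert (H0 : in_edge rho e s0)
  by (assert (L := edge_lt rho e rho_gt0); unfold in_edge, s0; lra).
assert (P0 : 0 < kappa e s0).
{ assert (O := outward_conormal e s0 H0); rewrite (conormal_radial e s0 E H0) in O.
  assert (C := corner_outward e E); fold s0 in C.
  set (r := radial f _ _) in *; set (o := outward e _ _) in *.
  replace (dot o (vscal (kappa e s0) r)) with (kappa e s0 * dot r o) in O by vring.
  nra. }
destruct (Rlt_le_dec 0 (kappa e s)) as [|N]; [assumption|exfalso].
assert (N' : kappa e s < 0) by (specialize (NZ s Hs); lra).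
destruct (IVT_between (kappa e) s s0 0 (kappa_continuous e)) as (t & Ht & Z); [lra|].
apply (NZ t); [|exact Z]; unfold in_edge in *; lra.
Qed.

Lemma conormal_is_radius e s : wire_edge h e = false -> in_edge rho e s ->
  cross (edge_vel rho f e s) (at_edge n e s) =
  vscal (vnorm (edge_vel rho f e s)) (at_edge (radial f) e s).
Proof.
intros E Hs; rewrite (conormal_radial e s E Hs); f_equal.
assert (K := kappa_sqr e s E Hs); assert (P := kappa_gt0 e s E Hs).
assert (Q := edge_vel_norm_gt0 e s Hs); nra.
Qed.

Lemma normal_radial e s : wire_edge h e = false -> in_edge rho e s ->
  dot (at_edge n e s) (at_edge (radial f) e s) = 0.
Proof.
intros E Hs; assert (K := conormal_is_radius e s E Hs).
assert (Q := edge_vel_norm_gt0 e s Hs).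
set (N := n _ _) in *; set (r := radial f _ _) in *; set (u := edge_vel _ _ _ _) in *.
assert (X : vnorm u * dot N r = 0).
{ replace (vnorm u * dot N r) with (dot N (vscal (vnorm u) r)) by vring.
  rewrite <- K; vring. }
apply Rmult_integral in X; destruct X; [lra|assumption].
Qed.

Lemma edge_vel_radial e s : edge_vel rho (radial f) e s =
  mkvec (edge_vel rho f e s ax_x) (edge_vel rho f e s ax_y) 0.
Proof.
assert (Ky : forall y z, dyv (radial f) y z = mkvec (dyv f y z ax_x) (dyv f y z ax_y) 0).
{ intros y z; apply vec_ext; try reflexivity.
  exact (Derive_const 0 y). }
assert (Kz : forall y z, dzv (radial f) y z = mkvec (dzv f y z ax_x) (dzv f y z ax_y) 0).
{ intros y z; apply vec_ext; try reflexivity.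
  exact (Derive_const 0 z). }
destruct e; unfold edge_vel; rewrite ?Ky, ?Kz; apply vec_ext; vexpand; ring.
Qed.

(** A wire is straight: an edge lying on it has a constant direction. *)
Lemma wire_direction e : wire_edge h e = true -> exists d, d <> vzero /\
  forall s, edge_lo e < s < edge_hi rho e -> cross d (edge_vel rho f e s) = vzero.
Proof.
intros E; assert (W := proj1 Hwires e).
assert (L := edge_lt rho e rho_gt0).
set (s0 := edge_lo e); assert (H0 : in_edge rho e s0) by (unfold in_edge, s0; lra).
set (p := fun s => f (edge_y e s) (edge_z rho e s)) in *.
assert (HH := fun s Hs => wire_edge_height rho theta0 f rho_gt0 adm e
  (fun t Ht => W t E Ht) s s0 Hs H0); cbv beta in HH; fold (p s0) in HH.
assert (X : exists d, d <> vzero /\ d ax_z = 0 /\ forall s, in_edge rho e s ->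
  p s ax_x * d ax_y - p s ax_y * d ax_x = 0).
{ destruct (wires_gauge _ _ _ (W s0 E H0)) as (_ & _ & Z); fold (p s0) in Z.
  assert (T := cos_sin_1 theta0); destruct Z as [Z|Z].
  - exists (mkvec 0 1 0); split; [|split; [reflexivity|]].
    + intros Q; assert (Qy := equal_f Q ax_y); unfold mkvec, vzero in Qy; lra.
    + intros s Hs; specialize (HH s Hs); destruct (W s E Hs) as [(t & _ & Q)|(t & _ & Q)];
        fold (p s) in Q, HH; rewrite Q in HH |- *; simpl in *; [ring|lra].
  - exists (mkvec (- sin theta0) (cos theta0) 0); split; [|split; [reflexivity|]].
    + intros Q; assert (Qx := equal_f Q ax_x); assert (Qy := equal_f Q ax_y).
      unfold mkvec, vzero in Qx, Qy; nra.
    + intros s Hs; specialize (HH s Hs); destruct (W s E Hs) as [(t & _ & Q)|(t & _ & Q)];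
        fold (p s) in Q, HH; rewrite Q in HH |- *; simpl in *; [lra|ring]. }
destruct X as (d & Hd & Hdz & Hp); exists d; split; [exact Hd|].
intros s Hs.
assert (Uz : edge_vel rho f e s ax_z = 0).
{ assert (K : edge_diff rho e (fun y z => dot (mkvec 0 0 1) (vsub (f y z) (p s0))) s = 0).
  { apply edge_diff_eq0; [|exact Hs|].
    - apply (C1_dot (fun _ _ => mkvec 0 0 1) (fun y z => vsub (f y z) (p s0))).
      + apply C2v_C1v, C2v_const.
      + apply (C1v_sub f (fun _ _ => p s0)); [exact C1f|apply C2v_C1v, C2v_const].
    - intros t Ht; unfold on_edge; rewrite (dot_unitv ax_z); unfold vsub.
      rewrite (HH t (open_in_edge _ _ _ Ht)); ring. }
  replace (fun y z => dot (mkvec 0 0 1) (vsub (f y z) (p s0)))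
    with (fun y z => f y z ax_z - p s0 ax_z) in K by (apply funext2; intros; vring).
  rewrite edge_vel_comp, <- K.
  assert (Q := has_C1_minus _ _ _ _ _ _ (C1v_has f ax_z C1f) (has_C1_const (p s0 ax_z))).
  unfold edge_diff, on_edge; rewrite (has_C1_dy _ _ _ Q), (has_C1_dz _ _ _ Q).
  destruct e; unfold dyv, dzv; ring. }
assert (Uxy : edge_vel rho f e s ax_x * d ax_y - edge_vel rho f e s ax_y * d ax_x = 0).
{ set (c := mkvec (d ax_y) (- d ax_x) 0).
  assert (K : edge_diff rho e (fun y z => dot c (f y z)) s = 0).
  { apply edge_diff_eq0; [|exact Hs|].
    - apply (C1_dot (fun _ _ => c) f); [apply C2v_C1v, C2v_const|exact C1f].
    - intros t Ht; rewrite <- (Hp t (open_in_edge _ _ _ Ht)); unfold on_edge, p, c; vring. }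
  rewrite (edge_diff_dot rho (fun _ _ => c) f e s (C2v_C1v _ (C2v_const c)) C1f) in K.
  rewrite edge_vel_const in K; rewrite <- K; unfold c; vring. }
apply vec_ext; unfold cross, mkvec, vzero; rewrite ?Uz, ?Hdz; lra.
Qed.

(** * The second variation as a quadratic form in the normal component *)

Definition form_density (c : R -> R -> R) (y z : R) : R :=
  dirichlet (mu y z) (dyv f y z) (dzv f y z) (dy c y z) (dz c y z) +
  2 * (c y z * c y z) * dot (n y z) (cross (dyv n y z) (dzv n y z)).

(** The density [(t . z)^2 dl] in the parameter of the edge. *)
Definition Y_weight (e : edge) (s : R) : R :=
  if wire_edge h e then 0 else
  edge_vel rho f e s ax_z * edge_vel rho f e s ax_z / vnorm (edge_vel rho f e s).

Definition form (c : R -> R -> R) : R :=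
  dbl rho (form_density c) -
  bd_int rho (fun e s => Y_weight e s * (on_edge rho e c s * on_edge rho e c s)).

Lemma form_density_cv ck c : cv1 rho ck c ->
  cv0 rho (fun k => form_density (ck k)) (form_density c).
Proof.
intros (_ & _ & H0 & H1 & H2).
assert (K : forall g tk t, C0 g -> cv0 rho tk t ->
  cv0 rho (fun k y z => g y z * tk k y z) (fun y z => g y z * t y z))
  by (intros g tk t Hg; apply (cv0_mult rho (fun _ => g) g), cv0_const, Hg).
assert (Fy : forall i, C0 (fun y z => dyv f y z i)) by (intros i; apply C0_dyv, C1f).
assert (Fz : forall i, C0 (fun y z => dzv f y z i)) by (intros i; apply C0_dzv, C1f).
assert (Cmu : C0 mu) by (apply C1_C0, Hn).
assert (Gzz := C0_mult _ _ Cmu (C0_dot (dzv f) (dzv f) Fz Fz)).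
assert (Gyz := C0_mult _ _ Cmu (C0_mult _ _ (C0_const 2) (C0_dot (dyv f) (dzv f) Fy Fz))).
assert (Gyy := C0_mult _ _ Cmu (C0_dot (dyv f) (dyv f) Fy Fy)).
assert (Gn : C0 (fun y z => 2 * dot (n y z) (cross (dyv n y z) (dzv n y z)))).
{ apply C0_mult; [apply C0_const|].
  apply (C0_dot n (fun y z => cross (dyv n y z) (dzv n y z)));
    [intros i; apply C1v_C0, C1n|].
  apply (C0_cross (dyv n) (dzv n)); intros i; [apply C0_dyv, C1n|apply C0_dzv, C1n]. }
eapply cv0_ext; [| |exact (cv0_plus rho _ _ _ _ (cv0_plus rho _ _ _ _ (cv0_minus rho _ _ _ _
  (K _ _ _ Gzz (cv0_mult rho _ _ _ _ H1 H1)) (K _ _ _ Gyz (cv0_mult rho _ _ _ _ H1 H2)))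
  (K _ _ _ Gyy (cv0_mult rho _ _ _ _ H2 H2))) (K _ _ _ Gn (cv0_mult rho _ _ _ _ H0 H0)))].
- intros k y z; unfold form_density, dirichlet; ring.
- intros y z; unfold form_density, dirichlet; ring.
Qed.

Lemma C0_form_density c : C1 c -> C0 (form_density c).
Proof. intros Cc; apply (form_density_cv (fun _ => c)), cv1_const, Cc. Qed.

Lemma Y_weight_continuous e s : in_edge rho e s -> continuous (Y_weight e) s.
Proof.
intros Hs; unfold Y_weight; destruct (wire_edge h e); [apply continuous_const|].
assert (K := fun i => continuous_edge_vel rho f e i s C1f).
assert (P := edge_vel_norm_gt0 e s Hs).
assert (D : continuous (fun s => dot (edge_vel rho f e s) (edge_vel rho f e s)) s).
{ unfold dot, sum3; repeat apply @continuous_plus; apply @continuous_mult; apply K. }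
assert (S : continuous (fun s => vnorm (edge_vel rho f e s)) s).
{ unfold vnorm; apply (continuous_comp (fun s => dot (edge_vel rho f e s)
    (edge_vel rho f e s)) sqrt); [exact D|].
  apply continuity_pt_filterlim, continuity_pt_sqrt, dot_ge0. }
unfold Rdiv; apply @continuous_mult; [apply @continuous_mult; apply K|].
apply (continuous_comp (fun s => vnorm (edge_vel rho f e s)) Rinv); [exact S|].
apply continuity_pt_filterlim, continuity_pt_inv; [apply continuity_pt_id|].
apply Rgt_not_eq, P.
Qed.

Lemma ex_RInt_Y_weight c e : C0 c -> ex_RInt
  (fun s => Y_weight e s * (on_edge rho e c s * on_edge rho e c s)) (edge_lo e) (edge_hi rho e).
Proof.
intros Cc; apply (@ex_RInt_continuous R_CompleteNormedModule); intros s Hs.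
assert (L := edge_lt rho e rho_gt0); rewrite Rmin_left, Rmax_right in Hs by lra.
apply @continuous_mult; [apply Y_weight_continuous, Hs|].
apply @continuous_mult; apply continuous_on_edge, Cc.
Qed.

(** Symmetry of the second fundamental form, from [n . f_y = n . f_z = 0]. *)
Lemma bracket_normal y z : inS0 rho y z ->
  dot (dyv n y z) (dzv f y z) = dot (dzv n y z) (dyv f y z).
Proof.
intros HS.
assert (Cy := C2v_dyv f C2f); assert (Cz := C2v_dzv f C2f).
assert (Z : forall P gy gz, (forall y z, dot (n y z) (P y z) = 0) ->
  has_C1 (fun y z => dot (n y z) (P y z)) gy gz -> gy y z = 0 /\ gz y z = 0).
{ intros P gy gz HP K.
  replace (fun y z => dot (n y z) (P y z)) with (fun _ _ : R => 0) in K
    by (apply funext2; intros; symmetry; apply HP).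
  rewrite <- (has_C1_dy _ _ _ K), <- (has_C1_dz _ _ _ K).
  rewrite (has_C1_dy _ _ _ (has_C1_const 0)), (has_C1_dz _ _ _ (has_C1_const 0)); auto. }
destruct (Z (dyv f) _ _ dot_normal_dyv (has_C1_dot n (dyv f) C1n Cy)) as (_ & E1).
destruct (Z (dzv f) _ _ dot_normal_dzv (has_C1_dot n (dzv f) C1n Cz)) as (E2 & _).
assert (S : dyv (dzv f) y z = dzv (dyv f) y z).
{ apply functional_extensionality; intros i; apply (C2_mixed _ (C2f i)). }
rewrite S in E2; lra.
Qed.

Section variation.

Variables v a : R -> R -> vec.
Hypothesis Hv : inV rho theta0 f v.
Hypothesis Ha : acceleration rho theta0 f v a.

Let c (y z : R) : R := dot (v y z) (n y z).
Let w (y z : R) : vec := vsub (v y z) (vscal (c y z) (n y z)).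
Let C1vv : C1v v := C2v_C1v v (proj1 Hv).
Let C1va : C1v a := C2v_C1v a (proj1 Ha).
Let C1c : C1 c := C1_dot v n C1vv C1n.
Let C1w : C1v w := C1v_sub v _ C1vv (C1v_scal c n C1c C1n).
Let P1 (y z : R) : vec := cross (n y z) (w y z).
Let C1P1 : C1v P1 := C1v_cross n w C1n C1w.
Let P2 (y z : R) : vec := vscal (c y z) (P1 y z).
Let C1P2 : C1v P2 := C1v_scal c P1 C1c C1P1.
Let P3 (y z : R) : vec := cross (n y z) (a y z).
Let C1P3 : C1v P3 := C1v_cross n a C1n C1va.

Lemma second_variation_pointwise y z : -1 < y < 1 -> 0 < z < rho ->
  ((vnorm (mapply (mtr (vgrad f v y z)) (normal f y z))) ^ 2
    + (sdiv f v y z) ^ 2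
    - mtrace (mmul (vgrad f v y z) (vgrad f v y z))
    + sdiv f a y z) * vnorm (area_vec f y z) =
  form_density c y z + vbracket P1 w y z + 2 * vbracket P2 n y z + vbracket P3 f y z.
Proof.
intros Hy Hz; assert (HS : inS0 rho y z) by (unfold inS0; lra).
assert (Reg := regular y z HS).
pose proof Hn as (_ & _ & Emu & K).
destruct (K y z HS) as (Lmu & En & _ & _ & N1 & Ny & Nz); clear K.
assert (HH := mean_curvature_zero y z Hy Hz).
transitivity ((vnorm (mapply (mtr (vgrad f v y z)) (normal f y z))) ^ 2 *
  vnorm (area_vec f y z) +
  ((sdiv f v y z) ^ 2 - mtrace (mmul (vgrad f v y z) (vgrad f v y z))) *
    vnorm (area_vec f y z) + sdiv f a y z * vnorm (area_vec f y z)); [ring|].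
rewrite (div_sqr_area f v y z Reg), (sdiv_area f a y z Reg).
rewrite (covector_sqr_area f y z (dot (n y z) (dyv v y z)) (dot (n y z) (dzv v y z)) _ Reg).
2:{ intros j; rewrite <- En; unfold mapply, mtr, vgrad, sgrad, vadd, vscal, dot, sum3.
    unfold dyv at 1 2 3, dzv at 1 2 3; ring. }
rewrite <- En, <- Lmu, (vbracket_cross a y z C1va), HH.
pose proof (has_C1_dot v n C1vv C1n) as Hc.
rewrite (second_variation_density (mu y z) (dyv f y z) (dzv f y z) (n y z)
  (dyv n y z) (dzv n y z) (v y z) (dyv v y z) (dzv v y z) (c y z) (dy c y z) (dz c y z)
  (w y z) (dyv w y z) (dzv w y z)).
- destruct (dv_cross n w y z C1n C1w) as (D1 & D2); fold P1 in D1, D2.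
  destruct (dv_scal c P1 y z C1c C1P1) as (D3 & D4); fold P2 in D3, D4.
  change (vbracket (fun y z => cross (n y z) (a y z)) f y z) with (vbracket P3 f y z).
  set (X3 := vbracket P3 f y z); unfold form_density, vbracket.
  rewrite D3, D4, D1, D2; unfold P1; vring.
- apply Emu.
- exact N1.
- exact Ny.
- exact Nz.
- exact HH.
- apply bracket_normal, HS.
- reflexivity.
- unfold c; rewrite (has_C1_dy _ _ _ Hc); reflexivity.
- unfold c; rewrite (has_C1_dz _ _ _ Hc); reflexivity.
- reflexivity.
- rewrite <- (proj1 (dv_scal c n y z C1c C1n)).
  apply (dv_sub v (fun y z => vscal (c y z) (n y z)) y z C1vv (C1v_scal c n C1c C1n)).
- rewrite <- (proj2 (dv_scal c n y z C1c C1n)).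
  apply (dv_sub v (fun y z => vscal (c y z) (n y z)) y z C1vv (C1v_scal c n C1c C1n)).
Qed.

Lemma normal_component_wire e s : wire_edge h e = true ->
  edge_lo e < s < edge_hi rho e -> on_edge rho e c s = 0.
Proof.
intros E Hs; pose proof Hv as (_ & T & _).
specialize (T e s Hs (proj1 Hwires e s E (open_in_edge _ _ _ Hs))).
assert (K := dot_normal_edge_vel e s).
unfold on_edge, c; rewrite T; unfold tangent, unit_vec.
set (u := edge_vel _ _ _ _) in *; set (N := n _ _) in *; set (k := dot _ (vscal _ u)).
replace (dot (vscal k (vscal (/ vnorm u) u)) N) with (k * / vnorm u * dot N u) by vring.
rewrite K; ring.
Qed.

Lemma tangential_part_wire e s d : wire_edge h e = true ->
  edge_lo e < s < edge_hi rho e -> cross d (edge_vel rho f e s) = vzero ->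
  cross d (at_edge w e s) = vzero.
Proof.
intros E Hs Hd; pose proof Hv as (_ & T & _).
specialize (T e s Hs (proj1 Hwires e s E (open_in_edge _ _ _ Hs))).
assert (K := normal_component_wire e s E Hs); unfold on_edge in K.
unfold w; rewrite K, T; unfold tangent, unit_vec.
set (u := edge_vel _ _ _ _) in *; set (k := dot _ (vscal _ u)); set (N := n _ _).
replace (cross d (vsub (vscal k (vscal (/ vnorm u) u)) (vscal 0 N)))
  with (vscal (k * / vnorm u) (cross d u)) by (apply vec_ext; vring).
rewrite Hd; apply functional_extensionality; intros i; vring.
Qed.

(** On a wire [w] and [dw] are both along the wire, [c] is 0 and the acceleration is
    tangent to the edge. *)
Lemma boundary_wire e s : wire_edge h e = true -> edge_lo e < s < edge_hi rho e ->
  dot (at_edge P1 e s) (edge_vel rho w e s) +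
  2 * dot (at_edge P2 e s) (edge_vel rho n e s) +
  dot (at_edge P3 e s) (edge_vel rho f e s) = 0.
Proof.
intros E Hs; destruct (wire_direction e E) as (d & Hd & Du).
assert (Dw : cross d (edge_vel rho w e s) = vzero).
{ apply functional_extensionality; intros i; unfold vzero.
  set (g := cross (unitv i) d).
  assert (K : edge_diff rho e (fun y z => dot g (w y z)) s = 0).
  { apply edge_diff_eq0; [|exact Hs|].
    - apply (C1_dot (fun _ _ => g) w); [apply C2v_C1v, C2v_const|exact C1w].
    - intros t Ht; unfold on_edge, g.
      replace (dot (cross (unitv i) d) (at_edge w e t))
        with (dot (unitv i) (cross d (at_edge w e t))) by vring.
      rewrite (tangential_part_wire e t d E Ht (Du t Ht)); vring. }
  rewrite (edge_diff_dot rho (fun _ _ => g) w e s (C2v_C1v _ (C2v_const g)) C1w) in K.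
  rewrite edge_vel_const in K; rewrite <- K, <- (dot_unitv i (cross d _)); unfold g; vring. }
unfold P2, P1, P3.
rewrite (parallel_det d _ _ _ Hd (tangential_part_wire e s d E Hs (Du s Hs)) Dw).
assert (K := normal_component_wire e s E Hs); unfold on_edge in K; rewrite K.
pose proof Ha as (_ & T & _).
specialize (T e s Hs (proj1 Hwires e s E (open_in_edge _ _ _ Hs))).
rewrite T; unfold tangent, unit_vec; vring.
Qed.

Lemma boundary_Y e s : wire_edge h e = false -> edge_lo e < s < edge_hi rho e ->
  dot (at_edge P1 e s) (edge_vel rho w e s) +
  2 * dot (at_edge P2 e s) (edge_vel rho n e s) +
  dot (at_edge P3 e s) (edge_vel rho f e s) =
  - (Y_weight e s * (on_edge rho e c s * on_edge rho e c s)).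
Proof.
intros E Hs; assert (Hc := open_in_edge _ _ _ Hs).
assert (OY : forall t, edge_lo e < t < edge_hi rho e ->
  onY rho theta0 f (edge_y e t) (edge_z rho e t)).
{ intros t Ht; split; [apply edge_bd; [exact rho_gt0|apply open_in_edge, Ht]|].
  apply (proj2 Hwires e t E Ht). }
assert (Vr : forall t, edge_lo e < t < edge_hi rho e ->
  dot (at_edge v e t) (at_edge (radial f) e t) = 0).
{ intros t Ht; pose proof Hv as (_ & _ & K); apply K, OY, Ht. }
assert (Nr : forall t, edge_lo e < t < edge_hi rho e ->
  dot (at_edge n e t) (at_edge (radial f) e t) = 0).
{ intros t Ht; apply normal_radial; [exact E|apply open_in_edge, Ht]. }
assert (C1r : C1v (radial f)) by (apply C2v_C1v, C2v_radial, C2f).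
unfold Y_weight; rewrite E.
apply (boundary_density (vnorm (edge_vel rho f e s)) (edge_vel rho f e s)
  (at_edge (radial f) e s) (at_edge n e s)
  (at_edge v e s) (at_edge c e s)
  (at_edge w e s) (edge_vel rho w e s) (edge_vel rho n e s)
  (edge_vel rho (radial f) e s) (at_edge a e s)).
- apply edge_vel_norm_gt0, Hc.
- apply vnorm_sqr.
- apply Y_radius; assumption.
- apply normal_unit, in_edge_S0; assumption.
- apply dot_normal_edge_vel.
- apply Vr, Hs.
- reflexivity.
- apply edge_vel_radial.
- apply conormal_is_radius; assumption.
- reflexivity.
- reflexivity.
- rewrite <- (edge_diff_dot rho w (radial f) e s C1w C1r).
  apply edge_diff_eq0; [apply C1_dot; assumption|exact Hs|].
  intros t Ht; unfold on_edge, w.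
  set (r := radial f _ _); set (N := n _ _); set (k := c _ _); set (V := v _ _).
  replace (dot (vsub V (vscal k N)) r) with (dot V r - k * dot N r) by vring.
  unfold V, N, r; rewrite Vr, Nr by exact Ht; ring.
- rewrite <- (edge_diff_dot rho n (radial f) e s C1n C1r).
  apply edge_diff_eq0; [apply C1_dot; assumption|exact Hs|].
  intros t Ht; apply Nr, Ht.
- pose proof Ha as (_ & _ & K); apply K, OY, Hs.
Qed.

(** The acceleration enters through its boundary values alone, because H = 0. *)
Lemma second_variation_form : second_variation rho sigma f v a = sigma * form c.
Proof.
assert (C0d := C0_form_density c C1c).
assert (B1 := C0_vbracket P1 w C1P1 C1w); assert (B2 := C0_vbracket P2 n C1P2 C1n).
assert (B3 := C0_vbracket P3 f C1P3 C1f).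
assert (B2' : C0 (fun y z => 2 * vbracket P2 n y z))
  by (apply C0_mult; [apply C0_const|exact B2]).
assert (C0all := C0_plus _ _ (C0_plus _ _ (C0_plus _ _ C0d B1) B2') B3).
transitivity (sigma * dbl rho (fun y z => form_density c y z + vbracket P1 w y z +
  2 * vbracket P2 n y z + vbracket P3 f y z)).
{ rewrite <- dbl_scal by exact C0all.
  apply (dbl_ext rho (fun y z => sigma * ((vnorm (mapply (mtr (vgrad f v y z)) (normal f y z))) ^ 2
    + (sdiv f v y z) ^ 2 - mtrace (mmul (vgrad f v y z) (vgrad f v y z))
    + sdiv f a y z) * vnorm (area_vec f y z)) _ rho_gt0).
  intros y z Hy Hz; rewrite Rmult_assoc, second_variation_pointwise by assumption.
  reflexivity. }
f_equal.
rewrite (dbl_plus rho (fun y z => form_density c y z + vbracket P1 w y z +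
  2 * vbracket P2 n y z) (vbracket P3 f) (C0_plus _ _ (C0_plus _ _ C0d B1) B2') B3).
rewrite (dbl_plus rho (fun y z => form_density c y z + vbracket P1 w y z)
  (fun y z => 2 * vbracket P2 n y z) (C0_plus _ _ C0d B1) B2').
rewrite (dbl_plus rho (form_density c) (vbracket P1 w) C0d B1).
rewrite (dbl_scal rho 2 (vbracket P2 n) B2).
rewrite (green_vec rho P1 w rho_gt0 C1P1 C1w), (green_vec rho P2 n rho_gt0 C1P2 C1n),
  (green_vec rho P3 f rho_gt0 C1P3 C1f).
set (I1 := fun e s => dot (at_edge P1 e s) (edge_vel rho w e s)).
set (I2 := fun e s => dot (at_edge P2 e s) (edge_vel rho n e s)).
set (I3 := fun e s => dot (at_edge P3 e s) (edge_vel rho f e s)).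
assert (Bd : bd_int rho (fun e s => I1 e s + 2 * I2 e s + I3 e s) =
  - bd_int rho (fun e s => Y_weight e s * (on_edge rho e c s * on_edge rho e c s))).
{ replace (- bd_int rho (fun e s => Y_weight e s * (on_edge rho e c s * on_edge rho e c s)))
    with (-1 * bd_int rho (fun e s => Y_weight e s * (on_edge rho e c s * on_edge rho e c s)))
    by ring.
  rewrite <- bd_int_scal by (intros e; apply ex_RInt_Y_weight, C1_C0, C1c).
  apply (bd_int_ext rho _ _ rho_gt0); intros e s Hs; unfold I1, I2, I3.
  destruct (wire_edge h e) eqn:E.
  - rewrite boundary_wire by assumption; unfold Y_weight; rewrite E; ring.
  - rewrite boundary_Y by assumption; ring. }
assert (Lin : bd_int rho (fun e s => I1 e s + 2 * I2 e s + I3 e s) =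
  bd_int rho I1 + 2 * bd_int rho I2 + bd_int rho I3).
{ assert (X : forall P G e s, C1v P -> C1v G -> continuous (fun s =>
    dot (at_edge P e s) (edge_vel rho G e s)) s).
  { intros P G e s HP HG; apply continuous_dot_edge_vel; [intros i; apply C1v_C0, HP|exact HG]. }
  assert (X1 : forall e s, continuous (I1 e) s) by (intros; apply X; assumption).
  assert (X2 : forall e s, continuous (fun s => 2 * I2 e s) s)
    by (intros; apply @continuous_mult; [apply continuous_const|apply X; assumption]).
  assert (X12 : forall e s, continuous (fun s => I1 e s + 2 * I2 e s) s)
    by (intros; apply @continuous_plus; [apply X1|apply X2]).
  rewrite (bd_int_plus rho (fun e s => I1 e s + 2 * I2 e s) I3),
    (bd_int_plus rho I1 (fun e s => 2 * I2 e s)), (bd_int_scal rho 2 I2); try reflexivity;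
    intros e; apply continuous_ex_RInt; auto; intros s; apply X; assumption. }
rewrite Lin in Bd.
unfold form; lra.
Qed.

End variation.

(** * Comparison of the admissible normal components *)

Lemma form_lim ck c : cv1 rho ck c -> is_lim_seq (fun k => form (ck k)) (form c).
Proof.
intros H; pose proof H as (Ck & Cc & H0 & _).
apply is_lim_seq_minus'; [apply dbl_lim; [exact rho_gt0|apply form_density_cv, H]|].
apply bd_int_lim; [exact rho_gt0|intros; apply ex_RInt_Y_weight, C1_C0, Ck|
  intros; apply ex_RInt_Y_weight, C1_C0, Cc|].
destruct (bounded_on_edges rho Y_weight rho_gt0 Y_weight_continuous) as (W & HW & BW).
intros eps He; destruct (proj2 (proj2 (cv0_mult rho _ _ _ _ H0 H0)) (eps / W)) as [N HN]; [apply Rdiv_lt_0_compat; lra|].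
exists N; intros k Hk e s Hs.
specialize (HN k Hk _ _ (in_edge_S0 rho e s rho_gt0 Hs)); specialize (BW e s Hs).
unfold on_edge; rewrite <- Rmult_minus_distr_l, Rabs_mult.
replace eps with (W * (eps / W)) by (field; lra).
apply Rmult_le_compat; try apply Rabs_pos; assumption.
Qed.

Lemma form_nonneg_lim ck c : cv1 rho ck c -> (forall k, 0 <= form (ck k)) -> 0 <= form c.
Proof.
intros H Hp; assert (L := form_lim ck c H).
apply (is_lim_seq_le (fun _ => 0) _ 0 (form c) Hp (is_lim_seq_const 0) L).
Qed.

Lemma form_ext c1 c2 : (forall y z, inS0 rho y z -> c1 y z = c2 y z) -> form c1 = form c2.
Proof.
intros H; unfold form; f_equal.
- apply (dbl_ext rho _ _ rho_gt0); intros y z Hy Hz.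
  assert (Loc : locally_2d (fun u v => c1 u v = c2 u v) y z).
  { destruct (between_locally _ _ y Hy) as [d1 D1], (between_locally _ _ z Hz) as [d2 D2].
    assert (Hd : 0 < Rmin d1 d2) by (apply Rmin_pos; apply cond_pos).
    exists (mkposreal _ Hd); simpl; intros u v Hu Hv; apply H.
    assert (A1 := Rmin_l d1 d2); assert (A2 := Rmin_r d1 d2).
    specialize (D1 u ltac:(lra)); specialize (D2 v ltac:(lra)); unfold inS0; lra. }
  destruct (dy_dz_ext_loc c1 c2 y z Loc) as (Ey & Ez).
  unfold form_density; rewrite Ey, Ez, (H y z) by (unfold inS0; lra); reflexivity.
- apply (bd_int_ext rho _ _ rho_gt0); intros e s Hs; unfold on_edge.
  rewrite H by (apply in_edge_S0; [exact rho_gt0|apply open_in_edge, Hs]); reflexivity.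
Qed.

Lemma inequality_form c : C1 c ->
  Y_int rho theta0 f
    (fun e s => (dot (tangent rho f e s) ezed) ^ 2 * (at_edge c e s) ^ 2)
  <= surf_int rho f
    (fun y z => (vnorm (sgrad f c y z)) ^ 2 + 2 * gauss_curv f y z * (c y z) ^ 2)
  <-> 0 <= form c.
Proof.
intros Cc.
assert (ES : surf_int rho f
  (fun y z => (vnorm (sgrad f c y z)) ^ 2 + 2 * gauss_curv f y z * (c y z) ^ 2) =
  dbl rho (form_density c)).
{ apply (dbl_ext rho (fun y z => ((vnorm (sgrad f c y z)) ^ 2 +
    2 * gauss_curv f y z * (c y z) ^ 2) * vnorm (area_vec f y z)) _ rho_gt0).
  intros y z Hy Hz; assert (HS : inS0 rho y z) by (unfold inS0; lra).
  assert (Reg := regular y z HS).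
  pose proof Hn as (_ & _ & _ & K); destruct (K y z HS) as (Lmu & En & Eny & Enz & _).
  transitivity ((vnorm (sgrad f c y z)) ^ 2 * vnorm (area_vec f y z) +
    2 * (gauss_curv f y z * vnorm (area_vec f y z)) * (c y z) ^ 2); [ring|].
  rewrite (gauss_curv_area f y z Reg), (covector_sqr_area f y z (dy c y z) (dz c y z) _ Reg)
    by reflexivity.
  rewrite <- En, <- Eny, <- Enz, <- Lmu; unfold form_density; ring. }
assert (EY : Y_int rho theta0 f
    (fun e s => (dot (tangent rho f e s) ezed) ^ 2 * (at_edge c e s) ^ 2) =
  bd_int rho (fun e s => Y_weight e s * (on_edge rho e c s * on_edge rho e c s))).
{ apply (bd_int_ext rho (fun e s =>
    if excluded_middle_informative (onY rho theta0 f (edge_y e s) (edge_z rho e s))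
    then (dot (tangent rho f e s) ezed) ^ 2 * (at_edge c e s) ^ 2 *
         vnorm (edge_vel rho f e s) else 0) _ rho_gt0).
  intros e s Hs; assert (I := open_in_edge _ _ _ Hs); unfold Y_weight.
  destruct (excluded_middle_informative _) as [O|O]; destruct (wire_edge h e) eqn:E.
  - exfalso; apply (proj2 O), (proj1 Hwires e s E I).
  - assert (P := edge_vel_norm_gt0 e s I); unfold tangent, unit_vec, on_edge.
    set (u := edge_vel _ _ _ _) in *.
    replace (dot (vscal (/ vnorm u) u) ezed) with (/ vnorm u * u ax_z)
      by (unfold ezed; vring).
    field; lra.
  - ring.
  - exfalso; apply O; split; [apply edge_bd; assumption|apply (proj2 Hwires e s E Hs)]. }
rewrite ES, EY; unfold form; split; lra.
Qed.

(** Every wire point has a preimage on the boundary, and by injectivity no other. *)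
Lemma wire_points y z : inS0 rho y z -> wires rho theta0 (f y z) ->
  exists e s, wire_edge h e = true /\ in_edge rho e s /\ y = edge_y e s /\ z = edge_z rho e s.
Proof.
intros HS W; pose proof adm as (_ & Inj & _ & Cov & _).
destruct (Cov _ W) as (y' & z' & B & E).
destruct (Inj _ _ _ _ (proj1 B) HS E) as (-> & ->).
destruct (bd_edge rho y z B) as (e & s & Hs & -> & ->).
destruct (wire_edge h e) eqn:We; [exists e, s; auto|].
destruct (excluded_middle_informative (edge_lo e < s < edge_hi rho e)) as [O|O].
{ exfalso; exact (proj2 Hwires e s We O W). }
assert (Hs' : s = edge_lo e \/ s = edge_hi rho e) by (unfold in_edge in Hs; lra).
unfold in_edge; destruct h, e; simpl in *; try discriminate; destruct Hs'; subst s.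
- exists e_bottom, 1; simpl; repeat split; lra.
- exists e_top, 1; simpl; repeat split; lra.
- exists e_bottom, (-1); simpl; repeat split; lra.
- exists e_top, (-1); simpl; repeat split; lra.
- exists e_left, 0; simpl; repeat split; lra.
- exists e_right, 0; simpl; repeat split; lra.
- exists e_left, rho; simpl; repeat split; lra.
- exists e_right, rho; simpl; repeat split; lra.
Qed.

Definition interpolation (g : R -> R -> R) (y z : R) : R :=
  if h then (1 - z * / rho) * g y 0 + z * / rho * g y rho
  else (1 - y) * / 2 * g (-1) z + (1 + y) * / 2 * g 1 z.

Lemma interpolation_wire g e s : wire_edge h e = true ->
  interpolation g (edge_y e s) (edge_z rho e s) = g (edge_y e s) (edge_z rho e s).
Proof.
unfold interpolation; destruct h, e; simpl; intros; try discriminate; field; lra.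
Qed.

Lemma interpolation_zero g y z : inS0 rho y z ->
  (forall e s, wire_edge h e = true -> in_edge rho e s -> on_edge rho e g s = 0) ->
  interpolation g y z = 0.
Proof.
intros HS H; unfold interpolation, in_edge, inS0, on_edge in *.
destruct h.
- assert (E1 := H e_bottom y eq_refl (proj1 HS)).
  assert (E2 := H e_top y eq_refl (proj1 HS)); simpl in E1, E2; rewrite E1, E2; ring.
- assert (E1 := H e_left z eq_refl (proj2 HS)).
  assert (E2 := H e_right z eq_refl (proj2 HS)); simpl in E1, E2; rewrite E1, E2; ring.
Qed.


Lemma C2_interpolation g : C2 g -> C2 (interpolation g).
Proof.
intros H; unfold interpolation; destruct h.
- apply C2_plus; (apply C2_mult; [|apply C2_fix_z, H]).
  + apply C2_minus; [apply C2_const|apply C2_mult; [apply C2_z|apply C2_const]].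
  + apply C2_mult; [apply C2_z|apply C2_const].
- apply C2_plus; (apply C2_mult; [|apply C2_fix_y, H]);
    (apply C2_mult; [|apply C2_const]).
  + apply C2_minus; [apply C2_const|apply C2_y].
  + apply C2_plus; [apply C2_const|apply C2_y].
Qed.

Lemma cv1_interpolation gk g : cv1 rho gk g ->
  cv1 rho (fun k => interpolation (gk k)) (interpolation g).
Proof.
intros H.
assert (K : forall l tk t, C2 l -> cv1 rho tk t ->
  cv1 rho (fun k y z => l y z * tk k y z) (fun y z => l y z * t y z))
  by (intros l tk t Hl; apply (cv1_mult rho (fun _ => l) l), cv1_const, C2_C1, Hl).
unfold interpolation; destruct h.
- apply (cv1_plus rho (fun k y z => (1 - z * / rho) * gk k y 0)
    (fun y z => (1 - z * / rho) * g y 0) (fun k y z => z * / rho * gk k y rho)).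
  + apply (K (fun _ z => 1 - z * / rho) (fun k y _ => gk k y 0) (fun y _ => g y 0)).
    * apply C2_minus; [apply C2_const|apply C2_mult; [apply C2_z|apply C2_const]].
    * apply cv1_fix_z; [lra|exact H].
  + apply (K (fun _ z => z * / rho) (fun k y _ => gk k y rho) (fun y _ => g y rho)).
    * apply C2_mult; [apply C2_z|apply C2_const].
    * apply cv1_fix_z; [lra|exact H].
- apply (cv1_plus rho (fun k y z => (1 - y) * / 2 * gk k (-1) z)
    (fun y z => (1 - y) * / 2 * g (-1) z) (fun k y z => (1 + y) * / 2 * gk k 1 z)).
  + apply (K (fun y _ => (1 - y) * / 2) (fun k _ z => gk k (-1) z) (fun _ z => g (-1) z)).
    * apply C2_mult; [apply C2_minus; [apply C2_const|apply C2_y]|apply C2_const].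
    * apply cv1_fix_y; [lra|exact H].
  + apply (K (fun y _ => (1 + y) * / 2) (fun k _ z => gk k 1 z) (fun _ z => g 1 z)).
    * apply C2_mult; [apply C2_plus; [apply C2_const|apply C2_y]|apply C2_const].
    * apply cv1_fix_y; [lra|exact H].
Qed.

(** Approximate by C^2 functions and subtract from each the interpolation of its
    values on the wires, which tends to 0. *)
Lemma form_nonneg_C1 c : C1 c ->
  (forall e s, wire_edge h e = true -> in_edge rho e s -> on_edge rho e c s = 0) ->
  (forall g, inVN rho theta0 f g -> 0 <= form g) -> 0 <= form c.
Proof.
intros Cc Zc H.
destruct (C1_approx rho c Cc) as (gk & C2k & Lk).
rewrite (form_ext c (fun y z => c y z - interpolation c y z)).
2:{ intros y z HS; rewrite (interpolation_zero c y z HS Zc); ring. }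
apply (form_nonneg_lim (fun k y z => gk k y z - interpolation (gk k) y z)).
- exact (cv1_minus rho _ _ _ _ Lk (cv1_interpolation gk c Lk)).
- intros k; apply H; split.
  + exact (C2_minus _ _ (C2k k) (C2_interpolation _ (C2k k))).
  + intros y z HS W; destruct (wire_points y z HS W) as (e & s & E & _ & -> & ->).
    rewrite interpolation_wire by exact E; ring.
Qed.

Lemma stable_of_form_nonneg :
  (forall g, inVN rho theta0 f g -> 0 <= form g) ->
  second_variation_stable rho theta0 sigma f.
Proof.
intros H v a Hv Ha; rewrite (second_variation_form v a Hv Ha).
apply Rmult_le_pos; [lra|].
assert (Cc : C1 (fun y z => dot (v y z) (n y z)))
  by (apply C1_dot; [apply C2v_C1v, Hv|exact C1n]).
apply form_nonneg_C1; [exact Cc| |exact H].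
intros e s E Hs.
apply (edge_closure rho e (on_edge rho e (fun y z => dot (v y z) (n y z))) rho_gt0);
  [intros; apply continuous_on_edge, C1_C0, Cc| |exact Hs].
intros t Ht; exact (normal_component_wire v Hv e t E Ht).
Qed.

(** Multiplication by [(r . r + phi) I - r (x) r], with [phi] zero on Y and
    positive elsewhere: it makes any field tangent to the cylinder on Y, and is
    positive on the normal. *)
Definition tangential_filter (u : R -> R -> vec) (y z : R) : vec :=
  vsub (vscal (dot (radial f y z) (radial f y z) + edge_cut rho (negb h) y z) (u y z))
       (vscal (dot (u y z) (radial f y z)) (radial f y z)).

Lemma C2v_tangential_filter u : C2v u -> C2v (tangential_filter u).
Proof.
intros Cu; assert (Cr := C2v_radial f C2f).
apply C2v_sub; apply C2v_scal.
- apply C2_plus; [apply C2_dot; exact Cr|apply C2_edge_cut].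
- exact Cu.
- apply C2_dot; assumption.
- exact Cr.
Qed.

Lemma tangential_filter_Y u e s : wire_edge h e = false -> in_edge rho e s ->
  dot (tangential_filter u (edge_y e s) (edge_z rho e s))
      (at_edge (radial f) e s) = 0.
Proof.
intros E Hs; assert (K := Y_radius e s E Hs).
assert (Z : edge_cut rho (negb h) (edge_y e s) (edge_z rho e s) = 0).
{ apply edge_cut_eq0; destruct e; simpl in *; destruct h; simpl in *; congruence. }
unfold tangential_filter; rewrite Z.
set (r := radial f _ _) in *; set (U := u _ _).
replace (dot (vsub (vscal (dot r r + 0) U) (vscal (dot U r) r)) r)
  with (dot r r * dot U r - dot U r * dot r r) by vring; ring.
Qed.

Lemma cauchy_schwarz_unit (x r : vec) : dot x x = 1 -> dot x r * dot x r <= dot r r.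
Proof.
intros H; assert (K := dot_ge0 (cross x r)).
replace (dot (cross x r) (cross x r)) with (dot x x * dot r r - dot x r * dot x r) in K
  by vring.
rewrite H in K; lra.
Qed.

(** Off Y the cut-off is positive; on Y the normal is orthogonal to the radius. *)
Lemma tangential_filter_normal y z : inS0 rho y z ->
  0 < dot (tangential_filter n y z) (n y z).
Proof.
intros HS; assert (N1 := normal_unit y z HS).
assert (CS := cauchy_schwarz_unit (n y z) (radial f y z) N1).
assert (E : dot (tangential_filter n y z) (n y z) =
  dot (radial f y z) (radial f y z) + edge_cut rho (negb h) y z -
  dot (n y z) (radial f y z) * dot (n y z) (radial f y z)).
{ unfold tangential_filter; set (r := radial f _ _); set (N := n _ _) in *.
  set (k := edge_cut _ _ _ _).
  replace (dot (vsub (vscal (dot r r + k) N) (vscal (dot N r) r)) N)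
    with ((dot r r + k) * dot N N - dot N r * dot N r) by vring.
  rewrite N1; ring. }
rewrite E.
assert (Y0 : forall e s, wire_edge h e = false -> in_edge rho e s ->
  y = edge_y e s -> z = edge_z rho e s ->
  0 < dot (radial f y z) (radial f y z) + edge_cut rho (negb h) y z -
  dot (n y z) (radial f y z) * dot (n y z) (radial f y z)).
{ intros e s We Hs -> ->; rewrite (Y_radius e s We Hs), (normal_radial e s We Hs).
  rewrite edge_cut_eq0; [lra|].
  destruct e; simpl in *; destruct h; simpl in *; congruence. }
unfold inS0, in_edge in *; destruct h; simpl in *.
- destruct (Req_dec y 1) as [->|N]; [apply (Y0 e_right z); simpl; try reflexivity; lra|].
  destruct (Req_dec y (-1)) as [->|N']; [apply (Y0 e_left z); simpl; try reflexivity; lra|].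
  assert (0 < 1 - y * y) by nra; lra.
- destruct (Req_dec z 0) as [->|N]; [apply (Y0 e_bottom y); simpl; try reflexivity; lra|].
  destruct (Req_dec z rho) as [->|N']; [apply (Y0 e_top y); simpl; try reflexivity; lra|].
  assert (0 < z * (rho - z)) by nra; lra.
Qed.

(** A radial field can meet the condition on Y, and the condition on the wires holds
    because it vanishes there with [v]. *)
Lemma exists_acceleration v : C2v v ->
  (forall e s, wire_edge h e = true -> in_edge rho e s ->
     v (edge_y e s) (edge_z rho e s) = vzero) ->
  exists a, acceleration rho theta0 f v a.
Proof.
intros Cv Zv.
exists (fun y z => vscal (dot (v y z) ezed * dot (v y z) ezed - dot (v y z) (v y z))
                     (radial f y z)).
split; [|split].
- apply C2v_scal; [|apply C2v_radial, C2f].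
  assert (Ce := C2_dot v (fun _ _ => ezed) Cv (C2v_const ezed)).
  exact (C2_minus _ _ (C2_mult _ _ Ce Ce) (C2_dot v v Cv Cv)).
- intros e s Hs W; rewrite (Zv e s (wire_edge_wires e s Hs W) (open_in_edge _ _ _ Hs)).
  apply functional_extensionality; intros i; vring.
- intros y z O; destruct (onY_edge y z O) as (e & s & E & Hs & -> & ->).
  change (cyl_normal (at_edge f e s))
    with (at_edge (radial f) e s).
  set (V := v _ _); set (r := radial f _ _).
  replace (dot (vscal (dot V ezed * dot V ezed - dot V V) r) r)
    with ((dot V ezed * dot V ezed - dot V V) * dot r r) by vring.
  unfold r; rewrite (Y_radius e s E Hs), <- vnorm_sqr; ring.
Qed.

(** The field [c n] need not be C^2.  Let [m] be the multiple of [n] whose filtered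
    field has normal component 1, and [m_k] C^2 fields tending to [m]; then
    [c * tangential_filter m_k] is in V and its normal component tends to [c]. *)
Lemma form_nonneg_of_stable c : second_variation_stable rho theta0 sigma f ->
  inVN rho theta0 f c -> 0 <= form c.
Proof.
intros St (C2c & Zc); assert (Cc := C2_C1 c C2c).
assert (Cr2 := C2v_radial f C2f); assert (Cr := C2v_C1v _ Cr2).
set (gain := fun y z => dot (radial f y z) (radial f y z) + edge_cut rho (negb h) y z).
assert (Cgain : C1 gain).
{ exact (C1_plus _ _ (C1_dot _ _ Cr Cr) (C2_C1 _ (C2_edge_cut rho (negb h)))). }
assert (Crn := C1_dot (radial f) n Cr C1n).
assert (Filter : forall u y z, dot (tangential_filter u y z) (n y z) =
  gain y z * dot (u y z) (n y z) -
  dot (u y z) (radial f y z) * dot (radial f y z) (n y z)).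
{ intros u y z; unfold tangential_filter, gain; vring. }
set (psi := fun y z => gain y z * dot (n y z) (n y z) -
  dot (n y z) (radial f y z) * dot (radial f y z) (n y z)).
assert (Cpsi : C1 psi).
{ exact (C1_minus _ _ (C1_mult _ _ Cgain (C1_dot n n C1n C1n))
    (C1_mult _ _ (C1_dot n _ C1n Cr) Crn)). }
destruct (positive_bounded_below rho psi (C1_C0 _ Cpsi)) as (m0 & Hm0 & Hm).
{ intros y z HS; unfold psi; rewrite <- Filter; apply tangential_filter_normal, HS. }
set (m := fun y z => vscal (/ lift_above (m0 / 2) (psi y z)) (n y z)).
assert (Cm : C1v m).
{ apply C1v_scal; [|exact C1n]; apply C1_inv; [|apply C1_lift_above, Cpsi].
  intros y z; assert (K := lift_above_ge (m0 / 2) (psi y z) ltac:(lra)); lra. }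
assert (Ex : forall i, exists gk, (forall k, C2 (gk k)) /\ cv1 rho gk (fun y z => m y z i))
  by (intros i; apply C1_approx, Cm).
destruct (Ex ax_x) as (gx & Gx & Lx), (Ex ax_y) as (gy & Gy & Ly), (Ex ax_z) as (gz & Gz & Lz).
set (mk := fun k y z => mkvec (gx k y z) (gy k y z) (gz k y z)).
assert (C2mk : forall k, C2v (mk k)) by (intros k []; [apply Gx|apply Gy|apply Gz]).
assert (Lmk : forall i, cv1 rho (fun k y z => mk k y z i) (fun y z => m y z i))
  by (intros []; [exact Lx|exact Ly|exact Lz]).
set (vk := fun k y z => vscal (c y z) (tangential_filter (mk k) y z)).
assert (C2vk : forall k, C2v (vk k)).
{ intros k; apply C2v_scal; [exact C2c|apply C2v_tangential_filter, C2mk]. }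
assert (Zv : forall k e s, wire_edge h e = true -> in_edge rho e s ->
  vk k (edge_y e s) (edge_z rho e s) = vzero).
{ intros k e s E Hs; unfold vk.
  rewrite (Zc _ _ (in_edge_S0 rho e s rho_gt0 Hs) (proj1 Hwires e s E Hs)).
  apply functional_extensionality; intros i; vring. }
assert (Vk : forall k, inV rho theta0 f (vk k)).
{ intros k; apply inV_intro; [apply C2vk|exact (Zv k)|].
  intros e s E Hs.
  assert (T := tangential_filter_Y (mk k) e s E Hs); unfold vk.
  set (x := tangential_filter _ _ _) in *; set (r := radial f _ _) in *.
  set (b := c _ _); replace (dot (vscal b x) r) with (b * dot x r) by vring.
  rewrite T; ring. }
assert (Pos : forall k, 0 <= form (fun y z => dot (vk k y z) (n y z))).
{ intros k; destruct (exists_acceleration (vk k) (C2vk k) (Zv k)) as (a & Ha).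
  specialize (St (vk k) a (Vk k) Ha).
  rewrite (second_variation_form (vk k) a (Vk k) Ha) in St.
  apply Rmult_le_reg_l with sigma; [exact sigma_gt0|rewrite Rmult_0_r; exact St]. }
set (T := fun u y z => c y z * (gain y z * dot (u y z) (n y z) -
  dot (u y z) (radial f y z) * dot (radial f y z) (n y z))).
rewrite (form_ext c (T m)).
2:{ intros y z HS; unfold T; rewrite <- Filter, Filter.
    assert (L : lift_above (m0 / 2) (psi y z) = psi y z)
      by (apply lift_above_id; specialize (Hm y z HS); lra).
    assert (P : 0 < psi y z) by (specialize (Hm y z HS); lra).
    unfold m; rewrite L.
    set (N := n y z); set (r := radial f y z).
    replace (gain y z * dot (vscal (/ psi y z) N) N - dot (vscal (/ psi y z) N) r * dot r N)
      with (/ psi y z * (gain y z * dot N N - dot N r * dot r N)) by vring.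
    change (gain y z * dot N N - dot N r * dot r N) with (psi y z).
    field; lra. }
apply (form_nonneg_lim (fun k => T (mk k))).
- exact (cv1_mult rho _ _ _ _ (cv1_const rho c Cc) (cv1_minus rho _ _ _ _
    (cv1_mult rho _ _ _ _ (cv1_const rho gain Cgain) (cv1_dot rho mk m n C1n Lmk))
    (cv1_mult rho _ _ _ _ (cv1_dot rho mk m (radial f) Cr Lmk) (cv1_const rho _ Crn)))).
- intros k; rewrite (form_ext (T (mk k)) (fun y z => dot (vk k y z) (n y z))); [apply Pos|].
  intros y z _; unfold T, vk; rewrite <- Filter; vring.
Qed.

End critical_surface.

Theorem proposition3p2 :
  forall (rho theta0 sigma : R) (f : R -> R -> vec),
    0 < rho -> 0 <= theta0 < PI -> 0 < sigma ->
    admissible rho theta0 f ->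
    critical rho theta0 sigma f ->
    (second_variation_stable rho theta0 sigma f <->
     forall c : R -> R -> R, inVN rho theta0 f c ->
       Y_int rho theta0 f
         (fun e s => (dot (tangent rho f e s) ezed) ^ 2
                     * (c (edge_y e s) (edge_z rho e s)) ^ 2)
       <= surf_int rho f
            (fun y z => (vnorm (sgrad f c y z)) ^ 2
                        + 2 * gauss_curv f y z * (c y z) ^ 2)).
Proof.
intros rho theta0 sigma f Hr _ Hs adm crit.
destruct (admissible_wire_edges rho theta0 f Hr adm) as (h & Hw).
destruct (exists_normal_extension rho f (proj1 adm)) as (n & mu & Hn); [apply adm|].
split.
- intros St c Hc.
  apply (inequality_form rho theta0 f h n mu Hr adm Hw Hn c); [apply C2_C1, Hc|].
  exact (form_nonneg_of_stable rho theta0 sigma f h n mu Hr Hs adm crit Hw Hn c St Hc).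
- intros H; apply (stable_of_form_nonneg rho theta0 sigma f h n mu Hr Hs adm crit Hw Hn).
  intros c Hc.
  apply (inequality_form rho theta0 f h n mu Hr adm Hw Hn c); [apply C2_C1, Hc|].
  exact (H c Hc).
Qed.
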